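(* Let $L_1,\dots,L_n\in H_n(q,\kappa)$ be the Jucys-Murphy elements of the cyclotomic Hecke algebra and put $\mathcal L_i:=f^{-1}(L_i)\in R_n$, where $f:R_n\to H_n(q,\kappa)$ is the Brundan-Kleshchev-Rouquier isomorphism; denote the image of $\mathcal L_i$ in $B_n$ by the same symbol. Then $\{\mathcal L_i: i=1,\dots,n\}$ is a family of JM-elements for $B_n$ with respect to the cellular basis $\mathcal C_n$ (for the order $\lhd$), with content function $c_{\mathfrak s}(i)=q^{\mathrm{res}(\mathfrak s(i))}$. That is: the $\mathcal L_i$ commute, $\mathcal L_i^*=\mathcal L_i$, and for all $\lambda\in\mathrm{Par}^1_{l,n}$, $\mathfrak s,\mathfrak t\in\mathrm{Std}(\lambda)$ and $1\le i\le n$ there are $r_{\mathfrak s\mathfrak v}\in F$ with $$m_{\mathfrak s\mathfrak t}\,\mathcal L_i\equiv q^{\mathrm{res}(\mathfrak t(i))}\,m_{\mathfrak s\mathfrak t}+\sum_{\mathfrak v\in\mathrm{Std}(\lambda),\ \mathfrak v\rhd\mathfrak t}r_{\mathfrak s\mathfrak v}\,m_{\mathfrak s\mathfrak v}\pmod{B_n^\lambda},$$ where $B_n^\lambda$ is the $F$-span of all $m_{\mathfrak a\mathfrak b}$ with $\mathfrak a,\mathfrak b\in\mathrm{Std}(\mu)$, $\mu\in\mathrm{Par}^1_{l,n}$, $\mu\rhd\lambda$.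
   Context: **Combinatorics.** A one-column $l$-multipartition of $n$ is a tuple $\lambda=((1^{a_1}),\dots,(1^{a_l}))$ with integers $a_m\ge 0$, $\sum_m a_m=n$; its diagram is $[\lambda]=\{(r,1,m):1\le m\le l,\ 1\le r\le a_m\}$. $\mathrm{Par}^1_{l,n}$ is the set of all of them. Nodes of $\mathbb N\times\{1\}\times\{1,\dots,l\}$ are totally ordered by: $(r,1,m)\lhd(r',1,m')$ iff $r>r'$, or $r=r'$ and $m>m'$. For finite sets $A,B$ of nodes, $A\unlhd B$ iff $|\{\gamma\in A:\gamma\rhd\gamma_0\}|\le|\{\gamma\in B:\gamma\rhd\gamma_0\}|$ for all nodes $\gamma_0$. $\lambda\unlhd\mu$ iff $[\lambda]\unlhd[\mu]$. A $\lambda$-tableau is a bijection $\mathfrak t:\{1,\dots,n\}\to[\lambda]$; it is standard if its entries increase from top to bottom in every component. $\mathrm{Tab}(\lambda)$, $\mathrm{Std}(\lambda)$: all, resp. standard, $\lambda$-tableaux. For tableaux, $\mathfrak t\unlhd\mathfrak s$ iff $\mathfrak t(\{1,\dots,k\})\unlhd\mathfrak s(\{1,\dots,k\})$ for all $k$. ($\lhd$ denotes the strict orders.) $\mathfrak t^\lambda$ is the $\lambda$-tableau with $\mathfrak t^\lambda(1)\rhd\cdots\rhd\mathfrak t^\lambda(n)$. $S_n$ acts on the right on $\mathrm{Tab}(\lambda)$ by $\mathfrak t w=\mathfrak t\circ w$ (so $\mathfrak t s_k$ interchanges entries $k,k+1$), and $\mathfrak t^\lambda d(\mathfrak t)=\mathfrak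 t$ defines $d(\mathfrak t)\in S_n$. **Algebras.** Fix integers $e,l,n>1$, a field $F$ and a primitive $e$-th root of unity $q\in F\setminus\{1\}$; $I_e=\mathbb Z/e\mathbb Z$; $S_n$ acts on $I_e^n$ by permuting coordinates. Fix $\hat\kappa\in\mathbb Z^l$; $\kappa_m\in I_e$ is the image of $\hat\kappa_m$, also identified with its representative in $\{0,\dots,e-1\}$. $\hat\kappa$ is strongly adjacency-free: (i) $\hat\kappa_{m+1}-\hat\kappa_m\ge n$; (ii) $\kappa_i-\kappa_j\not\equiv 0,\pm1\bmod e$ for $i\ne j$; (iii) $\kappa_1\not\equiv\kappa_l+2\bmod e$; (iv) $\kappa_1<\dots<\kappa_l$. The generalized blob algebra $B_n$ is the unital associative $F$-algebra with generators $\psi_1,\dots,\psi_{n-1},y_1,\dots,y_n,e(\boldsymbol i)$ ($\boldsymbol i\in I_e^n$) and relations: $e(\boldsymbol i)e(\boldsymbol j)=\delta_{\boldsymbol i\boldsymbol j}e(\boldsymbol i)$; $\sum_{\boldsymbol i}e(\boldsymbol i)=1$; $e(\boldsymbol i)=0$ if $i_1\notin\{\kappa_1,\dots,\kappa_l\}$; (†) $e(\boldsymbol i)=0$ if $i_1\in\{\kappa_1,\dots,\kappa_l\}$ and $i_2=i_1+1$; $y_1e(\boldsymbol i)=0$ if $i_1\in\{\kappa_1,\dots,\kappa_l\}$; $y_re(\boldsymbol i)=e(\boldsymbol i)y_r$; $\psi_re(\boldsymbol i)=e(s_r\cdot\boldsymbol i)\psi_r$; $y_ry_s=y_sy_r$;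 $\psi_ry_s=y_s\psi_r$ if $s\ne r,r+1$; $\psi_r\psi_s=\psi_s\psi_r$ if $|r-s|>1$; $\psi_ry_{r+1}e(\boldsymbol i)=(y_r\psi_r-\delta_{i_r,i_{r+1}})e(\boldsymbol i)$; $y_{r+1}\psi_re(\boldsymbol i)=(\psi_ry_r-\delta_{i_r,i_{r+1}})e(\boldsymbol i)$; $\psi_r^2e(\boldsymbol i)$ equals $0$ if $i_r=i_{r+1}$, $e(\boldsymbol i)$ if $i_r\ne i_{r+1},i_{r+1}\pm1$, $(y_{r+1}-y_r)e(\boldsymbol i)$ if $i_{r+1}=i_r+1$, $(y_r-y_{r+1})e(\boldsymbol i)$ if $i_{r+1}=i_r-1$; $\psi_r\psi_{r+1}\psi_re(\boldsymbol i)=(\psi_{r+1}\psi_r\psi_{r+1}+\alpha)e(\boldsymbol i)$ with $\alpha=-1$ if $i_{r+2}=i_r=i_{r+1}-1$, $\alpha=1$ if $i_{r+2}=i_r=i_{r+1}+1$, $\alpha=0$ otherwise. The cyclotomic KLR algebra $R_n$ has the same presentation with relation (†) omitted; so $B_n$ is a quotient of $R_n$. $*$ is the anti-involution (of $R_n$ and $B_n$) fixing all generators. $H_n(q,\kappa)$ is the $F$-algebra with generators $L_1,\dots,L_n,T_1,\dots,T_{n-1}$ and relations $(L_1-q^{\kappa_1})\cdots(L_1-q^{\kappa_l})=0$, $(T_r+1)(T_r-q)=0$, $T_sT_{s+1}T_s=T_{s+1}T_sT_{s+1}$, $L_rL_s=L_sL_r$, $T_rL_r=L_{r+1}(T_r-q+1)$,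 $T_rL_s=L_sT_r$ if $s\ne r,r+1$, $T_rT_s=T_sT_r$ if $|r-s|>1$. The isomorphism of $F$-algebras $f:R_n\to H_n(q,\kappa)$ is that of Brundan-Kleshchev and Rouquier: $f(e(\boldsymbol i))$ is the idempotent projecting onto the simultaneous generalized eigenspace of $L_1,\dots,L_n$ with eigenvalues $q^{i_1},\dots,q^{i_n}$, and $f(y_k)f(e(\boldsymbol i))=(1-q^{-i_k}L_k)f(e(\boldsymbol i))$. By Brundan-Kleshchev, $f^{-1}(L_k)=\sum_{\boldsymbol i\in I_e^n}q^{i_k}(1-y_k)e(\boldsymbol i)$, which may be taken as the definition of $\mathcal L_k$. **The set $\mathcal C_n$.** The residue of $(r,1,m)$ is $\mathrm{res}=\kappa_m+1-r\in I_e$; the residue sequence of $\mathfrak t$ is $(\mathrm{res}(\mathfrak t(1)),\dots,\mathrm{res}(\mathfrak t(n)))$, and $\boldsymbol i^\lambda$ is that of $\mathfrak t^\lambda$. For each $w\in S_n$ a reduced expression $w=s_{i_1}\cdots s_{i_N}$ ($s_k=(k,k+1)$) is chosen once and for all and $\psi_w:=\psi_{i_1}\cdots\psi_{i_N}$. For $\mathfrak s,\mathfrak t\in\mathrm{Tab}(\lambda)$, $m_{\mathfrak s\mathfrak t}:=\psi_{d(\mathfrak s)}^*e(\boldsymbol i^\lambda)\psi_{d(\mathfrak t)}\in B_n$, and $\mathcal C_n:=\{m_{\mathfrak s\mathfrak t}:\lambda\in\mathrm{Par}^1_{l,n},\ \mathfrak s,\mathfrak t\in\mathrm{Std}(\lambda)\}$;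 it is a cellular basis of $B_n$ with poset $(\mathrm{Par}^1_{l,n},\unlhd)$. *)

(* Defs.v *)
From HB Require Import structures.
From mathcomp Require Import all_boot all_algebra fingroup perm finmap boolp.
From mathcomp Require Import generic_quotient zify.

Set Implicit Arguments.
Unset Strict Implicit.
Unset Printing Implicit Defensive.

Import GRing.Theory.
Local Open Scope ring_scope.
Local Open Scope quotient_scope.

(** * Unital associative algebras presented by generators and relations

    [presAlg Rel] is the quotient of the expressions in the generators [G] by
    the least congruence that contains [Rel] and the axioms of unital
    associative [F]-algebras. MathComp's [algType] demands [1 != 0], which a
    presentation does not guarantee: [presAlg Rel] is given a [pzRingType] and
    an [lmodType F] structure, made compatible by [presZAl] and [presZAr]. *)

Inductive term (F G : Type) : Type :=
| TGen of G
| TZero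
| TOne
| TOpp of term F G
| TAdd of term F G & term F G
| TMul of term F G & term F G
| TScale of F & term F G.
Arguments TGen {F G}.
Arguments TZero {F G}.
Arguments TOne {F G}.

Declare Scope pres_scope.
Delimit Scope pres_scope with P.
Bind Scope pres_scope with term.
Notation "0" := TZero : pres_scope.
Notation "1" := TOne : pres_scope.
Notation "- x" := (TOpp x) : pres_scope.
Notation "x + y" := (TAdd x y) : pres_scope.
Notation "x - y" := (TAdd x (TOpp y)) : pres_scope.
Notation "x * y" := (TMul x y) : pres_scope.
Notation "c *: x" := (TScale c x) : pres_scope.

Section Presentation.
Variables (F : fieldType) (G : Type).
Implicit Types (Rel : term F G -> term F G -> Prop) (a b c d : term F G).

Inductive cong Rel : term F G -> term F G -> Prop :=
| cong_rel a b : Rel a b -> cong Rel a b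
| cong_refl a : cong Rel a a
| cong_sym a b : cong Rel a b -> cong Rel b a
| cong_trans b a c : cong Rel a b -> cong Rel b c -> cong Rel a c
| cong_opp a b : cong Rel a b -> cong Rel (- a) (- b)
| cong_add a b c d : cong Rel a b -> cong Rel c d -> cong Rel (a + c) (b + d)
| cong_mul a b c d : cong Rel a b -> cong Rel c d -> cong Rel (a * c) (b * d)
| cong_scale (x : F) a b : cong Rel a b -> cong Rel (x *: a) (x *: b)
| cong_addA a b c : cong Rel (a + (b + c)) (a + b + c)
| cong_addC a b : cong Rel (a + b) (b + a)
| cong_add0 a : cong Rel (0 + a) a
| cong_addN a : cong Rel (- a + a) 0
| cong_mulA a b c : cong Rel (a * (b * c)) (a * b * c)
| cong_mul1l a : cong Rel (1 * a) a
| cong_mul1r a : cong Rel (a * 1) a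
| cong_mulDl a b c : cong Rel ((a + b) * c) (a * c + b * c)
| cong_mulDr a b c : cong Rel (a * (b + c)) (a * b + a * c)
| cong_scaleA (x y : F) a : cong Rel (x *: (y *: a)) ((x * y)%R *: a)
| cong_scale1 a : cong Rel (1%R *: a) a
| cong_scaleDr (x : F) a b : cong Rel (x *: (a + b)) (x *: a + x *: b)
| cong_scaleDl (x y : F) a : cong Rel ((x + y)%R *: a) (x *: a + y *: a)
| cong_scaleAl (x : F) a b : cong Rel (x *: (a * b)) ((x *: a) * b)
| cong_scaleAr (x : F) a b : cong Rel (x *: (a * b)) (a * (x *: b)).

HB.instance Definition _ := gen_eqMixin (term F G).
HB.instance Definition _ := gen_choiceMixin (term F G).

Definition congb Rel : rel (term F G) := fun a b => `[< cong Rel a b >].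

Lemma congb_refl Rel : reflexive (congb Rel).
Proof. by move=> a; apply/asboolP; apply: cong_refl. Qed.
Lemma congb_sym Rel : symmetric (congb Rel).
Proof. by move=> a b; apply/asboolP/asboolP; apply: cong_sym. Qed.
Lemma congb_trans Rel : transitive (congb Rel).
Proof.
move=> b a c /asboolP ab /asboolP bc; apply/asboolP.
exact: cong_trans ab bc.
Qed.
Definition cong_equiv Rel :=
  EquivRel (congb Rel) (@congb_refl Rel) (@congb_sym Rel) (@congb_trans Rel).

Definition presAlg Rel := {eq_quot cong_equiv Rel}.
End Presentation.

Section PresAlg.
Variables (F : fieldType) (G : Type) (Rel : term F G -> term F G -> Prop).
Notation A := (presAlg Rel).

HB.instance Definition _ := Choice.on A.

Definition cls (a : term F G) : A := \pi_A a.

Lemma cls_eq a b : cls a = cls b <-> cong Rel a b.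
Proof.
split; first by move=> /eqmodP /asboolP.
by move=> h; apply/eqmodP/asboolP.
Qed.

Lemma clsP (x : A) : cls (repr x) = x.
Proof. exact: reprK. Qed.

Lemma repr_cls a : cong Rel (repr (cls a)) a.
Proof. by apply/cls_eq; rewrite clsP. Qed.

Definition pres_add (x y : A) : A := cls (repr x + repr y).
Definition pres_opp (x : A) : A := cls (- repr x).
Definition pres_mul (x y : A) : A := cls (repr x * repr y).
Definition pres_scale (c : F) (x : A) : A := cls (c *: repr x).

Let clsD a b : pres_add (cls a) (cls b) = cls (a + b).
Proof. by apply/cls_eq; apply: cong_add; apply: repr_cls. Qed.
Let clsN a : pres_opp (cls a) = cls (- a).
Proof. by apply/cls_eq; apply: cong_opp; apply: repr_cls. Qed.
Let clsM a b : pres_mul (cls a) (cls b) = cls (a * b).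
Proof. by apply/cls_eq; apply: cong_mul; apply: repr_cls. Qed.
Let clsZ c a : pres_scale c (cls a) = cls (c *: a).
Proof. by apply/cls_eq; apply: cong_scale; apply: repr_cls. Qed.

Let clsE := (clsD, clsN, clsM, clsZ).
Let elim_cls (P : A -> Prop) : (forall a, P (cls a)) -> forall x, P x.
Proof. by move=> h x; rewrite -(clsP x). Qed.

Let addA : associative pres_add.
Proof.
by do 3!elim/elim_cls=> ?; rewrite !clsE; apply/cls_eq; apply: cong_addA.
Qed.
Let addC : commutative pres_add.
Proof.
by do 2!elim/elim_cls=> ?; rewrite !clsE; apply/cls_eq;
apply: cong_addC.
Qed.
Let add0 : left_id (cls 0) pres_add.
Proof. by elim/elim_cls=> ?; rewrite !clsE; apply/cls_eq; apply: cong_add0. Qed.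
Let addN : left_inverse (cls 0) pres_opp pres_add.
Proof. by elim/elim_cls=> ?; rewrite !clsE; apply/cls_eq; apply: cong_addN. Qed.
HB.instance Definition _ := GRing.isZmodule.Build A addA addC add0 addN.

Let mulA : associative pres_mul.
Proof.
by do 3!elim/elim_cls=> ?; rewrite !clsE; apply/cls_eq; apply: cong_mulA.
Qed.
Let mul1l : left_id (cls 1) pres_mul.
Proof.
by elim/elim_cls=> ?; rewrite !clsE; apply/cls_eq;
apply: cong_mul1l.
Qed.
Let mul1r : right_id (cls 1) pres_mul.
Proof.
by elim/elim_cls=> ?; rewrite !clsE; apply/cls_eq;
apply: cong_mul1r.
Qed.
Let mulDl : left_distributive pres_mul pres_add.
Proof.
by do 3!elim/elim_cls=> ?; rewrite !clsE; apply/cls_eq; apply: cong_mulDl.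
Qed.
Let mulDr : right_distributive pres_mul pres_add.
Proof.
by do 3!elim/elim_cls=> ?; rewrite !clsE; apply/cls_eq; apply: cong_mulDr.
Qed.
HB.instance Definition _ :=
  GRing.Zmodule_isPzRing.Build A mulA mul1l mul1r mulDl mulDr.

Let scaleA a b v : pres_scale a (pres_scale b v) = pres_scale (a * b) v.
Proof.
by elim/elim_cls: v=> v; rewrite !clsE; apply/cls_eq;
apply: cong_scaleA.
Qed.
Let scale1 : left_id 1 pres_scale.
Proof.
by elim/elim_cls=> ?; rewrite !clsE; apply/cls_eq;
apply: cong_scale1.
Qed.
Let scaleDr : right_distributive pres_scale pres_add.
Proof.
by move=> c; do 2!elim/elim_cls=> ?; rewrite !clsE; apply/cls_eq;
apply: cong_scaleDr.
Qed.
Let scaleDl v : {morph pres_scale^~ v : a b / a + b >-> pres_add a b}.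
Proof.
by move=> a b; elim/elim_cls: v=> v; rewrite !clsE; apply/cls_eq;
apply: cong_scaleDl.
Qed.
HB.instance Definition _ :=
  GRing.Zmodule_isLmodule.Build F A scaleA scale1 scaleDr scaleDl.

Lemma cls0 : cls 0 = 0. Proof. by []. Qed.
Lemma cls1 : cls 1 = 1. Proof. by []. Qed.
Lemma cls_opp a : cls (- a)%P = - cls a. Proof. by rewrite -clsN. Qed.
Lemma cls_add a b : cls (a + b)%P = cls a + cls b. Proof. by rewrite -clsD. Qed.
Lemma cls_mul a b : cls (a * b)%P = cls a * cls b. Proof. by rewrite -clsM. Qed.
Lemma cls_scale c a : cls (c *: a)%P = c *: cls a. Proof. by rewrite -clsZ. Qed.

Lemma presZAl (c : F) (x y : A) : c *: (x * y) = (c *: x) * y.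
Proof.
rewrite -(clsP x) -(clsP y) -cls_mul -!cls_scale -cls_mul.
by apply/cls_eq; apply: cong_scaleAl.
Qed.
Lemma presZAr (c : F) (x y : A) : c *: (x * y) = x * (c *: y).
Proof.
rewrite -(clsP x) -(clsP y) -cls_mul -!cls_scale -cls_mul.
by apply/cls_eq; apply: cong_scaleAr.
Qed.

Definition pgen (g : G) : A := cls (TGen g).

Lemma presP a b : Rel a b -> cls a = cls b.
Proof. by move=> h; apply/cls_eq; apply: cong_rel. Qed.

End PresAlg.

Definition clsE := (cls0, cls1, cls_opp, cls_add, cls_mul, cls_scale).

(** When [R1] is contained in [R2], the canonical projection. *)
Section Quotient.
Variables (F : fieldType) (G : Type) (R1 R2 : term F G -> term F G -> Prop).
Hypothesis R12 : forall a b, R1 a b -> R2 a b.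

Lemma cong_mono a b : cong R1 a b -> cong R2 a b.
Proof.
elim=> *; [exact/cong_rel/R12 | exact: cong_refl | exact: cong_sym
  | by apply: cong_trans; eassumption | exact: cong_opp | exact: cong_add
  | exact: cong_mul | exact: cong_scale | exact: cong_addA | exact: cong_addC
  | exact: cong_add0 | exact: cong_addN | exact: cong_mulA | exact: cong_mul1l
  | exact: cong_mul1r | exact: cong_mulDl | exact: cong_mulDr
  | exact: cong_scaleA | exact: cong_scale1 | exact: cong_scaleDr
  | exact: cong_scaleDl | exact: cong_scaleAl | exact: cong_scaleAr].
Qed.

Definition pres_quo (x : presAlg R1) : presAlg R2 := cls R2 (repr x).

Lemma pres_quo_cls a : pres_quo (cls R1 a) = cls R2 a.
Proof. by apply/cls_eq/cong_mono/repr_cls. Qed.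
End Quotient.

(** The anti-involution fixing all generators, available as soon as the
    relations are stable under reversing products. *)
Section Star.
Variables (F : fieldType) (G : Type).

Fixpoint term_star (a : term F G) : term F G :=
  match a with
  | TGen g => TGen g
  | TZero => 0
  | TOne => 1
  | TOpp b => - term_star b
  | TAdd b c => term_star b + term_star c
  | TMul b c => term_star c * term_star b
  | TScale x b => x *: term_star b
  end%P.

Variable Rel : term F G -> term F G -> Prop.
Hypothesis Rel_star :
  forall a b, Rel a b -> cong Rel (term_star a) (term_star b).

Lemma cong_star a b : cong Rel a b -> cong Rel (term_star a) (term_star b).
Proof.
elim=> /= *; [exact: Rel_star | exact: cong_refl | exact: cong_sym
  | by apply: cong_trans; eassumption | exact: cong_opp | exact: cong_add
  | exact: cong_mul | exact: cong_scale | exact: cong_addA | exact: cong_addC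
  | exact: cong_add0 | exact: cong_addN | exact/cong_sym/cong_mulA
  | exact: cong_mul1r | exact: cong_mul1l | exact: cong_mulDr
  | exact: cong_mulDl | exact: cong_scaleA | exact: cong_scale1
  | exact: cong_scaleDr | exact: cong_scaleDl | exact: cong_scaleAr
  | exact: cong_scaleAl].
Qed.

Definition pres_star (x : presAlg Rel) : presAlg Rel :=
  cls Rel (term_star (repr x)).

Lemma pres_star_cls a : pres_star (cls Rel a) = cls Rel (term_star a).
Proof. by apply/cls_eq/cong_star/repr_cls. Qed.

Lemma pres_star_gen g : pres_star (pgen Rel g) = pgen Rel g.
Proof. exact: pres_star_cls. Qed.
Lemma pres_starD x y : pres_star (x + y) = pres_star x + pres_star y.
Proof.
by rewrite -(clsP x) -(clsP y) -cls_add !pres_star_cls -cls_add.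
Qed.
Lemma pres_starM x y : pres_star (x * y) = pres_star y * pres_star x.
Proof.
by rewrite -(clsP x) -(clsP y) -cls_mul !pres_star_cls -cls_mul.
Qed.
Lemma pres_starZ c x : pres_star (c *: x) = c *: pres_star x.
Proof. by rewrite -(clsP x) -cls_scale !pres_star_cls -cls_scale. Qed.
Lemma pres_starK x : pres_star (pres_star x) = x.
Proof.
rewrite -(clsP x) !pres_star_cls; congr (cls _ _).
by elim: (repr x) => //= [? -> | ? -> ? -> | ? -> ? -> | ? ? ->].
Qed.
End Star.

(** * Words in the symmetric group

    ['I_n] stands for {1, ..., n} and ['I_n.-1] for the indices of the simple
    transpositions, both shifted by one. *)
Section Words.
Variable n : nat.

Definition lo (r : 'I_n.-1) : 'I_n := widen_ord (leq_pred n) r.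

Lemma hi_subproof (r : 'I_n.-1) : (r.+1 < n)%N.
Proof. by rewrite -ltn_predRL ltn_ord. Qed.
Definition hi (r : 'I_n.-1) : 'I_n := Ordinal (hi_subproof r).

Definition stransp (r : 'I_n.-1) : 'S_n := tperm (lo r) (hi r).

(** Tableaux are acted on by [t w = t \o w], so products of permutations are
    compositions ([(v w) k = v (w k)]), whereas [(v * w)%g k = w (v k)]: the
    word [r1 :: ... :: rN] is sent to the function s_r1 \o ... \o s_rN. *)
Definition word_perm (w : seq 'I_n.-1) : 'S_n :=
  foldr (fun r v => (v * stransp r)%g) 1%g w.

Definition reduced_expr (v : 'S_n) (w : seq 'I_n.-1) : Prop :=
  word_perm w = v /\ forall w', word_perm w' = v -> (size w <= size w')%N.
End Words.

(** * Cyclotomic KLR algebras and generalized blob algebras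

    ['Z_e] is the ring of integers modulo [e] only when [1 < e]. The generators
    are psi_r, y_k and the idempotents e(i). *)

Inductive klr_gen (e n : nat) : Type :=
| KPsi of 'I_n.-1
| KY of 'I_n
| KIdem of {ffun 'I_n -> 'Z_e}.

Section KLR.
Variables (F : fieldType) (e l n : nat) (kappa : 'I_l -> 'Z_e).
Notation resseq := {ffun 'I_n -> 'Z_e}.
Notation klr_term := (term F (klr_gen e n)).

Implicit Types (r s : 'I_n.-1) (k : 'I_n) (i : resseq).

Definition sact (r : 'I_n.-1) (i : resseq) : resseq :=
  [ffun k => i (stransp r k)].

Local Notation psi r := (TGen (KPsi e r) : klr_term).
Local Notation y k := (TGen (KY e k) : klr_term).
Local Notation idm i := (TGen (KIdem i) : klr_term).

Definition braid_coef (i : resseq) (r s : 'I_n.-1) : F :=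
  if (i (hi s) == i (lo r)) && (i (lo r) == i (hi r) - 1) then - 1
  else if (i (hi s) == i (lo r)) && (i (lo r) == i (hi r) + 1) then 1
  else 0.

Local Open Scope pres_scope.
Inductive klr_rel : klr_term -> klr_term -> Prop :=
| klr_idem (i j : resseq) :
    klr_rel (idm i * idm j) (if i == j then idm i else TZero)
| klr_sum1 : klr_rel (\big[@TAdd F (klr_gen e n)/TZero]_(i : resseq) idm i) 1
| klr_init (i : resseq) (k : 'I_n) : k = 0%N :> nat ->
    (forall m, i k != kappa m) -> klr_rel (idm i) 0
| klr_y1 (i : resseq) (k : 'I_n) (m : 'I_l) : k = 0%N :> nat -> i k = kappa m ->
    klr_rel (y k * idm i) 0
| klr_y_idem (k : 'I_n) (i : resseq) : klr_rel (y k * idm i) (idm i * y k)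
| klr_psi_idem (r : 'I_n.-1) (i : resseq) :
    klr_rel (psi r * idm i) (idm (sact r i) * psi r)
| klr_yy (k k' : 'I_n) : klr_rel (y k * y k') (y k' * y k)
| klr_psi_y (r : 'I_n.-1) (k : 'I_n) : k != lo r -> k != hi r ->
    klr_rel (psi r * y k) (y k * psi r)
| klr_psi_psi (r s : 'I_n.-1) : (r.+1 < s)%N || (s.+1 < r)%N ->
    klr_rel (psi r * psi s) (psi s * psi r)
| klr_psi_yhi (r : 'I_n.-1) (i : resseq) :
    klr_rel (psi r * y (hi r) * idm i)
            ((y (lo r) * psi r - ((i (lo r) == i (hi r))%:R : F) *: 1) * idm i)
| klr_yhi_psi (r : 'I_n.-1) (i : resseq) :
    klr_rel (y (hi r) * psi r * idm i)
            ((psi r * y (lo r) - ((i (lo r) == i (hi r))%:R : F) *: 1) * idm i)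
| klr_psi2_eq (r : 'I_n.-1) (i : resseq) : i (lo r) = i (hi r) ->
    klr_rel (psi r * psi r * idm i) 0
| klr_psi2_far (r : 'I_n.-1) (i : resseq) :
    [&& i (lo r) != i (hi r), i (lo r) != (i (hi r) + 1)%R
      & i (lo r) != (i (hi r) - 1)%R] ->
    klr_rel (psi r * psi r * idm i) (idm i)
| klr_psi2_up (r : 'I_n.-1) (i : resseq) : i (hi r) = (i (lo r) + 1)%R ->
    klr_rel (psi r * psi r * idm i) ((y (hi r) - y (lo r)) * idm i)
| klr_psi2_down (r : 'I_n.-1) (i : resseq) : i (hi r) = (i (lo r) - 1)%R ->
    klr_rel (psi r * psi r * idm i) ((y (lo r) - y (hi r)) * idm i)
| klr_braid (r s : 'I_n.-1) (i : resseq) : s = r.+1 :> nat ->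
    klr_rel (psi r * psi s * psi r * idm i)
            ((psi s * psi r * psi s + braid_coef i r s *: 1) * idm i).

Inductive blob_rel : klr_term -> klr_term -> Prop :=
| blob_klr a b : klr_rel a b -> blob_rel a b
| blob_init (i : resseq) (k k' : 'I_n) (m : 'I_l) :
    k = 0%N :> nat -> k' = 1%N :> nat -> i k = kappa m ->
    i k' = (i k + 1)%R -> blob_rel (idm i) 0.

Local Close Scope pres_scope.

Definition klrAlg := presAlg klr_rel.
Definition blobAlg := presAlg blob_rel.

Definition klr_to_blob : klrAlg -> blobAlg := @pres_quo _ _ klr_rel blob_rel.

Lemma klr_to_blob_cls a : klr_to_blob (cls klr_rel a) = cls blob_rel a.
Proof. exact: pres_quo_cls blob_klr a. Qed.

Lemma sact_lo r i : sact r i (lo r) = i (hi r).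
Proof. by rewrite ffunE tpermL. Qed.
Lemma sact_hi r i : sact r i (hi r) = i (lo r).
Proof. by rewrite ffunE tpermR. Qed.
Lemma sactK r i : sact r (sact r i) = i.
Proof. by apply/ffunP => k; rewrite !ffunE tpermK. Qed.
Lemma sact_id r i : i (lo r) = i (hi r) -> sact r i = i.
Proof. by move=> h; apply/ffunP => k; rewrite ffunE;
case: tpermP => [->|->|].
Qed.

Let hi_lo (r s : 'I_n.-1) : s = r.+1 :> nat -> lo s = hi r.
Proof. by move=> h; apply: val_inj. Qed.

Lemma sact_braid (r s : 'I_n.-1) i k : s = r.+1 :> nat ->
  (sact r (sact s (sact r i)) k = i (tperm (lo r) (hi s) k)) *
  (sact s (sact r (sact s i)) k = i (tperm (lo r) (hi s) k)).
Proof.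
move=> h; have hE := hi_lo h.
have r0 : lo r != hi r by rewrite -val_eqE /= neq_ltn ltnSn.
have s0 : lo s != hi s by rewrite -val_eqE /= neq_ltn ltnSn.
have rs : lo r != hi s by rewrite -val_eqE /= h neq_ltn ltnW.
have tpermVJ (x y z t : 'I_n) : (tperm x y * (tperm z t * tperm x y))%g =
    tperm (tperm x y z) (tperm x y t) by rewrite -tpermJ conjgE tpermV.
have rs' : hi r != hi s by rewrite -hE.
rewrite !ffunE -!permM /stransp !tpermVJ hE tpermR tpermL.
have -> : tperm (hi r) (hi s) (lo r) = lo r by rewrite tpermD // eq_sym.
by rewrite (tpermD rs rs').
Qed.

Lemma braid_coef_star (r s : 'I_n.-1) i : s = r.+1 :> nat ->
  braid_coef i r s = 0 \/ sact r (sact s (sact r i)) = i.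
Proof.
move=> h; case: (eqVneq (i (hi s)) (i (lo r))) => [E|/negPf N]; last first.
  by left; rewrite /braid_coef N.
right; apply/ffunP => k; rewrite (sact_braid _ _ h).1.
by case: tpermP => [->|->|].
Qed.

Lemma blob_rel_star a b :
  blob_rel a b -> cong blob_rel (term_star a) (term_star b).
Proof.
pose A := presAlg blob_rel.
pose P r : A := pgen blob_rel (KPsi e r).
pose U k : A := pgen blob_rel (KY e k).
pose E i : A := pgen blob_rel (KIdem i).
have K c d : klr_rel c d -> cls blob_rel c = cls blob_rel d.
  by move=> h; apply/presP/blob_klr.
have UE k i : U k * E i = E i * U k.
  by move: (K _ _ (klr_y_idem k i)); rewrite !clsE.
have EP i r : E i * P r = P r * E (sact r i).
  by move: (K _ _ (klr_psi_idem r (sact r i))); rewrite !clsE sactK.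
have EPP i r : E i * (P r * P r) = P r * P r * E i.
  by rewrite mulrA EP -mulrA EP sactK mulrA.
have EPPP i r s t : E i * (P r * (P s * P t)) =
    P r * P s * P t * E (sact t (sact s (sact r i))).
  by rewrite mulrA EP -(mulrA (P r)) (mulrA (E _)) EP -(mulrA (P s)) EP !mulrA.
have dE i r :
  (sact r i (lo r) == sact r i (hi r))%:R *: E (sact r i) =
  (i (lo r) == i (hi r))%:R *: E i :> A.
  rewrite sact_lo sact_hi eq_sym; case: eqP => [/sact_id -> //|_].
  by rewrite !scale0r.
case=> {a b} [a b ab|]; last first.
  by move=> i k k' m hk hk' h h'; apply/cong_rel/(blob_init hk hk' h h').
apply/cls_eq; case: ab => /=.
- move=> i j; rewrite eq_sym.
  have := K _ _ (klr_idem j i); case: eqP => [->|_] //.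
- have -> : term_star (\big[@TAdd F (klr_gen e n)/TZero]_(i : resseq)
        TGen (KIdem i))
      = \big[@TAdd F (klr_gen e n)/TZero]_(i : resseq) TGen (KIdem i).
    exact: (big_morph (@term_star F (klr_gen e n))).
  exact: K klr_sum1.
- by move=> i k hk h; apply/K/(klr_init hk h).
- move=> i k m hk h; have := K _ _ (klr_y1 hk h).
  by rewrite !clsE -/(U k) -/(E i) UE.
- by move=> k i; rewrite !clsE -/(U k) -/(E i) UE.
- by move=> r i; rewrite !clsE -/(P r) -!/(E _) EP.
- by move=> k k'; apply/esym/K/klr_yy.
- by move=> r k h h'; apply/esym/K/klr_psi_y.
- by move=> r s h; apply/esym/K/klr_psi_psi.
- move=> r i; have := K _ _ (klr_yhi_psi r (sact r i)).
  rewrite !clsE -!/(U _) -!/(P _) -!/(E _) => h.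
  rewrite mulrA -UE -mulrA EP mulrA h.
  rewrite mulrBl mulrBr -presZAl -presZAr mulr1 mul1r dE.
  by rewrite mulrA EP -!mulrA UE.
- move=> r i; have := K _ _ (klr_psi_yhi r (sact r i)).
  rewrite !clsE -!/(U _) -!/(P _) -!/(E _) => h.
  rewrite mulrA EP -mulrA -UE mulrA h.
  rewrite mulrBl mulrBr -presZAl -presZAr mulr1 mul1r dE.
  by rewrite [in RHS]mulrA -UE -!mulrA EP.
- move=> r i h; have := K _ _ (klr_psi2_eq h).
  by rewrite !clsE -!/(P _) -!/(E _) EPP.
- move=> r i h; have := K _ _ (klr_psi2_far h).
  by rewrite !clsE -!/(P _) -!/(E _) EPP.
- move=> r i h; have := K _ _ (klr_psi2_up h).
  rewrite !clsE -!/(P _) -!/(E _) -!/(U _) EPP => ->.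
  by rewrite mulrBl mulrBr !UE.
- move=> r i h; have := K _ _ (klr_psi2_down h).
  rewrite !clsE -!/(P _) -!/(E _) -!/(U _) EPP => ->.
  by rewrite mulrBl mulrBr !UE.
move=> r s i h; pose j := sact r (sact s (sact r i)).
have ji : sact s (sact r (sact s i)) = j.
  by apply/ffunP => k; rewrite !(sact_braid _ _ h).
have := K _ _ (klr_braid j h).
rewrite !clsE -!/(P _) -!/(E _) => hb.
rewrite mulrDr -presZAr mulr1.
rewrite (EPPP i r s r) -/j hb mulrDl -presZAl mul1r; congr (_ + _).
  by rewrite EPPP ji.
have [i0|iE] := braid_coef_star i h; last by rewrite /j iE.
have [j0|ij] := braid_coef_star j h.
  by rewrite i0 j0 !scale0r.
have -> : j = i.
  rewrite -ij; apply/ffunP => k.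
  by rewrite (sact_braid _ _ h).1 (sact_braid _ _ h).1 tpermK.
by [].
Qed.

Definition blob_star : blobAlg -> blobAlg := pres_star (Rel := blob_rel).
End KLR.

(** * Cyclotomic Hecke algebras and the Jucys-Murphy elements *)

Inductive hecke_gen (n : nat) : Type :=
| HL of 'I_n
| HT of 'I_n.-1.

Section Hecke.
Variables (F : fieldType) (e l n : nat) (q : F) (kappa : 'I_l -> 'Z_e).

Definition qpow (a : 'Z_e) : F := q ^+ (a : nat).

Notation hecke_term := (term F (hecke_gen n)).
Local Notation L k := (TGen (HL k) : hecke_term).
Local Notation T r := (TGen (HT r) : hecke_term).

Local Open Scope pres_scope.
Inductive hecke_rel : hecke_term -> hecke_term -> Prop :=
| hecke_cyclotomic (k : 'I_n) : k = 0%N :> nat ->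
    hecke_rel (\big[@TMul F (hecke_gen n)/TOne]_(m < l)
                 (L k - qpow (kappa m) *: 1)) 0
| hecke_quadratic (r : 'I_n.-1) : hecke_rel ((T r + 1) * (T r - q *: 1)) 0
| hecke_braid (r s : 'I_n.-1) : s = r.+1 :> nat ->
    hecke_rel (T r * T s * T r) (T s * T r * T s)
| hecke_LL (k k' : 'I_n) : hecke_rel (L k * L k') (L k' * L k)
| hecke_TL_lo (r : 'I_n.-1) :
    hecke_rel (T r * L (lo r)) (L (hi r) * (T r - q *: 1 + 1))
| hecke_TL (r : 'I_n.-1) (k : 'I_n) : k != lo r -> k != hi r ->
    hecke_rel (T r * L k) (L k * T r)
| hecke_TT (r s : 'I_n.-1) : (r.+1 < s)%N || (s.+1 < r)%N ->
    hecke_rel (T r * T s) (T s * T r).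
Local Close Scope pres_scope.

Definition heckeAlg := presAlg hecke_rel.
Definition hecke_L (k : 'I_n) : heckeAlg := pgen hecke_rel (HL k).

Local Notation klrAlg := (klrAlg F n kappa).
Definition klr_y (k : 'I_n) : klrAlg := pgen _ (KY e k).
Definition klr_idm (i : {ffun 'I_n -> 'Z_e}) : klrAlg := pgen _ (KIdem i).

(** The properties characterizing the Brundan-Kleshchev-Rouquier isomorphism:
    [f (klr_idm i)] fixes exactly the simultaneous generalized eigenspace. *)
Record is_BKR (f : klrAlg -> heckeAlg) : Prop := {
  BKR_linear : linear f;
  BKR_mult : monoid_morphism f;
  BKR_bij : bijective f;
  BKR_idm : forall i h, f (klr_idm i) * h = h <->
    exists N, forall k, (hecke_L k - qpow (i k) *: (1 : heckeAlg)) ^+ N * h = 0;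
  BKR_y : forall k i, f (klr_y k) * f (klr_idm i) =
    (1 - (qpow (i k))^-1 *: hecke_L k) * f (klr_idm i) }.

Definition klr_JM (k : 'I_n) : klrAlg :=
  \sum_(i : {ffun 'I_n -> 'Z_e}) qpow (i k) *: ((1 - klr_y k) * klr_idm i).

Lemma klr_sum_idm : \sum_i klr_idm i = 1.
Proof.
rewrite -cls1 -(presP (klr_sum1 F n kappa)).
by rewrite (big_morph (cls _) (@cls_add _ _ _) (@cls0 _ _ _)).
Qed.

(** [klr_JM k] is the inverse image of [L_k] under the isomorphism. *)
Lemma BKR_JM (f : klrAlg -> heckeAlg) (k : 'I_n) :
  q != 0 -> is_BKR f -> f (klr_JM k) = hecke_L k.
Proof.
move=> q0 fP; have [flin [f1 fM]] := (BKR_linear fP, BKR_mult fP).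
pose fA := GRing.isLinear.Build _ _ _ _ f flin.
pose g : {linear klrAlg -> heckeAlg} := HB.pack f fA.
have fD : {morph f : x y / x + y} := linearD g.
have fB : {morph f : x y / x - y} := linearB g.
have fZ c x : f (c *: x) = c *: f x := linearZ_LR g c x.
have f0 : f 0 = 0 := linear0 g.
rewrite /klr_JM (big_morph f fD f0).
rewrite (eq_bigr (fun i => hecke_L k * f (klr_idm i))); last first.
  move=> i _; rewrite fZ mulrBl mul1r fB fM BKR_y // mulrBl mul1r opprB.
  rewrite addrC subrK -presZAl scalerA mulfV ?scale1r //.
  exact: expf_neq0.
by rewrite -mulr_sumr -(big_morph f fD f0) klr_sum_idm f1 mulr1.
Qed.
End Hecke.

(** * One-column multipartitions and tableaux *)

Section Combinatorics.
Variables (l n : nat).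

Definition Par1 := {a : {ffun 'I_l -> nat} | (\sum_m a m == n)%N}.
HB.instance Definition _ := SubChoice.on Par1.

(** A node [(r, m)] stands for (r, 1, m); rows are numbered from 1. *)
Definition node := (nat * 'I_l)%type.

Definition node_lt (x y : node) : bool :=
  (y.1 < x.1)%N || (x.1 == y.1) && (y.2 < x.2)%N.

Definition diagram (a : Par1) : {fset node} :=
  [fset x in [seq (r, m) | m <- enum 'I_l, r <- iota 1 (val a m)]]%fset.

Definition dom_le (A B : {fset node}) : Prop := forall x0 : node,
  (#|` [fset x in A | node_lt x0 x]|
     <= #|` [fset x in B | node_lt x0 x]|)%fset%N.

Definition par_le (a b : Par1) : Prop := dom_le (diagram a) (diagram b).
Definition par_lt (a b : Par1) : Prop := par_le a b /\ a != b.

Section Tableaux.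
Variable a : Par1.

Definition Tab := {t : {ffun 'I_n -> diagram a} |
  injectiveb t && [forall x, x \in codom t]}.
HB.instance Definition _ := SubFinite.on Tab.

Definition tab_node (t : Tab) (k : 'I_n) : node := val (val t k).

Definition standard (t : Tab) : bool :=
  [forall i : 'I_n, forall j : 'I_n,
    ((tab_node t i).2 == (tab_node t j).2) &&
    ((tab_node t i).1 < (tab_node t j).1)%N ==> (i < j)%N].

Definition Std := {t : Tab | standard t}.
HB.instance Definition _ := SubFinite.on Std.

(** The image of {1, ..., k}. *)
Definition tab_upto (t : Tab) (k : nat) : {fset node} :=
  [fset x in [seq tab_node t j | j : 'I_n <- enum 'I_n & (j < k)%N]]%fset.

Definition tab_le (t s : Tab) : Prop :=
  forall k : nat, (k <= n)%N -> dom_le (tab_upto t k) (tab_upto s k).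
Definition tab_lt (t s : Tab) : Prop := tab_le t s /\ t != s.

Lemma tab_inj (t : Tab) : injective (val t).
Proof. by apply/injectiveP; case/andP: (valP t). Qed.

Lemma tab_node_inj (t : Tab) : injective (tab_node t).
Proof. by move=> i j /val_inj /tab_inj. Qed.

Lemma in_diagram x : (x \in diagram a) = (0 < x.1 <= val a x.2)%N.
Proof.
case: x => r m; rewrite !inE /=; apply/allpairsPdep/idP => /=.
  by case=> m' [r' [_]]; rewrite mem_iota add1n ltnS => h [-> ->].
by move=> h; exists m, r; rewrite mem_enum mem_iota add1n ltnS.
Qed.

Lemma card_diagram : #|{: diagram a}| = n.
Proof.
rewrite -cardfE card_fseq undup_id; last first.
  apply: allpairs_uniq_dep => [|m _|]; first exact: enum_uniq.
    exact: iota_uniq.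
  by move=> [m r] [m' r'] _ _ /= [-> ->].
rewrite size_allpairs_dep sumnE big_map big_enum /=.
by rewrite -[RHS](eqP (valP a)); apply: eq_bigr => m _; rewrite size_iota.
Qed.

Lemma initial_tab_ex : exists t : Tab,
  [forall i : 'I_n, forall j : 'I_n,
    (i < j)%N ==> node_lt (tab_node t j) (tab_node t i)].
Proof.
pose ge (x y : diagram a) := (x == y) || node_lt (val y) (val x).
have ge_total : total ge.
  move=> x y; rewrite /ge /node_lt -!val_eqE /=.
  case: (val x) (val y) => [r m] [r' m'] /=; rewrite !xpair_eqE -!val_eqE /=.
  by case: (ltngtP r r') => //=; case: (ltngtP m m').
have ge_trans : transitive ge.
  move=> y x z; rewrite /ge /node_lt -!val_eqE /=.
  case: (val x) (val y) (val z) => [r m] [r' m'] [r'' m''] /=.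
  rewrite !xpair_eqE -!val_eqE /=; lia.
pose s := sort ge (enum {: diagram a}).
have sz : size s == n by rewrite size_sort -cardE card_diagram.
have su : uniq s by rewrite sort_uniq enum_uniq.
pose tp : n.-tuple (diagram a) := Tuple sz.
pose t := [ffun k => tnth tp k].
have t_inj : injective t.
  by move=> i j; rewrite !ffunE; apply/tuple_uniqP.
have tP : injectiveb t && [forall x, x \in codom t].
  apply/andP; split; first exact/injectiveP.
  apply/forallP => x; have : x \in tp by rewrite mem_sort mem_enum.
  case/tnthP => i ->; apply/codomP; exists i; by rewrite ffunE.
exists (exist _ t tP); apply/forallP => i; apply/forallP => j.
apply/implyP => ij.
have : ge (t i) (t j).
  rewrite !ffunE !(tnth_nth (t i)); apply: (sorted_ltn_nth ge_trans) => //.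
  - exact: sort_sorted.
  - by rewrite inE (eqP sz).
  - by rewrite inE (eqP sz).
case/orP => [/eqP/t_inj E|//]; by rewrite E ltnn in ij.
Qed.

(** t^lambda: the nodes in decreasing order. *)
Definition initial_tab : Tab := xchoose initial_tab_ex.

Definition tab_perm_fun (t : Tab) (k : 'I_n) : 'I_n :=
  iinv (forallP (proj2 (andP (valP initial_tab))) (val t k)).

Lemma tab_perm_inj (t : Tab) : injective (tab_perm_fun t).
Proof.
move=> i j /(congr1 (val initial_tab)); rewrite !f_iinv; exact: tab_inj.
Qed.

(** d(t), characterized by [tab_permP]. *)
Definition tab_perm (t : Tab) : 'S_n := perm (@tab_perm_inj t).

Lemma tab_permP (t : Tab) (k : 'I_n) :
  tab_node initial_tab (tab_perm t k) = tab_node t k.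
Proof. by rewrite permE /tab_node f_iinv. Qed.
End Tableaux.
End Combinatorics.

(** * The elements [m_{st}] *)

Definition lin_span (F : fieldType) (V : lmodType F) (S : V -> Prop)
    (x : V) : Prop :=
  exists (N : nat) (c : 'I_N -> F) (v : 'I_N -> V),
    (forall j, S (v j)) /\ x = \sum_j c j *: v j.

Definition charge (e l : nat) (khat : 'I_l -> int) (m : 'I_l) : 'Z_e :=
  (khat m)%:~R.

(** The last condition compares representatives in {0, ..., e-1}. *)
Record strongly_adjacency_free (e l n : nat) (khat : 'I_l -> int) : Prop := {
  saf_gap : forall m m' : 'I_l, m' = m.+1 :> nat ->
    (n%:Z <= khat m' - khat m)%R;
  saf_adj : forall i j : 'I_l, i != j ->
    [&& charge e khat i - charge e khat j != 0,
        charge e khat i - charge e khat j != 1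
      & charge e khat i - charge e khat j != - 1];
  saf_ends : forall i j : 'I_l, i = 0%N :> nat -> j.+1 = l :> nat ->
    charge e khat i != charge e khat j + 2%:R;
  saf_incr : forall i j : 'I_l, (i < j)%N ->
    ((charge e khat i : nat) < (charge e khat j : nat))%N }.

Section Cellular.
Variables (F : fieldType) (e l n : nat) (q : F) (kappa : 'I_l -> 'Z_e).
Variable (red : 'S_n -> seq 'I_n.-1).

Definition res (x : node l) : 'Z_e := kappa x.2 + 1 - x.1%:R.

Definition res_seq (a : Par1 l n) (t : Tab a) : {ffun 'I_n -> 'Z_e} :=
  [ffun k => res (tab_node t k)].

Definition blob_psi (w : 'S_n) : blobAlg F n kappa :=
  \prod_(r <- red w) pgen _ (KPsi e r).
Definition blob_idm (i : {ffun 'I_n -> 'Z_e}) : blobAlg F n kappa :=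
  pgen _ (KIdem i).

Definition blob_JM (k : 'I_n) : blobAlg F n kappa :=
  klr_to_blob (klr_JM q kappa k).

Definition cell (a : Par1 l n) (s t : Tab a) : blobAlg F n kappa :=
  blob_star (blob_psi (tab_perm s)) * blob_idm (res_seq (initial_tab a))
    * blob_psi (tab_perm t).

(** The span B_n^lambda of the cells above lambda. *)
Definition blob_above (a : Par1 l n) : blobAlg F n kappa -> Prop :=
  lin_span (fun x => exists (b : Par1 l n) (u v : Std b),
    par_lt a b /\ x = cell (val u) (val v)).
End Cellular.

(* Main.v *)
Require Import Defs.
From mathcomp Require Import all_boot all_algebra fingroup perm finmap boolp zify.

Set Implicit Arguments.
Unset Strict Implicit.
Unset Printing Implicit Defensive.

Import GRing.Theory.

(** The element [L_k] acts on an idempotent [e(i)] as [q^{i_k} (1 - y_k)], and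
    [m_st] absorbs the idempotent of the residue sequence of [t] on its right.
    Hence [m_st L_k] is [q^{res t(k)} (m_st - m_st y_k)], and the theorem
    amounts to: [m_st y_k] is a combination of the [m_sv] with [v] strictly
    more dominant than [t], modulo the span of the higher cells.

    Write [e = e(i^mu)] and let [I] be the ideal generated by the [e(i^nu)] with
    [nu] strictly more dominant than [mu].  In [e psi_w y_k] the dot travels to
    the left; at each crossing it passes, or deletes the crossing, and when it
    reaches [e] it is absorbed, because [y_k e] lies in [I] ([level_dot]).  The
    words with deleted crossings are rewritten by induction on their length
    ([all_good]): two reduced words of one permutation differ by commutations
    and braid relations, whose error terms have fewer crossings, and a reduced
    word that leads to a nonstandard tableau can be written so that a Garnir
    idempotent shows up, in which an entry [x + l] just precedes the entry [x]
    above it; Garnir idempotents lie in [I] ([garnir_idl]).  Deleting crossings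
    from a reduced word of [t] yields tableaux more dominant than [t] with fewer
    inversions, which is the asserted triangularity ([tableau_dot]).  Cutting a
    generator [a e(i^nu) a'] of [I] at its idempotent and straightening both
    halves writes it through cells ([idl_blob_above]).

    Both facts about idempotents follow from one statement ([core], [idm_step]):
    if the shapes of all standard tableaux with residue sequence [j] belong to an
    upper set [U] of the dominance order, then [e(j)] lies in the ideal generated
    by the [e(i^nu)] with [nu] in [U].  It is proved by induction on the number of
    strands.  Deleting the last strand keeps all local relations ([datum_rcons]),
    so the prefix of [j] may be replaced by row readings [i^mu]; what remains is
    [e(i^mu, b)] for one more residue [b].  If [b] is the residue of an addable
    node below all of [mu] there is nothing to do; otherwise [b] is compared with
    the last residue of [mu], and the invertible crossings, the dot on a pair of
    equal residues, the blob relation or the braid relation lead to a more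
    dominant [mu].

    By the hypothesis on [khat] the residues of any [l] consecutive nodes are
    pairwise neither equal nor adjacent ([rho_unlinked]), and [e > 2]
    ([two_unit]).  Therefore the row reading always adds the lowest addable node
    of its residue, and it is the least dominant tableau with its residue sequence
    ([antigreedy_dom], [tabs_shape_dom]); this turns the conditions on shapes above
    into inequalities in the dominance order.

    Throughout, the node in row [r] (counted from 1) and column [m] (counted from
    0) is coded by the number [(r - 1) l + m].  A more dominant node has a smaller
    code, and the node below [x] is [x + l].  A tableau is coded by the sequence of
    the nodes of its entries, a shape by the increasing sequence of its nodes,
    which is also its row reading. *)

(** * Dominance and standard sequences *)

Definition cntlt (p : nat) (s : seq nat) : nat := count (fun x => x < p) s.

(** Small numbers are the dominant nodes, so [dom s t] is the relation
    [t <= s] of the dominance order: the more dominant side comes first. *)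
Definition dom (s t : seq nat) : Prop := forall p, cntlt p t <= cntlt p s.

Definition tdom (s t : seq nat) : Prop := forall k, dom (take k s) (take k t).

(** No edge of the quiver joins the residues: the crossing of two such strands
    is invertible. *)
Definition unlinked (Z : nzRingType) (x y : Z) : bool :=
  [&& x != y, x != (y + 1)%R & x != (y - 1)%R].

Lemma unlinked_sym (Z : nzRingType) (x y : Z) : unlinked x y = unlinked y x.
Proof.
rewrite /unlinked eq_sym; congr andb.
by rewrite andbC -subr_eq (eq_sym _ y) -[in X in _ && X]subr_eq opprK (eq_sym _ y).
Qed.

Lemma unlinkedP (Z : nzRingType) (x y : Z) : unlinked x y ->
  [/\ x <> y, x <> (y + 1)%R, x <> (y - 1)%R, y <> (x + 1)%R & y <> (x - 1)%R].
Proof.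
move=> h; have := h; rewrite unlinked_sym; move: h.
by move=> /and3P [/eqP ? /eqP ? /eqP ?] /and3P [_ /eqP ? /eqP ?].
Qed.

Lemma cntlt_cat p s t : cntlt p (s ++ t) = cntlt p s + cntlt p t.
Proof. exact: count_cat. Qed.

Lemma cntlt_perm p s t : perm_eq s t -> cntlt p s = cntlt p t.
Proof. by move/seq.permP; apply. Qed.

Lemma dom_refl s : dom s s. Proof. by []. Qed.

Lemma dom_trans t s u : dom s t -> dom t u -> dom s u.
Proof. by move=> st tu p; apply: leq_trans (st p). Qed.

Lemma dom_perm s s' t t' : perm_eq s s' -> perm_eq t t' ->
  dom s t -> dom s' t'.
Proof.
by move=> ss tt h p; rewrite -(cntlt_perm p ss) -(cntlt_perm p tt).
Qed.

Lemma dom_cat2l c s t : dom (c ++ s) (c ++ t) <-> dom s t.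
Proof.
by split=> h p; move: (h p); rewrite !cntlt_cat leq_add2l.
Qed.

Lemma dom_cat s s' t t' : dom s t -> dom s' t' -> dom (s ++ s') (t ++ t').
Proof. by move=> h h' p; rewrite !cntlt_cat leq_add. Qed.

Lemma tdom_trans t s u : tdom s t -> tdom t u -> tdom s u.
Proof. by move=> st tu k; apply: dom_trans (st k) (tu k). Qed.

Lemma tdom_dom s t : tdom s t -> dom s t.
Proof.
move=> h p; have := h (maxn (size s) (size t)) p.
by rewrite !take_oversize // ?leq_maxl ?leq_maxr.
Qed.

(** Summation by parts: an entry [x < N] is counted by the [N - x] thresholds
    beyond it.  The sum of the entries is thereby a strictly monotone measure
    of dominance, on which the inductions over shapes run. *)
Lemma sumn_cntlt s N : all (fun x => x < N) s ->
  (sumn s + \sum_(p < N) cntlt p.+1 s = size s * N)%N.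
Proof.
elim: s => [_|x s IH] /=; first by rewrite big1.
case/andP=> xN /IH {IH}; rewrite mulSn => <-.
have -> : \sum_(p < N) cntlt p.+1 (x :: s) =
    (\sum_(p < N) (x <= p) + \sum_(p < N) cntlt p.+1 s)%N.
  by rewrite -big_split.
suff : (x + \sum_(p < N) (x <= p) = N)%N by lia.
elim: N xN => [//|N IH]; rewrite ltnS leq_eqVlt big_ord_recr /=.
case/orP=> [/eqP <-|xN]; last by rewrite addnA IH // ltnW ?addn1.
by rewrite leqnn big1 ?addn0 ?addn1 // => i _; rewrite leqNgt ltn_ord.
Qed.

Lemma dom_sumn s t : size s = size t -> dom s t -> sumn s <= sumn t.
Proof.
move=> st d.
pose N := (sumn s + sumn t).+1.
have le_sumn u x : x \in u -> x <= sumn u.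
  elim: u => //= y u IH; rewrite inE => /orP [/eqP ->|/IH h]; lia.
have hs : all (fun x => x < N) s by apply/allP=> x /le_sumn; rewrite /N; lia.
have ht : all (fun x => x < N) t by apply/allP=> x /le_sumn; rewrite /N; lia.
have := sumn_cntlt hs; have := sumn_cntlt ht; rewrite st => <-.
have : \sum_(p < N) cntlt p.+1 t <= \sum_(p < N) cntlt p.+1 s.
  by apply: leq_sum => p _; apply: d.
lia.
Qed.

(** The elements of an increasing sequence are the jumps of its counting
    function. *)
Lemma dom_anti s t : sorted ltn s -> sorted ltn t ->
  dom s t -> dom t s -> s = t.
Proof.
move=> ss tt st ts; have st' p : cntlt p s = cntlt p t.
  by apply/eqP; rewrite eqn_leq st ts.
apply: (irr_sorted_eq ltn_trans ltnn ss tt) => x.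
have us := sorted_uniq ltn_trans ltnn ss.
have ut := sorted_uniq ltn_trans ltnn tt.
have key u : uniq u -> (x \in u : nat) = cntlt x.+1 u - cntlt x u.
  move=> uu; rewrite -(count_uniq_mem x uu).
  have -> : cntlt x.+1 u = (cntlt x u + count_mem x u)%N.
    rewrite /cntlt -count_predUI [X in (_ + X)%N](eq_count (a2 := pred0)).
      by rewrite count_pred0 addn0; apply: eq_count => y /=; lia.
    by move=> y /=; lia.
  by rewrite addKn.
by have := key s us; rewrite !st' -(key t ut); case: (x \in s) (x \in t) => [] [].
Qed.

Lemma dom_sumn_lt s t : sorted ltn s -> sorted ltn t -> size s = size t ->
  dom s t -> s <> t -> sumn s < sumn t.
Proof.
move=> ss tt st d ne; rewrite ltn_neqAle dom_sumn // andbT.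
apply/negP=> /eqP E; apply: ne; apply: dom_anti => // p.
pose N := (sumn s + sumn t + p).+1.
have le_sumn u x : x \in u -> x <= sumn u.
  elim: u => //= y u IH; rewrite inE => /orP [/eqP ->|/IH h]; lia.
have hs : all (fun x => x < N) s by apply/allP=> x /le_sumn; rewrite /N; lia.
have ht : all (fun x => x < N) t by apply/allP=> x /le_sumn; rewrite /N; lia.
have := sumn_cntlt hs; have := sumn_cntlt ht; rewrite st -E => <-.
move/addnI => h.
case: p @N hs ht h => [|p] N _ _ h; first by rewrite /cntlt (eq_count (a2 := pred0)) ?count_pred0.
have pN : p < N by rewrite /N; lia.
have : \sum_(i < N | i != Ordinal pN) cntlt i.+1 t <=
       \sum_(i < N | i != Ordinal pN) cntlt i.+1 s.
  by apply: leq_sum => i _; apply: d.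
move: h; rewrite !(bigD1 (Ordinal pN) (P := predT)) //=.
set a := \sum_(i < N | _) _; set b := \sum_(i < N | _) _; lia.
Qed.

Section Tableaux.
Variables (Z : nzRingType) (l : nat) (rho : nat -> Z).

Definition addable (c : seq nat) (x : nat) : bool :=
  (x \notin c) && ((x < l) || (x - l \in c)).

(** Growth of a standard tableau from the diagram [c], one node at a time. *)
Fixpoint stdfrom (c s : seq nat) : bool :=
  if s is x :: s' then addable c x && stdfrom (rcons c x) s' else true.

Notation std := (stdfrom [::]).

Definition colclosed (c : seq nat) : bool :=
  all (fun x => (x < l) || (x - l \in c)) c.

Definition is_shape (mu : seq nat) : bool := sorted ltn mu && std mu.

Lemma eq_addable c c' : c =i c' -> addable c =1 addable c'.
Proof. by move=> h x; rewrite /addable !h. Qed.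

Lemma eq_stdfrom c c' : c =i c' -> stdfrom c =1 stdfrom c'.
Proof.
move=> h s; elim: s c c' h => //= x s IH c c' h; rewrite (eq_addable h).
by congr andb; apply: IH => y; rewrite !mem_rcons !inE h.
Qed.

Lemma stdfrom_cat c s t : stdfrom c (s ++ t) = stdfrom c s && stdfrom (c ++ s) t.
Proof.
elim: s c => [|x s IH] c /=; first by rewrite cats0.
by rewrite IH andbA cat_rcons.
Qed.

Lemma stdfrom_rcons c s x :
  stdfrom c (rcons s x) = stdfrom c s && addable (c ++ s) x.
Proof. by rewrite -cats1 stdfrom_cat /= andbT. Qed.

Lemma stdfrom_closed c s : colclosed c -> stdfrom c s -> colclosed (c ++ s).
Proof.
elim: s c => [|x s IH] c /=; first by rewrite cats0.
move=> cc /andP [/andP [_ ax] h]; rewrite -cat_rcons; apply: IH h.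
rewrite /colclosed all_rcons mem_rcons inE.
apply/andP; split; first by case/orP: ax => ->; rewrite ?orbT.
apply/allP=> y yc; have /orP [->//|h] := allP cc y yc.
by rewrite mem_rcons inE h !orbT.
Qed.

Lemma std_closed s : std s -> colclosed s.
Proof. exact: (@stdfrom_closed [::]). Qed.

Lemma stdfrom_uniq c s : uniq c -> stdfrom c s -> uniq (c ++ s).
Proof.
elim: s c => [|x s IH] c /=; first by rewrite cats0.
move=> uc /andP [/andP [xc _] h]; rewrite -cat_rcons; apply: IH h.
by rewrite rcons_uniq xc.
Qed.

Lemma std_uniq s : std s -> uniq s.
Proof. exact: (@stdfrom_uniq [::]). Qed.

Hypothesis l_gt0 : 0 < l.

Lemma closed_std s : sorted ltn s -> colclosed s -> std s.
Proof.
move=> ss cs.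
suff h t u : s = t ++ u -> stdfrom t u by apply: (h [::]).
elim: u t => //= x u IH t E.
apply/andP; split; last by apply: IH; rewrite cat_rcons.
have := ss; rewrite E (sorted_pairwise ltn_trans) pairwise_cat.
case/and3P=> /allrelP tx _ /andP [/allP xu _].
apply/andP; split.
  by apply/negP=> /tx /(_ (mem_head x u)); rewrite ltnn.
have xs : x \in s by rewrite E mem_cat mem_head orbT.
have /orP [->//|h] := allP cs x xs.
case: (ltnP x l) => //= lx; move: h; rewrite {1}E mem_cat inE.
case/or3P=> [//|/eqP|/xu /=]; lia.
Qed.

Lemma eq_closed c c' : c =i c' -> colclosed c = colclosed c'.
Proof.
move=> h; rewrite /colclosed (eq_all_r h); apply: eq_all => x; by rewrite h.
Qed.

Lemma shape_sort s : std s -> is_shape (sort leq s).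
Proof.
move=> hs; have ss : sorted ltn (sort leq s).
  by rewrite ltn_sorted_uniq_leq sort_uniq std_uniq // sort_sorted // => x y; apply: leq_total.
rewrite /is_shape ss; apply: closed_std => //.
by rewrite (eq_closed (mem_sort leq s)) std_closed.
Qed.

Lemma sort_shape mu : is_shape mu -> sort leq mu = mu.
Proof.
case/andP; rewrite ltn_sorted_uniq_leq => /andP [_ h] _.
exact: (sorted_sort leq_trans).
Qed.

Lemma shape_sorted mu : is_shape mu -> sorted ltn mu. Proof. by case/andP. Qed.
Lemma shape_std mu : is_shape mu -> std mu. Proof. by case/andP. Qed.

Lemma shape_perm s mu : is_shape mu -> perm_eq s mu -> sort leq s = mu.
Proof.
move=> h p; rewrite -(sort_shape h); apply/perm_sortP => //.
- exact: leq_total. - exact: leq_trans. - exact: anti_leq.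
Qed.

Lemma stdfrom_notin c s x : stdfrom c s -> x \in c -> x \notin s.
Proof.
elim: s c => //= y s IH c /andP [/andP [yc _] h] xc; rewrite inE negb_or.
rewrite (IH _ h) ?mem_rcons ?inE ?xc ?orbT // andbT.
by apply: contraNneq yc => <-.
Qed.

Lemma stdfrom_weaken c c' s : {subset c <= c'} ->
  (forall x, x \in s -> x \notin c') -> stdfrom c s -> stdfrom c' s.
Proof.
elim: s c c' => //= x s IH c c' cc sc /andP [/andP [xc xl] h].
have xc' := sc x (mem_head x s); rewrite /addable xc' /=; apply/andP; split.
  by case/orP: xl => [->//|/cc ->]; rewrite orbT.
have := h; apply: IH => y.
  by rewrite !mem_rcons !inE => /orP [->//|/cc ->]; rewrite orbT.
move=> ys; rewrite mem_rcons inE negb_or sc ?inE ?ys ?orbT // andbT.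
apply: contraTneq ys => ->; apply: (stdfrom_notin h).
by rewrite mem_rcons mem_head.
Qed.

(** Of all entries only [x + l] has to wait for [x]. *)
Lemma stdfrom_move c x q r : x + l \notin q ->
  stdfrom c (x :: q ++ r) -> stdfrom c (q ++ x :: r).
Proof.
elim: q c => [//|y q IH] c; rewrite inE negb_or => /andP [xy xq] /=.
case/and3P=> ax ay h; rewrite /=; apply/andP; split.
  move: ay; rewrite /addable !mem_rcons !inE negb_or => /andP [/andP [_ ->] /=].
  by case/or3P=> [->//|/eqP E|->]; rewrite ?orbT //; case: (ltnP y l) => //; lia.
apply: IH => //=; apply/andP; split.
  move: ay ax; rewrite /addable !mem_rcons !inE !negb_or eq_sym.
  move=> /andP [/andP [-> _] _] /andP [-> /orP [->//|->]] /=.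
  by rewrite !orbT.
move: h; rewrite (@eq_stdfrom _ (rcons (rcons c y) x)) // => z.
by rewrite !(mem_rcons, inE) orbCA.
Qed.

End Tableaux.

(** * Row readings are the least dominant tableaux of their residues *)

Section Antigreedy.
Variables (Z : nzRingType) (l : nat) (rho : nat -> Z).
Hypothesis l_gt0 : 0 < l.
Hypothesis rhoS : forall p, rho (p + l) = (rho p - 1)%R.
Hypothesis rho_apart : forall p p', p < p' < p + l -> unlinked (rho p) (rho p').
Notation std := (stdfrom l [::]).
Notation addable := (addable l).
Notation stdfrom := (stdfrom l).

Definition chain (x f : nat) : seq nat := [seq x + i * l | i <- iota 0 f].

Lemma chainP x f y : reflect (exists2 i, i < f & y = x + i * l) (y \in chain x f).
Proof.
apply: (iffP mapP) => [[i]|[i h ->]].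
  by rewrite mem_iota => h ->; exists i.
by exists i; rewrite ?mem_iota.
Qed.

Lemma chainS x f : chain x f.+1 = rcons (chain x f) (x + f * l).
Proof. by rewrite /chain -addn1 iotaD map_cat cats1. Qed.

Lemma rho_chain x y i : rho x = rho y -> rho (x + i * l) = rho (y + i * l).
Proof.
move=> h; elim: i => [|i IH]; first by rewrite !addn0.
by rewrite mulSn addnCA addnC rhoS IH -rhoS addnC addnCA.
Qed.

Lemma chain_dom x x2 f g : x2 < x -> f <= g ->
  dom (chain x f ++ chain x2 g) (chain x g ++ chain x2 f).
Proof.
move=> xx fg; rewrite -(subnKC fg); move: (g - f) => d {fg}.
elim: d => [|d IH] p; first by rewrite addn0.
have := IH p; rewrite !addnS !chainS !cntlt_cat -!cats1 !cntlt_cat /=; lia.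
Qed.

Lemma chain_next w f (a u : seq nat) i : (forall z, (z \in a) = (z \in u) || (z \in chain w f)) ->
  (forall j, w + j * l \notin u) -> addable a (w + i * l) -> i = f.
Proof.
move=> ma wu /andP []; rewrite !ma (negPf (wu i)) /= => na /orP h.
have ge : f <= i.
  by rewrite leqNgt; apply/negP=> lt; case/negP: na; apply/chainP; exists i.
case: i na h ge => [|i] na h ge; first by lia.
have E : w + i.+1 * l - l = w + i * l by rewrite mulSn; lia.
case: h => [|]; first by rewrite mulSn; lia.
rewrite E (negPf (wu i)) => /chainP [j jf /addnI/eqP].
by rewrite eqn_pmul2r // => /eqP; lia.
Qed.

Lemma chain_addable w f (a u : seq nat) : (forall z, (z \in a) = (z \in u) || (z \in chain w f)) ->
  (forall j, w + j * l \notin u) -> (w < l) || (w - l \in u) ->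
  addable a (w + f * l).
Proof.
move=> ma wu wl; rewrite /addable !ma (negPf (wu f)) /=; apply/andP; split.
  by apply/chainP=> -[j jf /addnI/eqP]; rewrite eqn_pmul2r // => /eqP; lia.
case: f ma => [|f] _; first by rewrite addn0; case/orP: wl => ->; rewrite ?orbT.
have -> : w + f.+1 * l - l = w + f * l by rewrite mulSn; lia.
apply/orP; right; apply/orP; right; apply/chainP; by exists f.
Qed.

Section Exchange.
Variables (x x2 : nat).
Hypothesis xx2 : x2 < x.
Hypothesis sep : forall i j, x + i * l <> x2 + j * l.
Hypothesis rhoE : rho x = rho x2.

(** Two diagrams differ by exchanging the heights of two columns: one has height
    [f] at [x] and [g >= f] at [x2], the other [g] at [x] and [f] at [x2].  A run
    of the first is mirrored in the second, steps in the two columns being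
    interchanged, until the heights agree; from then on the runs coincide.
    As [x2 < x], the first diagram is always the more dominant one. *)
Lemma exch_run s2 c f g a b : f <= g ->
  perm_eq a (c ++ chain x f ++ chain x2 g) ->
  perm_eq b (c ++ chain x g ++ chain x2 f) ->
  (forall i, x + i * l \notin c) -> (forall i, x2 + i * l \notin c) ->
  (x < l) || (x - l \in c) -> (x2 < l) || (x2 - l \in c) ->
  stdfrom a s2 ->
  exists s', [/\ stdfrom b s', map rho s' = map rho s2 &
    forall k, dom (a ++ take k s2) (b ++ take k s')].
Proof.
elim: s2 c f g a b => [|y s IH] c f g a b fg pa pb cx cx2 bx bx2 /=.
  move=> _; exists [::]; split=> // k; apply: dom_cat => //.
  apply: (dom_perm (s := c ++ chain x f ++ chain x2 g)
    (t := c ++ chain x g ++ chain x2 f)); rewrite 1?perm_sym //.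
  by apply/dom_cat2l/chain_dom.
case/andP=> ay hs.
have dab : dom a b.
  apply: (dom_perm (s := c ++ chain x f ++ chain x2 g)
    (t := c ++ chain x g ++ chain x2 f)); rewrite 1?perm_sym //.
  by apply/dom_cat2l/chain_dom.
have [E|ne] := eqVneq f g.
  exists (y :: s); split=> // [|k]; last exact: dom_cat.
  have E' : b =i a by move=> z; rewrite (perm_mem pa) (perm_mem pb) E.
  rewrite /= (eq_addable _ E') ay /=.
  by rewrite (@eq_stdfrom _ _ (rcons a y)) // => z; rewrite !mem_rcons !inE E'.
have ltfg : f < g by lia.
(* one simultaneous step, followed by the induction hypothesis *)
have step y' c' f' g' : f' <= g' -> addable b y' -> rho y' = rho y ->
    perm_eq (rcons a y) (c' ++ chain x f' ++ chain x2 g') ->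
    perm_eq (rcons b y') (c' ++ chain x g' ++ chain x2 f') ->
    (forall i, x + i * l \notin c') -> (forall i, x2 + i * l \notin c') ->
    (x < l) || (x - l \in c') -> (x2 < l) || (x2 - l \in c') ->
    exists s', [/\ stdfrom b s', map rho s' = rho y :: map rho s &
      forall k, dom (a ++ take k (y :: s)) (b ++ take k s')].
  move=> h1 h2 h3 h4 h5 h6 h7 h8 h9.
  have [s' [hs' r' d']] := IH _ _ _ _ _ h1 h4 h5 h6 h7 h8 h9 hs.
  exists (y' :: s'); split; rewrite /= ?h2 ?h3 ?r' // => -[|k] /=.
    by rewrite !cats0.
  by rewrite -!cat_rcons.
have memx d h i : (x + i * l \notin c ++ chain x2 h) && (x2 + i * l \notin c ++ chain x d).
  rewrite !mem_cat !negb_or cx cx2 /=; apply/andP; split; apply/chainP=> -[j _].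
    exact: sep.
  by move/esym; apply: sep.
have mx (u : seq nat) d h : perm_eq u (c ++ chain x d ++ chain x2 h) ->
    forall z, (z \in u) = (z \in c ++ chain x2 h) || (z \in chain x d).
  by move=> pu z; rewrite (perm_mem pu) !mem_cat -orbA (orbC (_ \in chain x2 _)).
have mx2 (u : seq nat) d h : perm_eq u (c ++ chain x d ++ chain x2 h) ->
    forall z, (z \in u) = (z \in c ++ chain x d) || (z \in chain x2 h).
  by move=> pu z; rewrite (perm_mem pu) !mem_cat orbA.
have rc (u : seq nat) z v : perm_eq u v -> perm_eq (rcons u z) (rcons v z).
  by rewrite -!cats1 perm_cat2r.
have bw w (u : seq nat) : (w < l) || (w - l \in c) -> (w < l) || (w - l \in c ++ u).
  by rewrite mem_cat => /orP [->//|->]; rewrite orbT.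
have [[i yE]|nx] := pselect (exists i, y = x + i * l).
  have {i} {}yE : y = x + f * l.
    rewrite yE; congr (x + _ * l); apply: (chain_next (mx _ _ _ pa)) => [j|].
      by case/andP: (memx 0 g j).
    by rewrite -yE.
  apply: (step (x2 + f * l) c f.+1 g) => //.
  - apply: (chain_addable (mx2 _ _ _ pb)) => [j|]; last exact: bw.
    by case/andP: (memx g 0 j).
  - by rewrite yE; apply/esym/rho_chain.
  - apply: (perm_trans (rc _ _ _ pa)); rewrite yE chainS -!cats1 -!catA !perm_cat2l.
    by rewrite perm_catC.
  - by apply: (perm_trans (rc _ _ _ pb)); rewrite chainS -!cats1 -!catA.
have [[i yE]|nx2] := pselect (exists i, y = x2 + i * l).
  have {i} {}yE : y = x2 + g * l.
    rewrite yE; congr (x2 + _ * l); apply: (chain_next (mx2 _ _ _ pa)) => [j|].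
      by case/andP: (memx f 0 j).
    by rewrite -yE.
  apply: (step (x + g * l) c f g.+1) => //.
  - by rewrite ltnW.
  - apply: (chain_addable (mx _ _ _ pb)) => [j|]; last exact: bw.
    by case/andP: (memx 0 f j).
  - by rewrite yE; apply: rho_chain.
  - by apply: (perm_trans (rc _ _ _ pa)); rewrite yE chainS -!cats1 -!catA.
  - apply: (perm_trans (rc _ _ _ pb)); rewrite chainS -!cats1 -!catA !perm_cat2l.
    by rewrite perm_catC.
have ych w d : (forall i, y <> w + i * l) -> (y \notin chain w d) /\
    (l <= y -> y - l \notin chain w d).
  move=> nw; split; first by apply/chainP=> -[i _]; apply: nw.
  by move=> ly; apply/chainP=> -[i _ E]; apply: (nw i.+1); rewrite mulSn; lia.
have nx' i : y <> x + i * l by move=> E; apply: nx; exists i.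
have nx2' i : y <> x2 + i * l by move=> E; apply: nx2; exists i.
have pc (u v : seq nat) : perm_eq u (c ++ v) -> perm_eq (rcons u y) (rcons c y ++ v).
  by move=> pu; apply: (perm_trans (rc _ _ _ pu)); rewrite -!cats1 -!catA perm_cat2l perm_catC.
apply: (step y (rcons c y) f g) => //.
- move: ay; rewrite /addable (perm_mem pa) (perm_mem pb) !mem_cat.
  rewrite (perm_mem pa) (perm_mem pb) !mem_cat.
  rewrite !(negPf (ych x _ nx').1) !(negPf (ych x2 _ nx2').1) !orbF => /andP [-> /=].
  case: (ltnP y l) => //= ly.
  by rewrite !(negPf ((ych x _ nx').2 ly)) !(negPf ((ych x2 _ nx2').2 ly)).
- exact: pc.
- exact: pc.
- by move=> i; rewrite mem_rcons inE negb_or cx andbT eq_sym; apply/eqP.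
- by move=> i; rewrite mem_rcons inE negb_or cx2 andbT eq_sym; apply/eqP.
- by rewrite mem_rcons inE; case/orP: bx => ->; rewrite ?orbT.
- by rewrite mem_rcons inE; case/orP: bx2 => ->; rewrite ?orbT.
Qed.
End Exchange.

Lemma chain_closed c x i : colclosed l c -> x + i * l \in c -> x \in c.
Proof.
move=> cc; elim: i => [|i IH]; first by rewrite addn0.
move=> h; apply: IH; have := allP cc _ h; rewrite mulSn.
have -> : x + (l + i * l) - l = x + i * l by lia.
by case/orP => // lt; lia.
Qed.

(** The futures of two columns whose addable nodes share a residue can be
    exchanged until the columns are level, so the run may as well start in the
    lower column. *)
Lemma swap_run c x x2 s2 : colclosed l c -> addable c x -> addable c x2 ->
  x2 < x -> rho x = rho x2 -> stdfrom (rcons c x2) s2 ->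
  exists s', [/\ stdfrom (rcons c x) s', map rho s' = map rho s2 &
    forall k, dom (rcons c x2 ++ take k s2) (rcons c x ++ take k s')].
Proof.
move=> cc /andP [xc xl] /andP [x2c x2l] lt E.
have nc w i : w \notin c -> w + i * l \notin c.
  by move=> wc; apply/negP=> /(chain_closed cc); apply/negP.
have ch1 w : chain w 1 = [:: w] by rewrite /chain /= mul0n addn0.
apply: (exch_run lt _ E (leq0n 1) (c := c)); rewrite ?ch1 -?cats1 //=.
- move=> i j h; have ij : i <= j.
    by rewrite -(leq_pmul2r l_gt0); lia.
  have {}h : x = x2 + (j - i) * l by rewrite mulnBl; lia.
  case: (j - i) h => [|d] h; first by lia.
  case/orP: xl => [|]; first by rewrite h mulSn; lia.
  rewrite h mulSn; have -> : x2 + (l + d * l) - l = x2 + d * l by lia.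
  by apply/negP; apply: nc.
- by move=> i; apply: nc.
- by move=> i; apply: nc.
Qed.

Fixpoint antigreedy (c t : seq nat) : Prop :=
  if t is x :: t' then
    (forall y, addable c y -> rho y = rho x -> y <= x) /\ antigreedy (rcons c x) t'
  else True.

(** By [swap_run] the first step of a run can be moved down to the lowest addable
    node of its residue without becoming more dominant.  Iterating this shows
    that the antigreedy tableau is the least dominant one. *)
Lemma antigreedy_dom t c s rest : colclosed l c -> stdfrom c t -> antigreedy c t ->
  stdfrom c s -> map rho s = map rho t ++ rest ->
  exists s'', [/\ stdfrom c (t ++ s''), map rho s'' = rest &
    forall k, dom (c ++ take k s) (c ++ take k (t ++ s''))].
Proof.
elim: t c s => [|x t IH] c s cc st.
  move=> _ hs E; exists s; split=> // k; apply: dom_refl.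
case=> mx ag; case: s => [//|y s] /= /andP [ay hs] [yx E].
have /= /andP [ax st'] := st.
have cx : colclosed l (rcons c x) by rewrite -cats1; apply: stdfrom_closed; rewrite //= ax.
have [s' [hs' rs' ds']] : exists s', [/\ stdfrom (rcons c x) s',
    map rho s' = map rho s &
    forall k, dom (rcons c y ++ take k s) (rcons c x ++ take k s')].
  have := mx y ay yx; rewrite leq_eqVlt => /orP [/eqP <-|lt].
    by exists s; split=> // k; apply: dom_refl.
  exact: (swap_run cc ax ay lt (esym yx) hs).
have [s'' [h1 h2 h3]] := IH _ _ cx st' ag hs' (etrans rs' E).
exists s''; split=> //=; first by rewrite ax.
case=> [//|k] /=.
by rewrite -!cat_rcons; apply: dom_trans (ds' k) (h3 k).
Qed.

(** An addable node beyond the next node [x] of a row reading lies less than [l]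
    beyond it, since the node above it is already present; so its residue is not
    that of [x]. *)
Lemma antigreedy_row c t : stdfrom c t -> sorted ltn t -> allrel ltn c t ->
  antigreedy c t.
Proof.
elim: t c => //= x t IH c /andP [ax st]; rewrite path_sortedE; last exact: ltn_trans.
case/andP=> /allP xt tt /allrelP ct; split; last first.
  apply: IH => //; apply/allrelP => y z; rewrite mem_rcons inE.
  by case/orP=> [/eqP ->|yc] zt; [apply: xt|apply: ct; rewrite // inE zt orbT].
move=> y /andP [_ yl] E; rewrite leqNgt; apply/negP=> lt.
have : unlinked (rho x) (rho y).
  apply: rho_apart; rewrite lt /=.
  case/orP: yl => [h|/ct /(_ (mem_head x t)) /=]; lia.
by rewrite /unlinked E eqxx.
Qed.

Lemma shape_antigreedy mu : is_shape l mu -> antigreedy [::] mu.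
Proof. by case/andP=> ss st; apply: antigreedy_row. Qed.

Definition tabs (j : seq Z) (c : seq nat) : Prop := std c /\ map rho c = j.

Lemma tabs_shape_dom mu c : is_shape l mu -> tabs (map rho mu) c -> tdom c mu.
Proof.
move=> sh [sc rc]; have [s' [_ h k]] : exists s'', [/\ std (mu ++ s''),
   map rho s'' = [::] & forall k, dom (take k c) (take k (mu ++ s''))].
  apply: (antigreedy_dom (c := [::])) => //; [exact: shape_std|exact: shape_antigreedy|].
  by rewrite cats0.
by case: s' h k => // _; rewrite cats0.
Qed.

Lemma tabs_shape_dom1 mu b c : is_shape l mu -> tabs (rcons (map rho mu) b) c ->
  exists x, [/\ addable mu x, rho x = b & dom c (rcons mu x)].
Proof.
move=> sh [sc rc]; have [s' [hs h k]] : exists s'', [/\ std (mu ++ s''),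
   map rho s'' = [:: b] & forall k, dom (take k c) (take k (mu ++ s''))].
  apply: (antigreedy_dom (c := [::])) => //; [exact: shape_std|exact: shape_antigreedy|].
  by rewrite cats1.
case: s' hs h k => [//|x [|//]] hs [<-] k; exists x; split=> //.
  by move: hs; rewrite cats1 stdfrom_rcons => /andP [].
have /tdom_dom := k; by rewrite cats1.
Qed.

(** The row reading always takes the most dominant of the remaining nodes. *)
Lemma row_max s mu : is_shape l mu -> perm_eq s mu -> tdom s mu -> s = mu.
Proof.
move=> sh p d.
have ss := shape_sorted sh.
have sz := perm_size p.
suff tk k : k <= size mu -> take k s = take k mu.
  by have := tk _ (leqnn _); rewrite take_size -sz take_size.
elim: k => [|k IH] kn; first by rewrite !take0.
have {}IH := IH (ltnW kn).
have ks : k < size s by rewrite sz.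
rewrite (take_nth 0 ks) (take_nth 0 kn) IH; congr rcons.
set x := nth 0 s k; set y := nth 0 mu k.
have : cntlt y.+1 (take k.+1 mu) <= cntlt y.+1 (take k.+1 s) by apply: d.
rewrite (take_nth 0 ks) (take_nth 0 kn) IH -!cats1 !cntlt_cat /= ltnSn -/x -/y.
rewrite leq_add2l addn0; case: (ltnP x y.+1) => // xy _.
have xm : x \in drop k mu.
  have : x \in drop k s by rewrite (drop_nth 0 ks) mem_head.
  have : perm_eq (drop k s) (drop k mu).
    by rewrite -(perm_cat2l (take k s)) cat_take_drop IH cat_take_drop.
  by move/perm_mem ->.
move: xm; rewrite (drop_nth 0 kn) -/y inE => /orP [/eqP //|xm].
have := ss; rewrite -(cat_take_drop k mu) (drop_nth 0 kn) -/y.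
rewrite (sorted_pairwise ltn_trans) pairwise_cat => /and3P [_ _ /= /andP [/allP /(_ _ xm) /= yx _]].
lia.
Qed.
End Antigreedy.

(** * Tableaux with the residues of a Garnir sequence *)

Lemma perm_map_lift (T T' : eqType) (f : T -> T') (s t c : seq T) :
  perm_eq s t -> map f c = map f s -> exists2 d, perm_eq d c & map f d = map f t.
Proof.
case: s t => [|x s] t.
  by rewrite perm_sym => /perm_nilP -> /=; exists [::]; case: c H.
move=> p E; have := p; rewrite perm_sym => /(perm_iotaP x) [Is pI ->].
have sz : size c = size (x :: s) by rewrite -(size_map f) E size_map.
exists [seq nth x c i | i <- Is].
  apply: (perm_trans (perm_map _ pI)).
  by rewrite -sz -/(mkseq _ _) mkseq_nth.
rewrite -!map_comp; apply/eq_in_map=> i; rewrite (perm_mem pI) mem_iota add0n.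
move=> /= ilt.
have := congr1 (fun u => nth (f x) u i) E.
by rewrite !(nth_map x) ?sz.
Qed.

Lemma map_catP (T T' : Type) (f : T -> T') (u : seq T) a b :
  map f u = a ++ b -> exists u1 u2, [/\ u = u1 ++ u2, map f u1 = a & map f u2 = b].
Proof.
move=> E; exists (take (size a) u), (drop (size a) u).
by rewrite cat_take_drop map_take map_drop E take_size_cat // drop_size_cat.
Qed.

Lemma map_consP (T T' : Type) (f : T -> T') (u : seq T) a b :
  map f u = a :: b -> exists x u2, [/\ u = x :: u2, f x = a & map f u2 = b].
Proof. by case: u => // x u [<- <-]; exists x, u. Qed.

Section Garnir.
Variables (Z : nzRingType) (l : nat) (rho : nat -> Z).
Hypothesis l_gt0 : 0 < l.
Hypothesis rhoS : forall p, rho (p + l) = (rho p - 1)%R.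
Hypothesis rho_apart : forall p p', p < p' < p + l -> unlinked (rho p) (rho p').
Hypothesis two_neq0 : (1 + 1 : Z)%R != 0%R.
Notation std := (stdfrom l [::]).
Notation addable := (addable l).
Notation stdfrom := (stdfrom l).
Notation tabs := (tabs l rho).

Definition antichain (w : seq nat) : Prop :=
  forall y, y \in w -> l <= y -> y - l \notin w.

(** Inside an antichain no entry waits for another, so the order is immaterial. *)
Lemma antichain_stdfrom c w : antichain w ->
  stdfrom c w = uniq w && all (addable c) w.
Proof.
elim: w c => //= x w IH c ac.
have acw : antichain w.
  move=> y yw ly; have := ac y; rewrite inE yw orbT => /(_ isT ly).
  by rewrite inE negb_or => /andP [].
rewrite IH //; have [xw|xw] /= := boolP (x \in w).
  suff -> : all (addable (rcons c x)) w = false by rewrite !andbF.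
  by apply/negP=> /allP /(_ x xw); rewrite /addable mem_rcons mem_head.
suff -> : all (addable (rcons c x)) w = all (addable c) w by rewrite andbCA.
apply: eq_in_all => y yw; rewrite /addable !mem_rcons !inE negb_or.
have -> : y != x by apply: contraNneq xw => <-.
rewrite /=; congr andb; case: ltnP => //= ly.
suff -> : (y - l == x) = false by [].
apply/negP=> /eqP E; have := ac y; rewrite inE yw orbT E => /(_ isT ly).
by rewrite mem_head.
Qed.

(** Let [c] be a standard tableau with the residues of the Garnir sequence.  In
    the window that carries the residues of [W1], [X + l], [X], [W2] no entry lies
    directly above another: unequal residues of [Q] are unlinked among themselves
    and from those of [X] and [X + l], and the entry with the residue of [X] comes
    after the one with the residue of [X + l], while 2 is nonzero.  Hence the window
    may be reordered so that the residues become those of the row reading, which is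
    the least dominant tableau.  Were the shape the same, the reordered tableau would
    be the row reading itself by [row_max], with [X] right above [X + l] in the window. *)
Lemma garnir_dom th X Q tl W1 W2 c :
  is_shape l (th ++ X :: Q ++ (X + l) :: tl) ->
  perm_eq (W1 ++ W2) Q ->
  tabs (map rho (th ++ W1 ++ [:: X + l, X & W2 ++ tl])) c ->
  dom (sort leq c) (th ++ X :: Q ++ (X + l) :: tl) /\
  sort leq c <> th ++ X :: Q ++ (X + l) :: tl.
Proof.
move=> sh pW [sc]; rewrite !map_cat /= map_cat.
set mu := th ++ _.
case/map_catP=> c0 [c1 [E0 r0 /map_catP [w1 [c2 [E1 r1]]]]].
case/(@map_consP _ _ rho)=> g' [c3 [E2 rg /(@map_consP _ _ rho) [x' [c4 [E3 rx]]]]].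
case/map_catP=> w2 [ct [E4 r2 rt]].
have Ec : c = c0 ++ (w1 ++ [:: g', x' & w2]) ++ ct.
  by rewrite E0 E1 E2 E3 E4 -!catA.
set w := w1 ++ [:: g', x' & w2] in Ec.
(* residues in the window are pairwise unlinked, those of X and X + l apart *)
have sQ v : v \in Q -> X < v < X + l.
  move=> vQ; have := shape_sorted sh; rewrite (sorted_pairwise ltn_trans).
  rewrite pairwise_cat /= all_cat pairwise_cat /= => /and5P [_ _ /and3P [/allP h _ _] h2 _].
  rewrite (h v vQ) /=.
  by move/allrelP: h2 => /(_ v (X + l) vQ (mem_head _ _)).
have uXQ v : v \in Q -> unlinked (rho X) (rho v) by move=> /sQ; apply: rho_apart.
have ugQ v : v \in Q -> unlinked (rho v) (rho (X + l)).
  by move=> /sQ h; apply: rho_apart; lia.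
have uQQ v v' : v \in Q -> v' \in Q -> v = v' \/ unlinked (rho v) (rho v').
  move=> /sQ h /sQ h'; case: (ltngtP v v') => k; last by left.
  - by right; apply: rho_apart; lia.
  - by right; rewrite unlinked_sym; apply: rho_apart; lia.
have rQ y : y \in w1 ++ w2 -> exists2 v, v \in Q & rho y = rho v.
  move=> yw; have : rho y \in map rho (W1 ++ W2) by rewrite map_cat -r1 -r2 -map_cat map_f.
  by case/mapP=> v; rewrite (perm_mem pW) => vQ ->; exists v.
have wE y : (y \in w) = [|| y == g', y == x' | y \in w1 ++ w2].
  by rewrite !mem_cat !inE; do !case: (_ == _); rewrite ?orbT //=; case: (y \in w1).
have one0 (a : Z) : a = (a - 1)%R -> False.
  by move/eqP; rewrite -subr_eq0 opprB addrCA subrr addr0 oner_eq0.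
have uniqc := std_uniq sc.
have ac : antichain w.
  move=> y yw ly; apply/negP=> yw'.
  have ry : rho y = (rho (y - l) - 1)%R by rewrite -rhoS subnK.
  move: yw yw'; rewrite !wE => /or3P [/eqP yg|/eqP yx|/rQ [v vQ rv]]
    /or3P [/eqP yg'|/eqP yx'|/rQ [v' vQ' rv']].
  - by lia.
  - have Ec' : c = (c0 ++ w1) ++ [:: g', x' & w2] ++ ct by rewrite Ec /w -!catA.
    move: sc; rewrite Ec' stdfrom_cat /= => /and3P [_ /andP [_]].
    rewrite -yg ltnNge ly /= yx' => h _.
    move: uniqc; rewrite Ec' cat_uniq => /and3P [_ /hasPn /(_ x') hh _].
    by move: hh; rewrite !inE eqxx orbT h => /(_ isT).
  - by have /unlinkedP [_ _ _ _] := ugQ _ vQ'; rewrite -rg -rv' -yg.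
  - move: ry; rewrite yg' yx rx rg rhoS -addrA -opprD => /eqP.
    by rewrite -subr_eq0 opprB addrC subrK (negPf two_neq0).
  - by lia.
  - by have /unlinkedP [_ _] := uXQ _ vQ'; rewrite -rx -rv' -yx.
  - by have /unlinkedP [_ _] := ugQ _ vQ; rewrite -rg -rv -yg'.
  - by have /unlinkedP [_ _ _ _] := uXQ _ vQ; rewrite -rx -rv -yx'.
  - case: (uQQ _ _ vQ vQ') => [E|/unlinkedP [_ _]].
      by apply: (one0 (rho v)); rewrite {2}E -rv -rv'.
    by rewrite -rv -rv'.
have [cQ pQ rcQ] : exists2 cQ, perm_eq cQ (w1 ++ w2) & map rho cQ = map rho Q.
  by apply: (perm_map_lift pW); rewrite !map_cat r1 r2.
pose w' := x' :: cQ ++ [:: g'].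
have pw : perm_eq w' w.
  rewrite /w /w' -cat1s -[w1 ++ _](cat_take_drop 0) take0 drop0 /=.
  have : perm_eq (x' :: cQ ++ [:: g']) (x' :: (w1 ++ w2) ++ [:: g']).
    by rewrite perm_cons perm_cat2r.
  move=> h; apply: (perm_trans h); rewrite -cat1s -!catA.
  rewrite perm_sym perm_catC /= -cat1s perm_catC /= -catA perm_cons.
  by rewrite perm_catC -catA perm_cat2l perm_catC.
pose c'' := c0 ++ w' ++ ct.
have pc : perm_eq c'' c by rewrite Ec /c'' perm_cat2l perm_cat2r.
have tc : tabs (map rho mu) c''.
  split; last by rewrite /mu !map_cat /= !map_cat /= r0 rcQ rx rg rt -!catA.
  have := sc; rewrite Ec stdfrom_cat [X in _ && X]stdfrom_cat !cat0s => /and3P [h0 hw ht].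
  have ac' : antichain w' by move=> y; rewrite !(perm_mem pw); apply: ac.
  rewrite stdfrom_cat [X in _ && X]stdfrom_cat !cat0s h0 (antichain_stdfrom _ ac') (perm_uniq pw) (perm_all _ pw).
  rewrite -antichain_stdfrom // hw !andTb.
  rewrite (@eq_stdfrom _ _ (c0 ++ w)); first exact: ht.
  by move=> z; rewrite mem_cat (perm_mem pw) -mem_cat.
have td := tabs_shape_dom l_gt0 rhoS rho_apart sh tc.
split.
  apply: (dom_perm (s := c'') (t := mu)) => //; last exact: tdom_dom.
  by rewrite perm_sym perm_sort perm_sym.
move=> E; have pE : perm_eq c mu by rewrite -E perm_sym perm_sort.
have Ec'' : c'' = mu.
  by apply: (row_max l_gt0 sh _ td); apply: (perm_trans pc).
have s0 : size c0 = size th by have := congr1 size r0; rewrite !size_map.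
have sq : size cQ = size Q by have := congr1 size rcQ; rewrite !size_map.
move/eqP: Ec''; rewrite /c'' /mu eqseq_cat // => /andP [_].
rewrite /w' /= eqseq_cons -catA eqseq_cat //= eqseq_cons => /and4P [/eqP ex _ /eqP eg _].
have := ac g'; rewrite !wE eqxx eg -ex leq_addl addnK eqxx orbT.
by move=> /(_ isT isT).
Qed.
End Garnir.

(** * Words in the simple transpositions *)

Fixpoint swp (T : Type) (r : nat) (s : seq T) : seq T :=
  match r, s with
  | 0, x :: y :: t => y :: x :: t
  | r'.+1, x :: t => x :: swp r' t
  | _, _ => s
  end.

Definition act (T : Type) (t : seq T) (u : seq nat) : seq T :=
  foldl (fun t r => swp r t) t u.

Fixpoint ninv (s : seq nat) : nat :=
  if s is x :: s' then cntlt x s' + ninv s' else 0.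

(** One step of the 0-Hecke (Demazure) action. *)
Definition dmz (r : nat) (t : seq nat) : seq nat :=
  if nth 0 t r < nth 0 t r.+1 then swp r t else t.

Definition dem (t : seq nat) (u : seq nat) : seq nat :=
  foldl (fun t r => dmz r t) t u.

Definition valid (n : nat) (u : seq nat) : bool := all (fun r => r.+1 < n) u.

Lemma swp_cat (T : Type) (a : seq T) x y b :
  swp (size a) (a ++ [:: x, y & b]) = a ++ [:: y, x & b].
Proof. by elim: a => //= z a ->. Qed.

Lemma split_at (T : Type) (t : seq T) r : r.+1 < size t ->
  exists a x y b, t = a ++ [:: x, y & b] /\ size a = r.
Proof.
elim: r t => [|r IH] [|x [|y t]] //=; first by exists [::], x, y, t.
rewrite ltnS => h; have [a [x' [y' [b [E s]]]]] := IH (y :: t) h.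
by exists (x :: a), x', y', b; rewrite E /= s.
Qed.

Lemma size_split2 (T : Type) (a : seq T) x y b n : size (a ++ [:: x, y & b]) = n ->
  (size a).+1 < n.
Proof. by rewrite size_cat /= => <-; lia. Qed.

Lemma size_swp (T : Type) r (t : seq T) : size (swp r t) = size t.
Proof. by elim: r t => [|r IH] [|x [|y t]] //=; rewrite IH. Qed.

Lemma map_swp (T T' : Type) (f : T -> T') r t : map f (swp r t) = swp r (map f t).
Proof. by elim: r t => [|r IH] [|x [|y t]] //=; rewrite IH. Qed.

Lemma map_act (T T' : Type) (f : T -> T') t u : map f (act t u) = act (map f t) u.
Proof. by elim: u t => //= r u IH t; rewrite IH map_swp. Qed.

Lemma swpK (T : Type) r (t : seq T) : swp r (swp r t) = t.
Proof. by elim: r t => [|r IH] [|x [|y t]] //=; rewrite IH. Qed.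

Lemma perm_swap2 (x y : nat) b : perm_eq [:: y, x & b] [:: x, y & b].
Proof. exact: (permEl (perm_catCA [:: y] [:: x] b)). Qed.

Lemma perm_swp r (t : seq nat) : perm_eq (swp r t) t.
Proof.
elim: r t => [|r IH] [|x [|y t]] //=; rewrite ?perm_cons ?IH //.
exact: perm_swap2.
Qed.

Lemma act_rcons (T : Type) (t : seq T) u r : act t (rcons u r) = swp r (act t u).
Proof. by rewrite /act -cats1 foldl_cat. Qed.

Lemma dem_rcons t u r : dem t (rcons u r) = dmz r (dem t u).
Proof. by rewrite /dem -cats1 foldl_cat. Qed.

Lemma perm_act (t : seq nat) u : perm_eq (act t u) t.
Proof.
elim/last_ind: u => // u r IH; rewrite act_rcons.
exact: perm_trans (perm_swp _ _) IH.
Qed.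

Lemma size_act (T : Type) (t : seq T) u : size (act t u) = size t.
Proof. by elim/last_ind: u => // u r IH; rewrite act_rcons size_swp. Qed.

Lemma size_dmz r t : size (dmz r t) = size t.
Proof. by rewrite /dmz; case: ifP; rewrite ?size_swp. Qed.

Lemma size_dem t u : size (dem t u) = size t.
Proof. by elim/last_ind: u => // u r IH; rewrite dem_rcons size_dmz. Qed.

Lemma valid_rcons n u r : valid n (rcons u r) = valid n u && (r.+1 < n).
Proof. by rewrite /valid all_rcons andbC. Qed.

Lemma ninv_swp a x y b : x < y ->
  ninv (a ++ [:: y, x & b]) = (ninv (a ++ [:: x, y & b])).+1.
Proof.
move=> xy; elim: a => [|z a IH] /=; first by rewrite xy ltnNge ltnW //=; lia.
rewrite IH addnS; congr (_ + _).+1; apply: cntlt_perm; rewrite perm_cat2l.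
exact: perm_swap2.
Qed.

Lemma ninv_swp_le r t : ninv (swp r t) <= (ninv t).+1.
Proof.
have [h|h] := ltnP r.+1 (size t); last first.
  suff -> : swp r t = t by [].
  by elim: r t h => [|r IH] [|x [|y t]] //= h; rewrite IH.
have [a [x [y [b [-> <-]]]]] := split_at h; rewrite swp_cat.
case: (ltngtP x y) => [/ninv_swp -> //|/ninv_swp -> |-> //]; lia.
Qed.

Lemma ninv_act_le t u : ninv (act t u) <= ninv t + size u.
Proof.
elim/last_ind: u => [|u r IH] /=; first by rewrite addn0.
by rewrite act_rcons size_rcons; have := ninv_swp_le r (act t u); lia.
Qed.

Lemma ninv_sorted t : sorted ltn t -> ninv t = 0.
Proof.
elim: t => //= x t IH h; rewrite IH ?(path_sorted h) // addn0.
rewrite path_sortedE in h; last exact: ltn_trans.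
case/andP: h => /allP h _; rewrite /cntlt (eq_in_count (a2 := pred0)) ?count_pred0 //.
by move=> y /h /= ; lia.
Qed.

Lemma descent t : uniq t -> ~~ sorted ltn t ->
  exists a y x b, t = a ++ [:: y, x & b] /\ x < y.
Proof.
elim: t => [//|z [|w t] IH] // /= /andP [zt ut]; rewrite negb_and.
have [zw /= h|zw _] := boolP (z < w).
  have [a [y [x [b [E xy]]]]] := IH ut h.
  by exists (z :: a), y, x, b; rewrite E.
exists [::], z, w, t; split=> //.
by rewrite ltn_neqAle leqNgt zw andbT; apply: contraNneq zt => ->; rewrite mem_head.
Qed.

(** Sorting by removing descents, each of which costs one inversion. *)
Lemma red_exists mu v : sorted ltn mu -> perm_eq v mu ->
  exists u, [/\ valid (size mu) u, act mu u = v & size u = ninv v].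
Proof.
move=> smu; move: {2}(ninv v) (erefl (ninv v)) => N; elim: N v => [|N IH] v iv pv.
  exists [::]; split=> //; apply/esym.
  have uv : uniq v by rewrite (perm_uniq pv) (sorted_uniq ltn_trans ltnn).
  have [sv|/(descent uv) [a [y [x [b [E xy]]]]]] := boolP (sorted ltn v).
    exact: (irr_sorted_eq ltn_trans ltnn sv smu (perm_mem pv)).
  by move: iv; rewrite E ninv_swp.
have uv : uniq v by rewrite (perm_uniq pv) (sorted_uniq ltn_trans ltnn).
have [/ninv_sorted|/(descent uv) [a [y [x [b [E xy]]]]]] := boolP (sorted ltn v).
  by rewrite iv.
have i' : ninv (a ++ [:: x, y & b]) = N.
  by move: iv; rewrite E ninv_swp // => -[].
have [|u [vu au su]] := IH _ i'.
  by apply: perm_trans pv; rewrite E -(swp_cat a x y b) perm_sym perm_swp.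
exists (rcons u (size a)); split; last by rewrite size_rcons su i' iv.
  rewrite valid_rcons vu -(perm_size pv); exact: (size_split2 (esym (congr1 size E))).
by rewrite act_rcons au swp_cat E.
Qed.

Lemma take_cat_add (T : Type) (a s : seq T) j : take (size a + j) (a ++ s) = a ++ take j s.
Proof. by rewrite take_cat ltnNge leq_addr /= addKn. Qed.

Lemma cntlt_take_swp p k r t : r.+1 < size t ->
  cntlt p (take k (swp r t)) = if k == r.+1 then
    cntlt p (take r t) + cntlt p (take r.+2 t) - cntlt p (take r.+1 t)
    else cntlt p (take k t).
Proof.
move=> h; have [a [x [y [b [-> <-]]]]] := split_at h; rewrite swp_cat.
have [ka|ka] := leqP k (size a).
  have -> : k == (size a).+1 = false by lia.
  by rewrite !takel_cat.
have -> : k = size a + (k - size a - 1).+1 by lia.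
case: (k - size a - 1) => [|j].
  have t1 : take (size a).+1 (a ++ [:: x, y & b]) = a ++ [:: x].
    by rewrite -addn1 take_cat_add.
  have t2 : take (size a).+2 (a ++ [:: x, y & b]) = a ++ [:: x; y].
    by rewrite -addn2 take_cat_add /= take0.
  rewrite {2}addn1 eqxx t1 t2 take_cat_add take_size_cat //.
  by rewrite !cntlt_cat /=; lia.
have -> : size a + j.+2 == (size a).+1 = false by lia.
by rewrite !take_cat_add !cntlt_cat /=; lia.
Qed.

(** The right-hand side is monotone in the counts of [t]: this is why Demazure
    steps preserve [tdom]. *)
Lemma cntlt_take_dmz p k r t : uniq t -> r.+1 < size t ->
  cntlt p (take k (dmz r t)) = if k == r.+1 then
    maxn (cntlt p (take r t)) (cntlt p (take r.+2 t)).-1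
    else cntlt p (take k t).
Proof.
move=> ut h; have tr k' : k' < size t ->
    cntlt p (take k'.+1 t) = cntlt p (take k' t) + (nth 0 t k' < p).
  by move=> hk; rewrite (take_nth 0 hk) -cats1 cntlt_cat /= addn0.
have e1 := tr r (ltnW h); have e2 := tr r.+1 h.
rewrite /dmz; case: ifP => c; last first.
  case: eqP => // ->; rewrite e2 e1; move/negbT: c; rewrite -leqNgt.
  by case: (ltnP (nth 0 t r) p); case: (ltnP (nth 0 t r.+1) p); rewrite /=; lia.
rewrite cntlt_take_swp //; case: eqP => // _; rewrite e2 e1.
by case: (ltnP (nth 0 t r) p); case: (ltnP (nth 0 t r.+1) p); rewrite /=; lia.
Qed.

Lemma uniq_dmz r t : uniq t -> uniq (dmz r t).
Proof. by rewrite /dmz; case: ifP => // _ u; rewrite (perm_uniq (perm_swp r t)). Qed.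

Lemma tdom_dmz r v t : uniq v -> uniq t -> size v = size t -> r.+1 < size t ->
  tdom v t -> tdom (dmz r v) (dmz r t).
Proof.
move=> uv ut sz h d k p; rewrite !cntlt_take_dmz ?sz //.
case: eqP => _; last exact: d.
rewrite geq_max !leq_max (d r p) -!subn1 leq_sub2r ?orbT //; exact: (d r.+2 p).
Qed.

Lemma tdom_dmz_self r t : uniq t -> r.+1 < size t -> tdom t (dmz r t).
Proof.
move=> ut h k p; rewrite cntlt_take_dmz //; case: eqP => // ->.
have tr k' : k' < size t ->
    cntlt p (take k'.+1 t) = cntlt p (take k' t) + (nth 0 t k' < p).
  by move=> hk; rewrite (take_nth 0 hk) -cats1 cntlt_cat /= addn0.
rewrite (tr r.+1 h) (tr r (ltnW h)).
by case: (_ < p); case: (_ < p); rewrite /=; lia.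
Qed.

Lemma nth_pair a x y b : (nth 0 (a ++ [:: x, y & b]) (size a) = x) *
  (nth 0 (a ++ [:: x, y & b]) (size a).+1 = y).
Proof.
by split; rewrite nth_cat ?ltnn ?subnn // ltnNge leqW //= subSnn.
Qed.

Lemma dmz_up a x y b : x < y -> dmz (size a) (a ++ [:: x, y & b]) = a ++ [:: y, x & b].
Proof. by move=> xy; rewrite /dmz swp_cat !nth_pair xy. Qed.

Lemma dmz_down a x y b : x < y -> dmz (size a) (a ++ [:: y, x & b]) = a ++ [:: y, x & b].
Proof. by move=> xy; rewrite /dmz !nth_pair ltnNge ltnW. Qed.

Lemma tdom_up a x y b : uniq (a ++ [:: x, y & b]) -> x < y ->
  tdom (a ++ [:: x, y & b]) (a ++ [:: y, x & b]).
Proof.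
move=> u xy; rewrite -(dmz_up a b xy); apply: tdom_dmz_self => //.
exact: (size_split2 (erefl _)).
Qed.

Section Reduced.
Variables (mu : seq nat).
Hypothesis smu : sorted ltn mu.
Notation n := (size mu).

Definition reduced (u : seq nat) : bool := valid n u && (size u == ninv (act mu u)).

Lemma uniq_act u : uniq (act mu u).
Proof. by rewrite (perm_uniq (perm_act mu u)) (sorted_uniq ltn_trans ltnn). Qed.

Lemma uniq_dem u : uniq (dem mu u).
Proof.
elim/last_ind: u => [|u r IH]; first exact: (sorted_uniq ltn_trans ltnn).
by rewrite dem_rcons uniq_dmz.
Qed.

Lemma split_act u r : r.+1 < n -> exists a x y b,
  [/\ act mu u = a ++ [:: x, y & b], size a = r & x < y \/ y < x].
Proof.
move=> rn; have [|a [x [y [b [E s]]]]] := @split_at _ (act mu u) r; first by rewrite size_act.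
exists a, x, y, b; split=> //; have : x != y.
  by apply: contraTneq (uniq_act u) => xy; rewrite E xy cat_uniq /= mem_head !andbF.
by case: (ltngtP x y) => //; [left|right].
Qed.

Lemma reduced_rconsP u r : reduced (rcons u r) ->
  reduced u /\ exists a x y b, [/\ act mu u = a ++ [:: x, y & b], size a = r & x < y].
Proof.
case/andP; rewrite valid_rcons act_rcons size_rcons => /andP [vu rn] /eqP E.
have [a [x [y [b [Ea sa xy]]]]] := split_act u rn.
have := ninv_act_le mu u; rewrite (ninv_sorted smu) add0n => le.
case: xy => xy; move: E; rewrite Ea -sa swp_cat.
  rewrite (ninv_swp a b xy) => -[E]; split; last by exists a, x, y, b.
  by rewrite /reduced vu Ea E /=.
move=> E; exfalso; move: le; rewrite Ea (ninv_swp a b xy) -E.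
by rewrite ltnNge leqW.
Qed.

Lemma reduced_rcons u a x y b : reduced u -> act mu u = a ++ [:: x, y & b] ->
  x < y -> reduced (rcons u (size a)) /\ act mu (rcons u (size a)) = a ++ [:: y, x & b].
Proof.
move=> /andP [vu /eqP su] Ea xy; rewrite /reduced act_rcons valid_rcons vu Ea swp_cat.
rewrite size_rcons su Ea (ninv_swp a b xy) eqxx andbT; split=> //.
rewrite -(size_act mu u); exact: (size_split2 (esym (congr1 size Ea))).
Qed.

Lemma reduced_dem u : reduced u -> dem mu u = act mu u.
Proof.
elim/last_ind: u => // u r IH /reduced_rconsP [ru [a [x [y [b [E <- xy]]]]]].
by rewrite dem_rcons IH // act_rcons E swp_cat dmz_up.
Qed.
End Reduced.

Local Open Scope ring_scope.

(** * Ideals generated by idempotents of shapes *)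

Section Span.
Variable R : pzRingType.

(** Integral combinations suffice, since the coefficients in the local relations
    are 0, 1 and -1. *)
Inductive zspan (S : R -> Prop) : R -> Prop :=
| zspan_in x : S x -> zspan S x
| zspan0 : zspan S 0
| zspanB x y : zspan S x -> zspan S y -> zspan S (x - y).

Lemma zspanN S x : zspan S x -> zspan S (- x).
Proof. by move=> h; rewrite -sub0r; apply: zspanB => //; apply: zspan0. Qed.

Lemma zspanD S x y : zspan S x -> zspan S y -> zspan S (x + y).
Proof. by move=> hx hy; rewrite -[y]opprK; apply: zspanB => //; apply: zspanN. Qed.

Lemma zspan_bind S S' (f : R -> R) : f 0 = 0 -> {morph f : x y / x - y} ->
  (forall x, S x -> zspan S' (f x)) -> forall x, zspan S x -> zspan S' (f x).
Proof.
move=> f0 fB h x; elim=> [y /h //||y z _ IHy _ IHz].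
  by rewrite f0; apply: zspan0.
by rewrite fB; apply: zspanB.
Qed.

Lemma zspan_sub S S' x : (forall x, S x -> zspan S' x) -> zspan S x -> zspan S' x.
Proof. by move=> h; apply: (zspan_bind (f := id)). Qed.
End Span.

Section Datum.
Variables (R : pzRingType) (Z : nzRingType) (l : nat) (rho : nat -> Z).
Variables (P Y : nat -> R).
Implicit Types (a b i j : seq Z) (x y z : Z) (n k r s : nat).

Definition delta x y (u : R) : R := if x == y then u else 0.

Definition braid_sign x y z (u : R) : R :=
  if (z == x) && (x == y - 1) then - u
  else if (z == x) && (x == y + 1) then u else 0.

(** The local relations of the blob algebra on [n] strands, for idempotents [E]
    indexed by all sequences and zero off length [n].  Completeness of
    the idempotents is left out, so that fixing the last residue of a datum on
    [n.+1] strands gives a datum on [n] strands. *)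
Record datum (n : nat) (E : seq Z -> R) : Prop := {
  d_size : forall i, size i <> n -> E i = 0;
  d_EE : forall i, E i * E i = E i;
  d_EE0 : forall i j, i <> j -> E i * E j = 0;
  d_init : forall x i, (forall m, (m < l)%N -> x <> rho m) -> E (x :: i) = 0;
  d_blob : forall m i, (m < l)%N -> E [:: rho m, rho m + 1 & i] = 0;
  d_Y0 : forall i, Y 0 * E i = 0;
  d_YE : forall k i, (k < n)%N -> Y k * E i = E i * Y k;
  d_PE : forall a x y b,
    P (size a) * E (a ++ [:: x, y & b]) = E (a ++ [:: y, x & b]) * P (size a);
  d_PY : forall r k, (r.+1 < n)%N -> (k < n)%N -> k <> r -> k <> r.+1 ->
    P r * Y k = Y k * P r;
  d_PP : forall r s, (s.+1 < n)%N -> (r.+1 < s)%N -> P r * P s = P s * P r;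
  d_PYhi : forall a x y b, P (size a) * Y (size a).+1 * E (a ++ [:: x, y & b]) =
    Y (size a) * P (size a) * E (a ++ [:: x, y & b])
      - delta x y (E (a ++ [:: x, y & b]));
  d_YhiP : forall a x y b, Y (size a).+1 * P (size a) * E (a ++ [:: x, y & b]) =
    P (size a) * Y (size a) * E (a ++ [:: x, y & b])
      - delta x y (E (a ++ [:: x, y & b]));
  d_P2eq : forall a x b, P (size a) * P (size a) * E (a ++ [:: x, x & b]) = 0;
  d_P2far : forall a x y b, unlinked x y ->
    P (size a) * P (size a) * E (a ++ [:: x, y & b]) = E (a ++ [:: x, y & b]);
  d_P2up : forall a x b, P (size a) * P (size a) * E (a ++ [:: x, x + 1 & b]) =
    (Y (size a).+1 - Y (size a)) * E (a ++ [:: x, x + 1 & b]);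
  d_P2down : forall a x b, P (size a) * P (size a) * E (a ++ [:: x, x - 1 & b]) =
    (Y (size a) - Y (size a).+1) * E (a ++ [:: x, x - 1 & b]);
  d_braid : forall a x y z b,
    P (size a) * P (size a).+1 * P (size a) * E (a ++ [:: x, y, z & b]) =
    P (size a).+1 * P (size a) * P (size a).+1 * E (a ++ [:: x, y, z & b])
      + braid_sign x y z (E (a ++ [:: x, y, z & b])) }.

Lemma datum_rcons n E x : datum n.+1 E -> datum n (fun i => E (rcons i x)).
Proof.
move=> D; split=> * /=; rewrite ?rcons_cat /=.
- by apply: (d_size D); rewrite size_rcons; case.
- exact: (d_EE D).
- by apply: (d_EE0 D) => /rcons_inj [].
- exact: (d_init D).
- exact: (d_blob D).
- exact: (d_Y0 D).
- by apply: (d_YE D); rewrite ltnW.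
- exact: (d_PE D).
- by apply: (d_PY D) => //; apply: ltnW.
- by apply: (d_PP D) => //; apply: ltnW.
- exact: (d_PYhi D).
- exact: (d_YhiP D).
- exact: (d_P2eq D).
- exact: (d_P2far D).
- exact: (d_P2up D).
- exact: (d_P2down D).
exact: (d_braid D).
Qed.

Inductive mono (n : nat) : R -> Prop :=
| mono1 : mono n 1
| monoP u r : (r.+1 < n)%N -> mono n u -> mono n (u * P r)
| monoY u k : (k < n)%N -> mono n u -> mono n (u * Y k).

Lemma monoM n u v : mono n u -> mono n v -> mono n (u * v).
Proof.
move=> hu; elim=> [|v' r rn _ IH|v' k kn _ IH]; first by rewrite mulr1.
  by rewrite mulrA; apply: monoP.
by rewrite mulrA; apply: monoY.
Qed.

Lemma mono_P n r : (r.+1 < n)%N -> mono n (P r).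
Proof. by move=> h; rewrite -[P r]mul1r; apply: monoP => //; apply: mono1. Qed.

Lemma mono_Y n k : (k < n)%N -> mono n (Y k).
Proof. by move=> h; rewrite -[Y k]mul1r; apply: monoY => //; apply: mono1. Qed.

Lemma mono_leq n m u : (n <= m)%N -> mono n u -> mono m u.
Proof.
move=> nm; elim=> [|v r rn _ IH|v k kn _ IH]; first exact: mono1.
  by apply: monoP => //; apply: leq_trans nm.
by apply: monoY => //; apply: leq_trans nm.
Qed.

Record gideal (n : nat) (J : R -> Prop) : Prop := {
  g0 : J 0;
  gB : forall u v, J u -> J v -> J (u - v);
  gMl : forall m u, mono n m -> J u -> J (m * u);
  gMr : forall m u, mono n m -> J u -> J (u * m) }.

Definition idl_gen n (E : seq Z -> R) (U : seq nat -> Prop) (z : R) : Prop :=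
  exists (nu : seq nat) (a a' : R), [/\ is_shape l nu, size nu = n & U nu] /\
    [/\ mono n a, mono n a' & z = a * E (map rho nu) * a'].

Definition idl n E U : R -> Prop := zspan (idl_gen n E U).

Lemma idl_gideal n E U : gideal n (idl n E U).
Proof.
split; [exact: zspan0|by move=> *; apply: zspanB|move=> m u hm|move=> m u hm].
  apply: zspan_bind => [|v w|v]; [exact: mulr0|exact: mulrBr|].
  case=> nu [a [a' [h [ha ha' ->]]]]; apply: zspan_in.
  by exists nu, (m * a), a'; rewrite !mulrA; do !split=> //; apply: monoM.
apply: (zspan_bind (f := fun u => u * m)) => [|v w|v]; [exact: mul0r|exact: mulrBl|].
case=> nu [a [a' [h [ha ha' ->]]]]; apply: zspan_in.
by exists nu, a, (a' * m); rewrite !mulrA; do !split=> //; apply: monoM.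
Qed.

Lemma idl_E n E (U : seq nat -> Prop) nu : is_shape l nu -> size nu = n -> U nu ->
  idl n E U (E (map rho nu)).
Proof.
move=> h1 h2 h3; apply: zspan_in; exists nu, 1, 1; rewrite mulr1 mul1r.
by do !split => //; apply: mono1.
Qed.

(** Ideals are compared through their generators. *)
Lemma idl_sub n m E (U : seq nat -> Prop) J (u : R) : (n <= m)%N -> gideal m J ->
  (forall nu, is_shape l nu -> size nu = n -> U nu -> J (E (map rho nu))) ->
  idl n E U u -> J u.
Proof.
move=> nm G h; elim=> [v|| v w _ hv _ hw]; last exact: (gB G); last exact: (g0 G).
case=> nu [a [a' [[h1 h2 h3] [ha ha' ->]]]].
apply: (gMr G); first exact: mono_leq ha'.
by apply: (gMl G); [exact: mono_leq ha|apply: h].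
Qed.

Section Moves.
Variables (n : nat) (E : seq Z -> R) (J : R -> Prop).
Hypotheses (D : datum n E) (G : gideal n J).

Lemma E_small i u : ((size i = n) -> J (u * E i)) -> J (u * E i).
Proof.
move=> h; have [/h //|/eqP /(d_size D) ->] := eqVneq (size i) n.
by rewrite mulr0; apply: (g0 G).
Qed.

Lemma E_small1 i : ((size i = n) -> J (E i)) -> J (E i).
Proof. by move=> h; rewrite -[E i]mul1r; apply: E_small; rewrite mul1r. Qed.

Lemma size_split a x y b : size (a ++ [:: x, y & b]) = n -> ((size a).+1 < n)%N.
Proof. by rewrite size_cat /= => <-; rewrite !addnS !ltnS leq_addr. Qed.

(** The crossing of two unlinked strands is invertible. *)
Lemma far_conj a x y b : unlinked x y ->
  E (a ++ [:: y, x & b]) = P (size a) * E (a ++ [:: x, y & b]) * P (size a).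
Proof.
move=> h; rewrite -(d_P2far D); last by rewrite unlinked_sym.
by rewrite -mulrA (d_PE D) mulrA.
Qed.

Lemma swapE a x y b : unlinked x y ->
  J (E (a ++ [:: x, y & b])) -> J (E (a ++ [:: y, x & b])).
Proof.
move=> h hJ; apply: E_small1 => /size_split rn.
rewrite (far_conj _ _ h); have hP := mono_P rn.
by apply: (gMr G) => //; apply: (gMl G).
Qed.

Lemma swapYfar k a x y b : (k < n)%N -> k <> size a -> k <> (size a).+1 ->
  unlinked x y ->
  J (Y k * E (a ++ [:: x, y & b])) -> J (Y k * E (a ++ [:: y, x & b])).
Proof.
move=> kn k1 k2 h hJ; apply: E_small => /size_split rn.
rewrite (far_conj _ _ h) !mulrA -(d_PY D) // -2!mulrA (mulrA (Y k)); have hP := mono_P rn.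
by apply: (gMl G) => //; apply: (gMr G).
Qed.

Lemma swapYhi a x y b : unlinked x y ->
  J (Y (size a) * E (a ++ [:: x, y & b])) ->
  J (Y (size a).+1 * E (a ++ [:: y, x & b])).
Proof.
move=> h hJ; apply: E_small => /size_split rn; have hP := mono_P rn.
rewrite (far_conj _ _ h) !mulrA (d_YhiP D) /delta.
have /and3P [/negPf -> _ _] := h; rewrite subr0 -[P _ * Y _ * _]mulrA.
by apply: (gMr G) => //; apply: (gMl G).
Qed.

Lemma swapR u a x y b : unlinked x y ->
  (forall m, mono n m -> J (u * m * E (a ++ [:: x, y & b]))) ->
  forall m, mono n m -> J (u * m * E (a ++ [:: y, x & b])).
Proof.
move=> h hJ m hm; apply: E_small => /size_split rn; have hP := mono_P rn.
rewrite (far_conj _ _ h) mulrA; apply: (gMr G) => //.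
by rewrite mulrA -(mulrA u); apply: hJ; apply: monoM.
Qed.

Lemma moveE_left a x q b : all (unlinked x) q ->
  J (E (a ++ x :: q ++ b)) -> J (E (a ++ q ++ x :: b)).
Proof.
elim: q a => [//|y q IH] a /= /andP [xy xq] h.
by rewrite -cat_rcons; apply: IH => //; rewrite cat_rcons; apply: swapE.
Qed.

Lemma moveE_right a x q b : all (unlinked x) q ->
  J (E (a ++ q ++ x :: b)) -> J (E (a ++ x :: q ++ b)).
Proof.
elim: q a => [//|y q IH] a /= /andP [xy xq] h.
apply: swapE; first by rewrite unlinked_sym.
by rewrite -cat_rcons; apply: IH => //; rewrite cat_rcons.
Qed.

Lemma moveR_left u a x q b : all (unlinked x) q ->
  (forall m, mono n m -> J (u * m * E (a ++ x :: q ++ b))) ->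
  forall m, mono n m -> J (u * m * E (a ++ q ++ x :: b)).
Proof.
elim: q a => [//|y q IH] a /= /andP [xy xq] h.
by rewrite -cat_rcons; apply: IH => //; rewrite cat_rcons; apply: swapR.
Qed.

(** Write [psi] for the crossing of the pair, [y], [y'] for the dots on its
    strands and [e] for the idempotent.  If [y e] is in [J] then so is
    [psi e = psi (y psi - psi y') e = psi y e psi - psi^2 e y'], because [psi^2 e = 0],
    and then so is [e = psi y e - y' psi e]. *)
Lemma equal_pair a x b : J (Y (size a) * E (a ++ [:: x, x & b])) ->
  J (E (a ++ [:: x, x & b])).
Proof.
move=> h; apply: E_small1 => hs; have rn := size_split hs.
have r1n : (size a < n)%N by apply: ltnW.
set e := E _ in h *; set r := size a in h rn r1n *.
have eP : P r * e = e * P r by apply: (d_PE D).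
have eY1 : Y r.+1 * e = e * Y r.+1 by apply: (d_YE D).
have eY : Y r * e = e * Y r by apply: (d_YE D).
have h1 := d_PYhi D a x x b; have h2 := d_YhiP D a x x b.
have h0 := d_P2eq D a x b.
move: h1 h2 h0; rewrite /delta eqxx -/e -/r => h1 h2 h0.
have e1 : e = Y r * P r * e - P r * Y r.+1 * e by rewrite h1 opprB addrC subrK.
have e2 : e = P r * Y r * e - Y r.+1 * P r * e by rewrite h2 opprB addrC subrK.
have hP := mono_P rn; have hY := mono_Y rn.
have Pe : J (P r * e).
  rewrite {1}e1 mulrBr -[P r * Y r.+1 * e]mulrA -[Y r * P r * e]mulrA eP eY1.
  rewrite [Y r * _]mulrA [P r * (P r * _)]mulrA [P r * P r * (_ * _)]mulrA h0.
  by rewrite mul0r subr0; apply: (gMl G) => //; apply: (gMr G).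
rewrite e2; apply: (gB G).
  by rewrite -mulrA; apply: (gMl G).
by rewrite -mulrA; apply: (gMl G).
Qed.

(** The correction term of the braid relation on these three strands is the
    idempotent itself, up to sign. *)
Lemma braid_triple a x b :
  J (P (size a) * E (a ++ [:: x, x - 1, x & b])) ->
  J (P (size a).+1 * E (a ++ [:: x, x - 1, x & b])) ->
  J (E (a ++ [:: x, x - 1, x & b])).
Proof.
move=> h1 h2; apply: E_small1 => hs; have rn := size_split hs.
have r1n : ((size a).+2 < n)%N by rewrite -hs size_cat /=; lia.
have := d_braid D a x (x - 1) x b; rewrite /braid_sign eqxx subrK eqxx /=.
set e := E _ in h1 h2 *.
have hP := mono_P rn; have hP1 := mono_P r1n.
have t1 : J (P (size a) * P (size a).+1 * P (size a) * e).
  by rewrite -!mulrA; do 2!apply: (gMl G) => //.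
have t2 : J (P (size a).+1 * P (size a) * P (size a).+1 * e).
  by rewrite -!mulrA; do 2!apply: (gMl G) => //.
move: t1 t2; set u := _ * e; set v := _ * e => t1 t2; case: ifP => _ uv.
  by have -> : e = v - u; [rewrite uv opprB addrC subrK|apply: (gB G)].
by have -> : e = u - v; [rewrite uv addrAC subrr add0r|apply: (gB G)].
Qed.
End Moves.
End Datum.

(** * Idempotents and dots lie in ideals of dominant shapes *)

Section Levels.
Variables (R : pzRingType) (Z : nzRingType) (l : nat) (rho : nat -> Z).
Variables (P Y : nat -> R).
Hypothesis l_gt0 : (0 < l)%N.
Hypothesis rhoS : forall p, rho (p + l)%N = rho p - 1.
Hypothesis rho_apart : forall p p', (p < p' < p + l)%N -> unlinked (rho p) (rho p').
Hypothesis two_neq0 : (1 + 1 : Z) != 0.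
Notation tabs := (tabs l rho).
Notation addable := (addable l).
Notation is_shape := (is_shape l).
Notation std := (stdfrom l [::]).
Notation idl := (idl l rho P Y).
Notation mono := (mono P Y).
Notation gideal := (gideal P Y).
Notation datum := (datum l rho P Y).
Implicit Types (U : seq nat -> Prop) (mu nu : seq nat).

Definition upper U : Prop := forall mu nu, is_shape mu -> is_shape nu ->
  size nu = size mu -> dom nu mu -> U mu -> U nu.

Definition above mu nu : Prop := [/\ size nu = size mu, dom nu mu & nu <> mu].

Lemma upper_above mu : is_shape mu -> upper (above mu).
Proof.
move=> hmu nu xi hnu hxi sz d [s1 d1 ne]; split; first by rewrite sz.
  exact: dom_trans d d1.
move=> E; apply: ne; apply: dom_anti; rewrite ?(shape_sorted hnu) ?(shape_sorted hmu) //.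
by rewrite -E.
Qed.

Lemma sort_perm_eq (s t : seq nat) : perm_eq s t -> sort leq s = sort leq t.
Proof. move/perm_sortP; apply; [exact: leq_total|exact: leq_trans|exact: anti_leq]. Qed.

Lemma cntlt_sort p s : cntlt p (sort leq s) = cntlt p s.
Proof. by apply: cntlt_perm; rewrite perm_sort. Qed.

Lemma cntlt_rcons p s x : cntlt p (rcons s x) = (cntlt p s + (x < p))%N.
Proof. by rewrite -cats1 cntlt_cat /= addn0. Qed.

Lemma tabs_std j s : tabs j s -> std s. Proof. by case. Qed.

Lemma tabs_size j s : tabs j s -> size s = size j.
Proof. by case=> _ <-; rewrite size_map. Qed.

Lemma tabs_shape j s : tabs j s -> is_shape (sort leq s).
Proof. by move/tabs_std; apply: shape_sort. Qed.

Lemma tabs_rcons j s b x : tabs j s -> addable (sort leq s) x -> rho x = b ->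
  tabs (rcons j b) (rcons s x).
Proof.
case=> ss <- ax <-; split; last by rewrite map_rcons.
by rewrite stdfrom_rcons ss -(eq_addable _ (mem_sort leq s)).
Qed.

(** The row reading of the shape of [s] is the least dominant tableau with its
    residues, so a tableau with the residues of this row reading followed by [b]
    dominates the extension of [s] by some single node of residue [b]. *)
Lemma extension_upper U j s b c : upper U -> tabs j s ->
  (forall d, tabs (rcons j b) d -> U (sort leq d)) ->
  tabs (rcons (map rho (sort leq s)) b) c -> U (sort leq c).
Proof.
move=> up ts hU tc.
have [x [ax rx d]] := tabs_shape_dom1 l_gt0 rhoS rho_apart (tabs_shape ts) tc.
have tx := tabs_rcons ts ax rx.
apply: (up (sort leq (rcons s x))); first exact: tabs_shape tx.
- exact: tabs_shape tc.
- by rewrite !size_sort (tabs_size tc) size_rcons size_map size_sort size_rcons.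
- move=> p; rewrite !cntlt_sort; apply: leq_trans (d p).
  by rewrite !cntlt_rcons cntlt_sort.
exact: hU.
Qed.

(** What the induction on the number of strands carries along.  The truncation
    property is what lets a prefix of a residue sequence be replaced by the row
    readings of the shapes of its standard tableaux. *)
Record level (n : nat) (E : seq Z -> R) : Prop := {
  level_idm : forall U, upper U -> forall j,
    (forall c, tabs j c -> U (sort leq c)) -> idl n E U (E j);
  level_dot : forall mu k, is_shape mu -> size mu = n -> (k < n)%N ->
    idl n E (above mu) (Y k * E (map rho mu));
  level_trunc : forall U, upper U -> forall z i, idl n E U z ->
    idl n E (fun nu => U nu /\ exists2 c, tabs i c & sort leq c = nu) (z * E i) }.

(** The two strands of a Garnir sequence stand in the wrong order, so all standard
    tableaux with its residues have a more dominant shape. *)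
Lemma garnir_idl n E th X Q tl W1 W2 :
  (forall U, upper U -> forall j, (forall c, tabs j c -> U (sort leq c)) ->
    idl n E U (E j)) ->
  is_shape (th ++ X :: Q ++ (X + l)%N :: tl) -> perm_eq (W1 ++ W2) Q ->
  idl n E (above (th ++ X :: Q ++ (X + l)%N :: tl))
    (E (map rho (th ++ W1 ++ [:: (X + l)%N, X & W2 ++ tl]))).
Proof.
move=> idm sh pW; apply: idm; first exact: upper_above.
move=> c tc; have [d ne] := garnir_dom l_gt0 rhoS rho_apart two_neq0 sh pW tc.
split=> //; rewrite size_sort (tabs_size tc) size_map; have := perm_size pW.
by do 3!rewrite ?size_cat /=; lia.
Qed.

Section Step.
Variables (n : nat) (E : seq Z -> R).
Hypothesis D : datum n.+1 E.
Hypothesis IH : forall b, level n (fun i => E (rcons i b)).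

(** As [E] is idempotent, the ideal generated by all shapes may be truncated by the
    prefix [j]; only the row readings of the shapes of its tableaux survive. *)
Lemma prefix_reduce J j b : gideal n.+1 J ->
  (forall s, tabs j s -> J (E (rcons (map rho (sort leq s)) b))) ->
  J (E (rcons j b)).
Proof.
move=> G h; rewrite -(d_EE D).
have h1 : idl n (fun i => E (rcons i b)) (fun=> True) (E (rcons j b)).
  exact: (level_idm (IH b)).
have h2 : upper (fun=> True) by [].
have := level_trunc (IH b) h2 j h1.
apply: (idl_sub _ G) => // nu _ _ [_ [c tc <-]]; exact: h.
Qed.

Lemma above_reduce J mu b z : gideal n.+1 J -> is_shape mu ->
  (forall s, tabs (map rho mu) s -> above mu (sort leq s) ->
    J (E (rcons (map rho (sort leq s)) b))) ->
  idl n (fun i => E (rcons i b)) (above mu) z ->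
  J (z * E (rcons (map rho mu) b)).
Proof.
move=> G sh h hz.
have := level_trunc (IH b) (upper_above sh) (map rho mu) hz.
apply: (idl_sub _ G) => // nu _ _ [ab [c tc ec]]; rewrite -ec; apply: h => //.
by rewrite ec.
Qed.

Lemma shape_rcons mu x : is_shape mu -> addable mu x -> all (ltn^~ x) mu ->
  is_shape (rcons mu x).
Proof.
case/andP=> ss st ax mx; apply/andP; split; last by rewrite stdfrom_rcons st.
by move: ss mx; case: (mu) => [//|y u] /= ss; rewrite rcons_path ss /= => /andP [yx /allP h];
  case: (lastP u) h {ss} => [//|u' z] h; rewrite last_rcons h // mem_rcons mem_head.
Qed.

Lemma shape_rconsP mu x : is_shape (rcons mu x) ->
  [/\ is_shape mu, addable mu x & all (ltn^~ x) mu].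
Proof.
case/andP=> ss; rewrite stdfrom_rcons => /andP [st ax].
move: ss; rewrite (sorted_pairwise ltn_trans) pairwise_rcons => /andP [mx pm].
by rewrite /is_shape (sorted_pairwise ltn_trans) pm st.
Qed.

Lemma unlinked_shift (x y : Z) : unlinked (x + 1) y = unlinked x (y - 1).
Proof.
rewrite /unlinked subrK (inj_eq (addIr _)) [x + 1 == y - 1]eq_sym.
rewrite [x == y - 1]eq_sym [x == y - 1 - 1]eq_sym !subr_eq [x + 1 == y]eq_sym.
by congr andb.
Qed.

Lemma above_replace mu g x s t : is_shape (rcons mu g) -> std s ->
  perm_eq t (rcons mu x) -> size s = (size mu).+1 -> (x < g)%N -> dom s t ->
  above (rcons mu g) (sort leq s).
Proof.
move=> sh hs pt sz xg d.
have [_ _ mg] := shape_rconsP sh.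
have d' p : (cntlt p mu + (x < p) <= cntlt p s)%N.
  by rewrite -cntlt_rcons -(cntlt_perm p pt); apply: d.
split; first by rewrite size_sort sz size_rcons.
  move=> p; rewrite cntlt_sort cntlt_rcons; apply: leq_trans (d' p); rewrite leq_add2l.
  by case: (ltnP g p) => // gp; rewrite (ltn_trans xg gp).
move=> E'; have := d' g; rewrite xg -(cntlt_sort g s) E' cntlt_rcons ltnn addn0.
by lia.
Qed.

Lemma core_reduce U J mu j b : gideal n.+1 J -> upper U ->
  (forall nu b', is_shape nu -> size nu = n -> (sumn nu < sumn mu)%N ->
    (forall c, tabs (rcons (map rho nu) b') c -> U (sort leq c)) ->
    J (E (rcons (map rho nu) b'))) ->
  is_shape mu -> size mu = n ->
  (forall d, tabs (rcons j b) d -> U (sort leq d)) ->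
  forall s, tabs j s -> above mu (sort leq s) ->
    J (E (rcons (map rho (sort leq s)) b)).
Proof.
move=> G up ih sh sz hU s ts [s1 d ne]; apply: ih.
- exact: tabs_shape ts.
- by rewrite s1.
- by apply: dom_sumn_lt => //; [apply: (shape_sorted (tabs_shape ts))|apply: (shape_sorted sh)].
by move=> c tc; apply: (extension_upper up ts hU tc).
Qed.

(** The key step: a row reading followed by one more residue [b].  The last node [g]
    of [mu] is compared with [b].
    - If [b] is the residue of an addable node below [mu], the sequence is itself a
      row reading.
    - If [rho g] and [b] are unlinked, their strands are swapped, and the induction
      on strands applies to the prefix, now ending in [b].
    - If [rho g = b], the dot on the strand of [g] is small by induction, and
      [equal_pair] applies.
    - If [rho g = b + 1], the node below [g] is addable with residue [b], which is
      the first case.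
    - If [rho g = b - 1] and [g] is in the first row, both strands can be moved to
      the front, where the blob relation kills them.
    - If [rho g = b - 1] and [g = X + l], the strand of [X], of residue [b], is moved
      next to [g]; the braid relation on [b, b - 1, b] then leaves a Garnir sequence
      and a sequence with [b, b] at the place of [X].
    Whenever a prefix is replaced by row readings, their shapes are strictly above
    [mu], and the induction on the sum of the nodes applies. *)
Lemma core U mu b : upper U -> is_shape mu -> size mu = n ->
  (forall c, tabs (rcons (map rho mu) b) c -> U (sort leq c)) ->
  idl n.+1 E U (E (rcons (map rho mu) b)).
Proof.
move=> up; move: {2}(sumn mu).+1 (ltnSn (sumn mu)) => N.
elim: N mu b => // N IHN mu b; rewrite ltnS => lN sh sz hU.
set J := idl n.+1 E U; have G : gideal n.+1 J := idl_gideal l rho P Y n.+1 E U.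
have ih nu b' : is_shape nu -> size nu = n -> (sumn nu < sumn mu)%N ->
    (forall c, tabs (rcons (map rho nu) b') c -> U (sort leq c)) ->
    J (E (rcons (map rho nu) b')).
  by move=> h1 h2 h3; apply: IHN => //; apply: leq_trans lN.
have red := core_reduce G up ih sh sz.
have [[x [ax rx mx]]|alpha] :=
  pselect (exists x, [/\ addable mu x, rho x = b & all (ltn^~ x) mu]).
  have sx := shape_rcons sh ax mx.
  have -> : rcons (map rho mu) b = map rho (rcons mu x) by rewrite map_rcons rx.
  apply: idl_E; rewrite ?size_rcons ?sz //.
  rewrite -(sort_shape sx); apply: hU.
  by split; [exact: shape_std|rewrite map_rcons rx].
move: lN sh sz hU ih red alpha; case: (lastP mu) => [|mu' g] lN sh sz hU ih red alpha.
  rewrite (d_init D); first exact: (g0 G).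
  by move=> m ml E0; apply: alpha; exists m; rewrite /addable ml.
have [sh' ag mg] := shape_rconsP sh.
(* no addable node of residue b lies beyond mu, so all but g precede g *)
have beta x : addable mu' x -> x != g -> rho x = b -> (x < g)%N.
  move=> /andP [xm xl] xg rx; rewrite ltnNge leq_eqVlt eq_sym (negPf xg) /=.
  apply/negP=> gx; apply: alpha; exists x; split=> //.
    rewrite /addable !mem_rcons !inE negb_or xg xm /=.
    by case/orP: xl => ->; rewrite ?orbT.
  rewrite all_rcons /= gx /=; apply/allP=> y /(allP mg) h; exact: ltn_trans gx.
have [ung|lk] := boolP (unlinked (rho g) b).
  have Ej : rcons (map rho (rcons mu' g)) b = map rho mu' ++ [:: rho g; b].
    by rewrite map_rcons -!cats1 -catA.
  rewrite Ej; apply: (swapE D G); first by rewrite unlinked_sym.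
  rewrite -cat1s catA cats1 cats1; apply: prefix_reduce => // s ts.
  apply: (red _ (rho g) _ _ ts) => [c tc|].
    have [sc rc] := tc.
    move: rc sc; case: (lastP c) => [|c1 g'].
      by move/(congr1 size); rewrite !size_rcons.
    case: (lastP c1) => [|c0 z]; first by move/(congr1 size); rewrite !size_rcons.
    rewrite !map_rcons => /rcons_inj [/rcons_inj [r0 rz] rg] sc.
    have -> : sort leq (rcons (rcons c0 z) g') = sort leq (rcons (rcons c0 g') z).
      by apply: sort_perm_eq; rewrite -!cats1 -!catA perm_cat2l perm_catC.
    apply: hU; split; last by rewrite !map_rcons r0 rz rg.
    move: sc; rewrite -!cats1 -!catA stdfrom_cat cat0s [X in _ -> is_true X]stdfrom_cat => /andP [-> h].
    apply: (stdfrom_move l_gt0 (x := z) (q := [:: g']) (r := [::])) => //.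
    rewrite inE; apply: contraTneq ung => E'.
    by rewrite -rg -E' rhoS rz /unlinked eqxx !andbF.
  have [x [ax rx d]] := tabs_shape_dom1 l_gt0 rhoS rho_apart sh' ts.
  apply: (above_replace sh (tabs_std ts) (perm_refl (rcons mu' x)) _ _ d).
    by rewrite (tabs_size ts) size_rcons size_map.
  apply: beta => //; apply: contraTneq ung => <-; by rewrite rx /unlinked eqxx.
have dot : J (Y (size mu') * E (rcons (map rho (rcons mu' g)) b)).
  rewrite -(d_EE D) mulrA; apply: above_reduce => //.
    by move=> s ts ab; apply: red ts ab.
  by apply: (level_dot (IH b)); rewrite // -sz size_rcons.
have mgb : rho g = b \/ rho g = b - 1.
  have [E1|E1] := eqVneq (rho g) b; first by left.
  have [E2|E2] := eqVneq (rho g) (b - 1); first by right.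
  have E3 : rho g = b + 1.
    by apply/eqP; move: lk; rewrite /unlinked E1 E2 andbT /= negbK.
  case: alpha; exists (g + l)%N; split; first last.
  - rewrite all_rcons /= -addn1 leq_add2l l_gt0 /=.
    by apply/allP=> y /(allP mg) h; apply: ltn_trans h _; rewrite -addn1 leq_add2l.
  - by rewrite rhoS E3 addrK.
  rewrite /addable !mem_rcons !inE addnK eqxx !orbT andbT negb_or.
  apply/andP; split; first by apply/eqP; lia.
  by apply/negP=> /(allP mg) /=; lia.
case: mgb => rg.
  have Ej : rcons (map rho (rcons mu' g)) b = map rho mu' ++ [:: b; b].
    by rewrite map_rcons -!cats1 -catA rg.
  by rewrite Ej; apply: (equal_pair D G); rewrite size_map -Ej.
have bg : b = rho g + 1 by rewrite rg subrK.
have uQ q : (q < g < q + l)%N -> unlinked (rho q) (rho g) by apply: rho_apart.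
have [gl|lg] := ltnP g l.
  have Ej : rcons (map rho (rcons mu' g)) b = map rho mu' ++ rho g :: [:: b].
    by rewrite map_rcons -!cats1 -catA.
  rewrite Ej; apply: (moveE_left D G (a := [::])).
    apply/allP=> _ /mapP [q qm ->]; rewrite unlinked_sym; apply: uQ.
    by have := allP mg q qm; rewrite /=; lia.
  rewrite -[_ :: _]cat1s; apply: (moveE_left D G (b := [::])).
    apply/allP=> _ /mapP [q qm ->]; rewrite bg unlinked_shift -rhoS.
    by apply: rho_apart; have := allP mg q qm; rewrite /=; lia.
  rewrite cats0 /= bg (d_blob D) //; exact: (g0 G).
have Xm : (g - l)%N \in mu'.
  have := std_closed (shape_std sh) => /allP /(_ g); rewrite mem_rcons mem_head.
  move=> /(_ isT); rewrite ltnNge lg /= mem_rcons inE => /orP [/eqP|//]; lia.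
have {Xm} [X gX Xm] : exists2 X, g = (X + l)%N & X \in mu' by exists (g - l)%N; rewrite ?subnK.
case/splitPr: Xm lN sh sz hU ih red alpha sh' ag mg beta dot => th Q.
move=> lN sh sz hU ih red alpha sh' ag mg beta dot.
have rX : rho X = b by rewrite bg gX rhoS subrK.
have sQ q : q \in Q -> (X < q < X + l)%N.
  move=> qQ; have := shape_sorted sh'; rewrite (sorted_pairwise ltn_trans).
  rewrite pairwise_cat /= => /and4P [_ _ /allP h _]; rewrite (h q qQ) -gX /=.
  by apply: (allP mg); rewrite mem_cat inE qQ !orbT.
have uXQ : all (unlinked b) (map rho Q).
  by apply/allP=> _ /mapP [q /sQ h ->]; rewrite -rX; apply: rho_apart.
have uQ' c : c \in map rho Q -> c <> b /\ c <> b - 1.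
  move=> cQ; have /unlinkedP [h1 _ _ _ h2] := allP uXQ c cQ.
  by split=> // h; apply: h1.
have szQ : n = (size th + size Q).+2.
  by rewrite -sz size_rcons size_cat /= addnS.
have Ej : rcons (map rho (rcons (th ++ X :: Q) g)) b =
    map rho th ++ b :: map rho Q ++ [:: b - 1; b].
  by rewrite map_rcons map_cat /= rX rg -!cats1 -!catA.
rewrite Ej; apply: (moveE_right D G uXQ); rewrite catA.
apply: (braid_triple D G).
  pose Eb i := E (rcons i b); set a := map rho th ++ map rho Q.
  have Db : datum n Eb := datum_rcons b D.
  have Gn : gideal n J.
    by split; [exact: (g0 G)|exact: (gB G)| |] => m u /(mono_leq (leqnSn n)) hm;
      [apply: (gMl G)|apply: (gMr G)].
  have hz : idl n Eb (above (rcons (th ++ X :: Q) g)) (Eb (a ++ [:: b - 1; b])).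
    have shg : is_shape (th ++ X :: Q ++ [:: (X + l)%N]).
      by move: sh; rewrite -cats1 -catA gX.
    have := garnir_idl (W1 := Q) (W2 := [::]) (level_idm (IH b)) shg.
    rewrite cats0 perm_refl => /(_ isT); rewrite /Eb /a !map_cat /= -gX rg rX -!cats1 -!catA.
    by [].
  set z := Eb (a ++ [:: b - 1; b]) in hz.
  have hm m : mono n m -> J (z * m * Eb (a ++ [:: b, b - 1 & [::]])).
    rewrite /a -catA; move: m; apply: (moveR_left Db Gn uXQ) => m hm.
    have -> : Eb (map rho th ++ b :: map rho Q ++ [:: b - 1]) =
        E (rcons (map rho (rcons (th ++ X :: Q) g)) b).
      by rewrite /Eb Ej -cats1 -!catA /= -catA.
    apply: above_reduce => // [s ts ab|]; first exact: red ts ab.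
    by apply: (gMr (idl_gideal _ _ _ _ _ _ _)).
  have -> : E (a ++ [:: b, b - 1, b & [::]]) = Eb (a ++ [:: b; b - 1]).
    by rewrite /Eb -cats1 -catA.
  rewrite -(d_EE Db) mulrA (d_PE Db); apply: hm.
  by apply: mono_P; rewrite /a size_cat !size_map szQ.
have -> : (size (map rho th ++ map rho Q)).+1 = size (rcons (map rho th ++ map rho Q) b).
  by rewrite size_rcons.
rewrite -cat_rcons (d_PE D); apply: (gMr G).
  by apply: mono_P; rewrite size_rcons size_cat !size_map szQ.
rewrite cat_rcons -catA; apply: (moveE_left D G uXQ).
rewrite -cat_rcons; apply: (moveE_left D G uXQ); rewrite cat_rcons.
have -> : map rho th ++ [:: b, b & map rho Q ++ [:: b - 1]] =
    rcons (map rho th ++ [:: b, b & map rho Q]) (b - 1).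
  by rewrite -cats1 -catA.
have h1 (x : Z) : x <> x - 1.
  by move/eqP; rewrite -subr_eq0 opprB addrC subrK oner_eq0.
apply: prefix_reduce => // s ts; apply: (red _ (b - 1) _ _ ts) => [c tc|].
  have [sc] := tc; rewrite -cats1 -catA /=.
  case/map_catP=> c0 [c1 [E0 r0 /(@map_consP _ _ rho) [z1 [c2 [E1 rz1]]]]].
  case/(@map_consP _ _ rho)=> z2 [c3 [E2 rz2 /map_catP [cQ [c4 [E3 rQ]]]]].
  case/(@map_consP _ _ rho)=> g' [c5 [E4 rg' /eqP]]; rewrite -size_eq0 size_map size_eq0 => /eqP E5.
  have {E0 E1 E2 E3 E4 E5} Ec : c = c0 ++ [:: z1, z2 & cQ ++ [:: g']].
    by rewrite E0 E1 E2 E3 E4 E5.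
  have nQ z : rho z = b -> (z + l)%N \notin cQ.
    move=> rz; apply/negP=> /(map_f rho); rewrite rQ rhoS rz => /uQ' [_]; exact.
  have [zg|zg] := eqVneq (z2 + l)%N g'.
    have -> : sort leq c = sort leq (c0 ++ z2 :: cQ ++ [:: g'; z1]).
      apply: sort_perm_eq; rewrite Ec perm_cat2l -cat1s perm_catC /= perm_cons -catA.
      by rewrite perm_refl.
    apply: hU; split; last first.
      by rewrite Ej map_cat /= map_cat /= r0 rz2 rQ rg' rz1.
    have := sc; rewrite Ec stdfrom_cat [X in _ -> is_true X]stdfrom_cat => /andP [-> h].
    have := @stdfrom_move _ l_gt0 _ z1 (z2 :: cQ ++ [:: g']) [::].
    rewrite cats0 -cat_cons -catA /=; apply; last exact: h.
    rewrite inE mem_cat inE !negb_or (nQ _ rz1) -zg eqn_add2r /=.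
    apply/andP; split.
      by apply/eqP=> /(congr1 rho); rewrite rhoS rz1 rz2 => /esym /h1.
    have := std_uniq sc; rewrite Ec cat_uniq /= inE => /and3P [_ _ /andP []].
    by rewrite negb_or => /andP [].
  have -> : sort leq c = sort leq (c0 ++ z1 :: cQ ++ [:: g'; z2]).
    apply: sort_perm_eq; rewrite Ec perm_cat2l perm_cons -cat1s perm_catC -catA.
    by rewrite perm_refl.
  apply: hU; split; last first.
    by rewrite Ej map_cat /= map_cat /= r0 rz1 rQ rg' rz2.
  move: sc; rewrite Ec -cat_rcons -[c0 ++ z1 :: _]cat_rcons stdfrom_cat [X in _ -> is_true X]stdfrom_cat => /andP [-> h].
  have := @stdfrom_move _ l_gt0 _ z2 (cQ ++ [:: g']) [::].
  rewrite cats0 -catA /=; apply; last exact: h.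
  by rewrite mem_cat inE negb_or (nQ _ rz2) zg.
have thX : is_shape (rcons th X).
  have := sh'; rewrite -cat_rcons; case/andP=> ss; rewrite stdfrom_cat => /andP [st _].
  by rewrite /is_shape st andbT; move: ss; rewrite !(sorted_pairwise ltn_trans) pairwise_cat => /and3P [].
have [||||s1 [hs1 rs1 ds1]] := antigreedy_dom l_gt0 rhoS (c := [::])
    (t := rcons th X) (s := s) (rest := b :: map rho Q) isT.
- exact: shape_std.
- exact: shape_antigreedy.
- exact: tabs_std ts.
- by rewrite (proj2 ts) map_rcons rX cat_rcons.
have [x' [sQ' [Es1 rx' rsQ]]] := map_consP rs1.
move: hs1; rewrite Es1 stdfrom_cat !cat0s => /andP [stX /= /andP [ax' hsQ]].
have x'g : (x' < g)%N.
  have x'Q : x' \notin Q by apply/negP=> /(map_f rho); rewrite rx' => /uQ' [].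
  apply: beta => //.
    move: ax'; rewrite /addable -cat_rcons !mem_cat (negPf x'Q) orbF.
    by case/andP=> -> /orP [->//|->]; rewrite orbT.
  by apply/eqP=> E'; move: rx'; rewrite E' rg => /esym /h1.
have x'X : (x' < X)%N.
  rewrite ltnNge leq_eqVlt negb_or; apply/andP; split.
    by apply: contraTneq ax' => <-; rewrite /addable mem_rcons mem_head.
  apply/negP=> Xx'; have : unlinked (rho X) (rho x').
    by apply: rho_apart; rewrite Xx' -gX.
  by rewrite rX rx' /unlinked eqxx.
have sx' : std (rcons (rcons th X) x') by rewrite stdfrom_rcons stX.
have stQ : stdfrom l (rcons (rcons th X) x') Q.
  have := shape_std sh'; rewrite -cat_rcons stdfrom_cat => /andP [_ h].
  apply: stdfrom_weaken h => [y yt|q qQ]; first by rewrite mem_rcons inE yt orbT.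
  rewrite !(mem_rcons, inE) !negb_or; have := sQ _ qQ.
  have := shape_sorted sh'; rewrite (sorted_pairwise ltn_trans) pairwise_cat.
  case/and3P=> /allrelP h1' _ _ /andP [hq _]; apply/and3P; split.
  - by rewrite neq_ltn (ltn_trans x'X hq) orbT.
  - by rewrite neq_ltn hq orbT.
  by apply/negP=> qt; have := h1' q q qt (mem_behead (s := X :: Q) qQ); rewrite ltnn.
have srt : sorted ltn Q.
  have := shape_sorted sh'; rewrite !(sorted_pairwise ltn_trans) pairwise_cat /=.
  by case/and4P.
have ag2 : antigreedy l rho (rcons (rcons th X) x') Q.
  apply: (antigreedy_row l_gt0 rho_apart) => //; apply/allrelP => y q; rewrite !(mem_rcons, inE).
  move=> h /sQ /andP [hq _]; case/or3P: h => [/eqP ->|/eqP -> //|yt] /=.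
    exact: ltn_trans hq.
  have := shape_sorted thX; rewrite (sorted_pairwise ltn_trans) pairwise_rcons.
  by case/andP=> /allP /(_ y yt) /= yX _; apply: ltn_trans hq.
have [|s2 [_ rs2 ds2]] := antigreedy_dom l_gt0 rhoS (rest := [::])
  (std_closed sx') stQ ag2 hsQ; first by rewrite cats0.
have {rs2} E2 : s2 = [::] by apply/eqP; rewrite -size_eq0 -(size_map rho) rs2.
have d1 : dom s (rcons th X ++ s1) := tdom_dom ds1.
have d2 : dom (rcons th X ++ s1) (rcons (rcons th X) x' ++ Q).
  have := ds2 (maxn (size sQ') (size Q)); rewrite E2 cats0 Es1 -cat_rcons.
  by rewrite !take_oversize ?leq_maxl ?leq_maxr.
have dd := dom_trans d1 d2.
apply: (above_replace sh (tabs_std ts) _ _ x'g dd).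
  rewrite -!cats1 -!catA /= perm_cat2l perm_cons -cat1s.
  by rewrite perm_catC.
by rewrite (tabs_size ts) !size_cat /= !size_map addnS.
Qed.

Lemma idm_step U : upper U -> forall j,
  (forall c, tabs j c -> U (sort leq c)) -> idl n.+1 E U (E j).
Proof.
move=> up j hU; have G := idl_gideal l rho P Y n.+1 E U.
apply: (E_small1 D G) => szj; case: (lastP j) szj hU => [//|j' b].
rewrite size_rcons => -[szj] hU.
apply: prefix_reduce => // s ts; apply: core => //.
- exact: tabs_shape ts.
- by rewrite size_sort (tabs_size ts).
by move=> c tc; apply: (extension_upper up ts hU tc).
Qed.

(** A tableau with the residues of a row reading dominates it; equality of the
    extended shapes would, by [row_max], make [s] the row reading of [mu]. *)
Lemma extension_above mu g s : is_shape (rcons mu g) -> tabs (map rho mu) s ->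
  above mu (sort leq s) ->
  forall c, tabs (rcons (map rho (sort leq s)) (rho g)) c ->
  above (rcons mu g) (sort leq c).
Proof.
move=> sh ts [szs ds ne] c tc.
have [x [ax rx d]] := tabs_shape_dom1 l_gt0 rhoS rho_apart (tabs_shape ts) tc.
have := tabs_rcons ts ax rx; rewrite -map_rcons => tx.
have tdx := tabs_shape_dom l_gt0 rhoS rho_apart sh tx.
have dx : dom c (rcons s x).
  by move=> p; apply: leq_trans (d p); rewrite !cntlt_rcons cntlt_sort.
split; first by rewrite size_sort (tabs_size tc) !size_rcons size_map szs.
  by move=> p; rewrite cntlt_sort; apply: leq_trans (dx p); apply: (tdom_dom tdx).
move=> E'; have Ex : sort leq (rcons s x) = rcons mu g.
  apply: dom_anti; [exact: shape_sorted (tabs_shape tx)|exact: shape_sorted sh| |].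
    by move=> p; rewrite cntlt_sort; apply: (tdom_dom tdx).
  by move=> p; rewrite cntlt_sort -E' cntlt_sort.
have := row_max l_gt0 sh _ tdx; rewrite -{1}Ex perm_sym perm_sort => /(_ (perm_refl _)).
move/rcons_inj=> [Es _]; apply: ne; rewrite Es; have [shm _ _] := shape_rconsP sh.
exact: sort_shape shm.
Qed.

(** Dots off the last strand are small by the induction on strands.  For the dot
    on the last strand, of the node [g], the strand is moved to the left: in the
    first row it reaches the front, where the dot vanishes.  Otherwise [g = X + l]
    stops next to [X], and the difference of the two dots is the square of their
    crossing, which factors through a Garnir sequence. *)
Lemma dot_step mu k : is_shape mu -> size mu = n.+1 -> (k < n.+1)%N ->
  idl n.+1 E (above mu) (Y k * E (map rho mu)).
Proof.
case: (lastP mu) => [//|mu' g] sh; rewrite size_rcons => -[sz].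
have [sh' ag mg] := shape_rconsP sh.
have G := idl_gideal l rho P Y n.+1 E (above (rcons mu' g)).
rewrite ltnS.
have small k' : (k' < n)%N ->
    idl n.+1 E (above (rcons mu' g)) (Y k' * E (map rho (rcons mu' g))).
  move=> kn; rewrite map_rcons -(d_EE D) mulrA; apply: above_reduce => //.
    move=> s ts ab; apply: idm_step; first exact: upper_above.
    exact: extension_above.
  by apply: (level_dot (IH (rho g))).
rewrite leq_eqVlt => /orP [/eqP {k}->|]; last exact: small.
set J := idl n.+1 E _ in G small *.
have hy : forall q, all (unlinked (rho g)) q -> forall a,
    J (Y (size a) * E (a ++ rho g :: q)) ->
    J (Y (size (a ++ q)) * E (a ++ q ++ [:: rho g])).
  elim=> [_ a|y q IHq /= /andP [uy uq] a h]; first by rewrite cats0.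
  have := IHq uq (rcons a y); rewrite size_rcons !cat_rcons; apply.
  exact: (swapYhi D G).
have [gl|lg] := ltnP g l.
  have u1 : all (unlinked (rho g)) (map rho mu').
    apply/allP=> _ /mapP [q qm ->]; rewrite unlinked_sym; apply: rho_apart.
    by have := allP mg q qm; rewrite /=; lia.
  have := hy _ u1 [::]; rewrite /= size_map sz map_rcons -cats1; apply.
  by rewrite (d_Y0 D); apply: (g0 G).
have Xm : (g - l)%N \in mu'.
  have := std_closed (shape_std sh) => /allP /(_ g); rewrite mem_rcons mem_head.
  move=> /(_ isT); rewrite ltnNge lg /= mem_rcons inE => /orP [/eqP|//]; lia.
have {Xm} [X gX Xm] : exists2 X, g = (X + l)%N & X \in mu' by exists (g - l)%N; rewrite ?subnK.
case/splitPr: Xm @J sh sz sh' ag mg G small hy => th Q J sh sz sh' ag mg G small hy.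
have uQ : all (unlinked (rho g)) (map rho Q).
  apply/allP=> _ /mapP [q qQ ->]; rewrite unlinked_sym; apply: rho_apart.
  have := shape_sorted sh'; rewrite (sorted_pairwise ltn_trans) pairwise_cat /=.
  case/and4P=> _ _ /allP /(_ q qQ) /= h _.
  by have := allP mg q; rewrite mem_cat inE qQ !orbT => /(_ isT) /=; lia.
have hyb : forall q, all (unlinked (rho g)) q -> forall k a, (k < size a)%N ->
    (k < n.+1)%N ->
    J (Y k * E (a ++ q ++ [:: rho g])) ->
    J (Y k * E (a ++ rho g :: q)).
  elim=> [//|y q IHq /= /andP [uy uq] k a ka kn h].
  apply: (swapYfar D G) => //; [lia|lia|by rewrite unlinked_sym|].
  have := IHq uq k (rcons a y); rewrite size_rcons !cat_rcons; apply=> //.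
  by rewrite ltnW.
have Eg : map rho (rcons (th ++ X :: Q) g) =
    rcons (map rho th) (rho X) ++ map rho Q ++ [:: rho g].
  by rewrite map_rcons map_cat -cats1 cat_rcons -catA.
have -> : n = size (rcons (map rho th) (rho X) ++ map rho Q).
  by rewrite size_cat size_rcons !size_map -sz size_cat /= addnS.
rewrite Eg; apply: hy => //.
have szn : n = (size th + size Q).+1 by rewrite -sz size_cat /= addnS.
have low : J
    (Y (size th) * E (rcons (map rho th) (rho X) ++ rho g :: map rho Q)).
  apply: hyb; rewrite ?size_rcons ?size_map ?szn //; first by lia.
  by rewrite -Eg; apply: small; rewrite szn; lia.
have rg : rho g = rho X - 1 by rewrite gX rhoS.
have := d_P2down D (map rho th) (rho X) (map rho Q).
rewrite size_rcons size_map -rg cat_rcons in low *.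
set e := E _ in low *; rewrite mulrBl => /eqP; rewrite eq_sym subr_eq => /eqP h.
have -> : Y (size th).+1 * e = Y (size th) * e - P (size th) * P (size th) * e.
  by rewrite h addrAC subrr add0r.
apply: (gB G) => //; rewrite -mulrA -[size th](size_map rho) /e (d_PE D).
have rn : ((size (map rho th)).+1 < n.+1)%N by rewrite size_map szn !ltnS leq_addr.
have hP := mono_P P Y rn.
apply: (gMl G) => //; apply: (gMr G) => //.
have shg : is_shape (th ++ X :: Q ++ [:: (X + l)%N]).
  by move: sh; rewrite -cats1 -catA gX.
have := garnir_idl (W1 := [::]) (W2 := Q) idm_step shg (perm_refl _).
rewrite cats0 /J -cats1 -catA /= -gX map_cat /=; exact.
Qed.
End Step.
End Levels.

(** * Straightening words *)

Lemma telescope4 (V : zmodType) (a b c d : V) :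
  a - b = a - c - (b - d) + (c - d).
Proof. by rewrite opprB (addrC (a - c)) -addrA [a - c + _]addrA subrK addrC addrA subrK. Qed.

Lemma tdom_refl t : tdom t t. Proof. by move=> k p. Qed.
#[local] Hint Resolve tdom_refl : core.

Section Straighten.
Variables (R : pzRingType) (Z : nzRingType) (l : nat) (rho : nat -> Z).
Variables (P Y : nat -> R).
Hypothesis l_gt0 : (0 < l)%N.
Variables (mu : seq nat) (E : seq Z -> R).
Notation n := (size mu).
Hypothesis D : datum l rho P Y n E.
Hypothesis hmu : is_shape l mu.
Notation std := (stdfrom l [::]).
Notation I := (idl l rho P Y n E (above mu)).
Notation mono := (mono P Y n).
Notation reduced := (reduced mu).
Notation valid := (valid n).
Hypothesis garnir : forall th X Q tl W1 W2,
  mu = th ++ X :: Q ++ (X + l)%N :: tl -> perm_eq (W1 ++ W2) Q ->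
  I (E (map rho (th ++ W1 ++ [:: (X + l)%N, X & W2 ++ tl]))).
Hypothesis dots : forall k, (k < n)%N -> I (Y k * E (map rho mu)).
Variable red : seq nat -> seq nat.
Hypothesis redP : forall v, perm_eq v mu ->
  [/\ valid (red v), act mu (red v) = v & size (red v) = ninv v].

Local Notation e := (E (map rho mu)).
Definition Psi (u : seq nat) : R := \prod_(r <- u) P r.

Lemma Psi_rcons u r : Psi (rcons u r) = Psi u * P r.
Proof. by rewrite /Psi -cats1 big_cat big_seq1. Qed.

Lemma Psi_nil : Psi [::] = 1. Proof. by rewrite /Psi big_nil. Qed.

Lemma mono_Psi u : valid u -> mono (Psi u).
Proof.
elim/last_ind: u => [_|u r IH]; first by rewrite Psi_nil; apply: mono1.
by rewrite valid_rcons Psi_rcons => /andP [/IH hu rn]; apply: monoP.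
Qed.

Let GI : gideal P Y n I := idl_gideal l rho P Y n E (above mu).
Let smu : sorted ltn mu := shape_sorted hmu.

Lemma EP i r : (r.+1 < n)%N -> E i * P r = P r * E (swp r i).
Proof.
move=> rn; have [si|/eqP si] := eqVneq (size i) n; last first.
  by rewrite !(d_size D) ?size_swp // mulr0 mul0r.
have [|a [x [y [b [-> <-]]]]] := @split_at _ i r; first by rewrite si.
by rewrite swp_cat (d_PE D).
Qed.

Lemma EPsi i u : valid u -> E i * Psi u = Psi u * E (act i u).
Proof.
elim/last_ind: u => [_|u r IH]; first by rewrite Psi_nil mul1r mulr1.
rewrite valid_rcons Psi_rcons act_rcons => /andP [/IH hu rn].
by rewrite mulrA hu -mulrA EP // mulrA.
Qed.

Lemma ePsiE u : valid u -> e * Psi u = e * Psi u * E (map rho (act mu u)).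
Proof. by move=> vu; rewrite map_act -mulrA -EPsi // mulrA (d_EE D). Qed.

Lemma mono_E m i : mono m -> exists i', m * E i = E i' * m.
Proof.
move=> hm; elim: hm i => [|u r rn _ IH|u k kn _ IH] i.
- by exists i; rewrite mul1r mulr1.
- have [i' h] := IH (swp r i); exists i'; rewrite mulrA -h -!mulrA EP //.
  by rewrite swpK.
- have [i' h] := IH i; exists i'; by rewrite mulrA -h -!mulrA (d_YE D).
Qed.

Lemma idl_rE U i z : idl l rho P Y n E U z -> idl l rho P Y n E U (z * E i).
Proof.
apply: (zspan_bind (f := fun z => z * E i)) => [|x y|x]; [exact: mul0r|exact: mulrBl|].
case=> nu [a [a' [h [ha ha' ->]]]].
have [i' E'] := mono_E i ha'.
rewrite -mulrA E' mulrA -(mulrA a); have [<-|ne] := pselect (map rho nu = i').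
  by rewrite (d_EE D); apply: zspan_in; exists nu, a, a'.
by rewrite (d_EE0 D) // mulr0 mul0r; apply: zspan0.
Qed.

Definition low_gen (M : nat) (t : seq nat) (z : R) : Prop :=
  (exists v, [/\ std v, perm_eq v mu, tdom v t, (ninv v < M)%N & z = e * Psi (red v)])
  \/ I z.

(** The error terms of straightening: the bound on the inversions makes the
    induction on the length of words work, the bound by [t] is the triangularity. *)
Definition low M t : R -> Prop := zspan (low_gen M t).

Lemma low_I M t z : I z -> low M t z.
Proof. by move=> h; apply: zspan_in; right. Qed.

Lemma low_weaken M M' t t' z : (M <= M')%N -> tdom t t' -> low M t z -> low M' t' z.
Proof.
move=> MM tt; apply: zspan_sub => x [[v [h1 h2 h3 h4 ->]]|h]; last exact: low_I.
apply: zspan_in; left; exists v; split=> //; first exact: tdom_trans h3 tt.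
exact: leq_trans MM.
Qed.

Lemma low_rE M t i z : low M t z -> low M t (z * E i).
Proof.
apply: (zspan_bind (f := fun z => z * E i)) => [|x y|x]; [exact: mul0r|exact: mulrBl|].
case=> [[v [h1 h2 h3 h4 ->]]|h]; last exact/low_I/idl_rE.
have [vv av sv] := redP h2.
have h := ePsiE vv; rewrite av in h; rewrite h -mulrA; have [<-|ne] := pselect (map rho v = i).
  by rewrite (d_EE D) -h; apply: zspan_in; left; exists v.
by rewrite (d_EE0 D) // mulr0; apply: zspan0.
Qed.

Definition lead (t : seq nat) : R := if std t then e * Psi (red t) else 0.

(** The straightening of a word: a reduced word yields the chosen word of its
    tableau, or nothing when the tableau is not standard.  The Demazure product
    [dem mu u] bounds from below, in the dominance order, all tableaux reached by
    subwords of [u], and it is [act mu u] when [u] is reduced. *)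
Definition good (u : seq nat) : Prop :=
  (reduced u -> low (size u) (act mu u) (e * Psi u - lead (act mu u))) /\
  (~~ reduced u -> low (size u) (dem mu u) (e * Psi u)).

Section Induction.
Variable N : nat.
Hypothesis IH : forall u, valid u -> (size u < N)%N -> good u.

Lemma good_low u : valid u -> (size u < N)%N -> low (size u).+1 (dem mu u) (e * Psi u).
Proof.
move=> vu su; have [g1 g2] := IH vu su.
have [ru|/g2 h] := boolP (reduced u); last by apply: low_weaken h.
rewrite reduced_dem // -[e * _](subrK (lead (act mu u))).
apply: zspanD; first by apply: low_weaken (g1 ru).
rewrite /lead; case: ifP => st; last exact: zspan0.
apply: zspan_in; left; exists (act mu u); split=> //; first exact: perm_act.
by case/andP: ru => _ /eqP <-.
Qed.

Lemma low_P M t r z : (r.+1 < n)%N -> (M < N)%N -> uniq t -> size t = n ->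
  low M t z -> low M.+1 (dmz r t) (z * P r).
Proof.
move=> rn MN ut st.
apply: (zspan_bind (f := fun z => z * P r)) => [|x y|x]; [exact: mul0r|exact: mulrBl|].
case=> [[v [h1 h2 h3 h4 ->]]|h]; last by apply/low_I/(gMr GI) => //; apply: mono_P.
have [vv av sv] := redP h2; have rv : reduced (red v) by rewrite /reduced vv av sv /=.
rewrite -mulrA -Psi_rcons.
have uv : uniq v by rewrite (perm_uniq h2) (sorted_uniq ltn_trans ltnn).
have szv : size v = n by apply: perm_size.
have := @good_low (rcons (red v) r); rewrite valid_rcons vv rn size_rcons sv.
move=> /(_ isT) h; apply: low_weaken (h _); [by []| |by apply: leq_ltn_trans MN].
rewrite dem_rcons reduced_dem // av; apply: tdom_dmz; rewrite ?szv ?st //.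
Qed.

Lemma size_dem_n u : size (dem mu u) = n. Proof. exact: size_dem. Qed.

(** A dot slides to the left through a word, at the cost of deleting letters, until
    it is absorbed by the idempotent. *)
Lemma low_Y u k : valid u -> (size u <= N)%N -> (k < n)%N ->
  low (size u) (dem mu u) (e * Psi u * Y k).
Proof.
elim/last_ind: u k => [|u r IHu] k.
  by move=> _ _ kn; rewrite Psi_nil mulr1 -(d_YE D) //; apply/low_I/dots.
rewrite valid_rcons size_rcons => /andP [vu rn] su kn.
have ud := uniq_dem smu u; have sd := size_dem_n u.
have IHr k' : (k' < n)%N -> low (size u).+1 (dem mu (rcons u r)) (e * Psi u * Y k' * P r).
  move=> kn'; rewrite dem_rcons; apply: low_P => //.
  by apply: IHu => //; apply: ltnW.
have hE i : low (size u).+1 (dem mu (rcons u r)) (e * Psi u * E i).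
  apply: low_rE; rewrite dem_rcons; apply: low_weaken (good_low vu su) => //.
  by apply: tdom_dmz_self; rewrite // sd.
rewrite Psi_rcons mulrA.
have [|a [x [y [b [Ea sa]]]]] := @split_at _ (map rho (act mu (rcons u r))) r.
  by rewrite size_map size_act.
have vur : valid (rcons u r) by rewrite valid_rcons vu.
have eE : e * Psi u * P r * Y k = e * Psi u * (P r * Y k * E (a ++ [:: x, y & b])).
  rewrite -[e * Psi u * P r]mulrA -Psi_rcons ePsiE // Psi_rcons Ea -!mulrA.
  by rewrite (d_YE D).
have del i : low (size u).+1 (dem mu (rcons u r)) (e * Psi u * delta x y (E i)).
  by rewrite /delta; case: ifP => _; rewrite ?mulr0; [apply: hE|apply: zspan0].
rewrite eE; have [->|k1] := eqVneq k r.+1.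
  rewrite -sa (d_PYhi D) mulrBr; apply: zspanB; rewrite sa; last exact: del.
  rewrite 2!mulrA.
  by apply: low_rE; apply: IHr; apply: ltnW.
have [->|k2] := eqVneq k r.
  have h := d_YhiP D a x y b; rewrite sa in h.
  have {}h : P r * Y r * E (a ++ [:: x, y & b]) =
     Y r.+1 * P r * E (a ++ [:: x, y & b]) + delta x y (E (a ++ [:: x, y & b])).
    by rewrite h subrK.
  rewrite h mulrDr; apply: zspanD; last exact: del.
  rewrite 2!mulrA.
  by apply: low_rE; apply: IHr.
rewrite (d_PY D) //; [|exact/eqP|exact/eqP].
by rewrite 2!mulrA; apply: low_rE; apply: IHr.
Qed.

Lemma good_diff u u' : valid u -> (size u < N)%N -> reduced u -> reduced u' ->
  act mu u = act mu u' -> low (size u) (act mu u) (e * Psi u - e * Psi u').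
Proof.
move=> vu su ru ru' E'; have /andP [vu' /eqP s'] := ru'.
have ss : size u' = size u by case/andP: ru => _ /eqP ->; rewrite E' s'.
have [g1 _] := IH vu su; have [|g2 _] := IH vu' _; first by rewrite ss.
rewrite ss -E' in g2.
have -> : e * Psi u - e * Psi u' =
    e * Psi u - lead (act mu u) - (e * Psi u' - lead (act mu u)).
  by rewrite opprB addrA subrK.
by apply: zspanB; [apply: g1|apply: g2].
Qed.

Lemma low_P_diff u u' a x y b : valid u -> (size u < N)%N -> reduced u ->
  reduced u' -> act mu u = a ++ [:: x, y & b] -> act mu u' = act mu u -> (x < y)%N ->
  low (size u).+1 (a ++ [:: y, x & b])
    (e * Psi u * P (size a) - e * Psi u' * P (size a)).
Proof.
move=> vu su ru ru' Ea E' xy; rewrite -mulrBl -dmz_up //.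
apply: low_P => //; first by rewrite -(size_act mu u) Ea; apply: (size_split2 (erefl _)).
- by rewrite -Ea uniq_act.
- by rewrite -Ea size_act.
by rewrite -Ea; apply: good_diff.
Qed.

Lemma redR v : perm_eq v mu -> reduced (red v).
Proof. by move=> pv; have [vv av sv] := redP pv; rewrite /reduced vv av sv /=. Qed.

Lemma reduced_valid u : reduced u -> valid u. Proof. by case/andP. Qed.

Lemma reduced_size u : reduced u -> size u = ninv (act mu u).
Proof. by case/andP=> _ /eqP. Qed.

Lemma perm_pair a (x y : nat) b : perm_eq (a ++ [:: y, x & b]) (a ++ [:: x, y & b]).
Proof. by rewrite perm_cat2l; apply: perm_swap2. Qed.

(** The words end in two commuting letters in either order: both are compared with
    the words that share a prefix reaching the tableau [v] before these letters. *)
Lemma far_words a x y b x' y' c u1 u2 : (x < y)%N -> (x' < y')%N ->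
  reduced u1 -> act mu u1 = a ++ [:: x, y & b ++ [:: y', x' & c]] ->
  reduced u2 -> act mu u2 = (a ++ [:: y, x & b]) ++ [:: x', y' & c] ->
  (size u1 < N)%N ->
  low (size u1).+1 (a ++ [:: y, x & b ++ [:: y', x' & c]])
    (e * Psi u1 * P (size a) - e * Psi u2 * P (size (a ++ [:: y, x & b]))).
Proof.
move=> xy xy' r1 a1 r2 a2 s1; set s := size (_ ++ _).
pose v := a ++ [:: x, y & b ++ [:: x', y' & c]].
have pv : perm_eq v mu.
  apply: perm_trans (perm_act mu u1); rewrite a1 /v perm_cat2l !perm_cons perm_cat2l.
  exact: perm_swap2.
have rw := redR pv; have [_ av _] := redP pv.
have [rw2 aw2] := reduced_rcons rw av xy.
have av1 : act mu (red v) = (a ++ [:: x, y & b]) ++ [:: x', y' & c].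
  by rewrite av -catA.
have [rw1 aw1] := reduced_rcons rw av1 xy'.
have ss : size (a ++ [:: x, y & b]) = s by rewrite /s !size_cat.
rewrite ss in rw1 aw1.
have i1 : size u1 = (size (red v)).+1.
  by rewrite (reduced_size r1) a1 -(size_rcons _ s) (reduced_size rw1) aw1 -catA.
have i2 : size u2 = (size (red v)).+1.
  by rewrite (reduced_size r2) a2 -(size_rcons _ (size a)) (reduced_size rw2) aw2 -catA.
have i12 : size u2 = size u1 by rewrite i1 i2.
have e1 : act mu (rcons (red v) s) = act mu u1 by rewrite aw1 a1 -catA.
have e2 : act mu (rcons (red v) (size a)) = act mu u2 by rewrite aw2 a2 -catA.
have s2 : (size u2 < N)%N by rewrite i12.
have h1 := low_P_diff (reduced_valid r1) s1 r1 rw1 a1 e1 xy.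
have h2 := low_P_diff (reduced_valid r2) s2 r2 rw2 a2 e2 xy'.
rewrite -/s i12 -catA in h2.
have comm : P (size a) * P s = P s * P (size a).
  apply: (d_PP D); last by rewrite /s size_cat /=; lia.
  by have := reduced_valid rw1; rewrite valid_rcons => /andP [].
have -> : e * Psi u1 * P (size a) - e * Psi u2 * P s =
   (e * Psi u1 * P (size a) - e * Psi (rcons (red v) s) * P (size a)) -
   (e * Psi u2 * P s - e * Psi (rcons (red v) (size a)) * P s).
  rewrite !Psi_rcons !mulrA -2!(mulrA (e * Psi (red v))) comm.
  by rewrite opprB addrA subrK.
exact: zspanB.
Qed.

(** The words end in the two sides of a braid relation: both are compared with the
    words that share a prefix reaching the tableau [v] before these three letters.
    The correction term of the relation is a shorter word. *)
Lemma adjacent_words a x y z b u1 u2 : (z < x)%N -> (x < y)%N ->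
  reduced u1 -> act mu u1 = a ++ [:: x, y, z & b] ->
  reduced u2 -> act mu u2 = rcons a y ++ [:: z, x & b] ->
  (size u1 < N)%N ->
  low (size u1).+1 (a ++ [:: y, x, z & b])
    (e * Psi u1 * P (size a) - e * Psi u2 * P (size a).+1).
Proof.
move=> zx xy r1 a1 r2 a2 s1; have zy := ltn_trans zx xy.
pose v := a ++ [:: z, x, y & b].
have pv : perm_eq v mu.
  apply: perm_trans (perm_act mu u1); rewrite a1 /v perm_cat2l.
  exact: (permEl (perm_catCA [:: z] [:: x; y] b)).
have rw := redR pv; have [vw av sw] := redP pv.
have [rw1 aw1] := reduced_rcons rw av zx.
have aw1' : act mu (rcons (red v) (size a)) = rcons a x ++ [:: z, y & b].
  by rewrite aw1 cat_rcons.
have [rw11 aw11] := reduced_rcons rw1 aw1' zy.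
have av2 : act mu (red v) = rcons a z ++ [:: x, y & b] by rewrite av cat_rcons.
have [rw2 aw2] := reduced_rcons rw av2 xy.
have aw2' : act mu (rcons (red v) (size (rcons a z))) = a ++ [:: z, y, x & b].
  by rewrite aw2 cat_rcons.
have [rw22 aw22] := reduced_rcons rw2 aw2' zy.
rewrite !size_rcons in rw11 aw11 rw2 aw2 aw2' rw22 aw22.
have e1 : act mu (rcons (rcons (red v) (size a)) (size a).+1) = act mu u1.
  by rewrite aw11 a1 cat_rcons.
have e2 : act mu (rcons (rcons (red v) (size a).+1) (size a)) = act mu u2.
  by rewrite aw22 a2 cat_rcons.
have i1 : size u1 = (size (red v)).+2.
  by rewrite (reduced_size r1) -e1 -(reduced_size rw11) !size_rcons.
have i2 : size u2 = (size (red v)).+2.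
  by rewrite (reduced_size r2) -e2 -(reduced_size rw22) !size_rcons.
have i12 : size u2 = size u1 by rewrite i1 i2.
have s2 : (size u2 < N)%N by rewrite i12.
have h1 := low_P_diff (reduced_valid r1) s1 r1 rw11 a1 e1 xy.
have h2 := low_P_diff (reduced_valid r2) s2 r2 rw22 a2 e2 zx.
rewrite size_rcons i12 cat_rcons in h2.
pose r := size a; set t := a ++ [:: y, x, z & b].
have vr1 : (r.+2 < n)%N.
  by have := reduced_valid rw2; rewrite valid_rcons => /andP [].
pose i := map rho t.
have Ei u : valid u -> act mu u = t -> e * Psi u = e * Psi u * E i.
  by move=> vu au; rewrite [LHS]ePsiE // au.
have br : e * Psi (red v) * P r * P r.+1 * P r - e * Psi (red v) * P r.+1 * P r * P r.+1 =
    e * Psi (red v) * braid_sign (rho y) (rho x) (rho z) (E i).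
  have w1 : valid (rcons (rcons (rcons (red v) r) r.+1) r).
    by rewrite valid_rcons (reduced_valid rw11) /=; lia.
  have w2 : valid (rcons (rcons (rcons (red v) r.+1) r) r.+1).
    by rewrite valid_rcons (reduced_valid rw22).
  have t1 : act mu (rcons (rcons (rcons (red v) r) r.+1) r) = t.
    by rewrite act_rcons aw11 cat_rcons /r swp_cat.
  have t2 : act mu (rcons (rcons (rcons (red v) r.+1) r) r.+1) = t.
    by rewrite act_rcons aw22 -cat_rcons /r -(size_rcons a y) swp_cat cat_rcons.
  have := Ei _ w1 t1; have := Ei _ w2 t2; rewrite !Psi_rcons !mulrA => -> ->.
  set A := e * Psi (red v).
  have := d_braid D (map rho a) (rho y) (rho x) (rho z) (map rho b).
  rewrite size_map -/r; have -> : map rho a ++ [:: rho y, rho x, rho z & map rho b] = i.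
    by rewrite /i map_cat.
  move=> h; have -> : A * P r * P r.+1 * P r * E i = A * (P r * P r.+1 * P r * E i).
    by rewrite !mulrA.
  by rewrite h mulrDr !mulrA addrAC subrr add0r.
have lw : low (size u1).+1 t (e * Psi (red v) * braid_sign (rho y) (rho x) (rho z) (E i)).
  have tv : tdom v t.
    have p1 := tdom_up (a := a) (x := z) (y := x) (b := y :: b).
    have p2 := tdom_up (a := rcons a x) (x := z) (y := y) (b := b).
    have p3 := tdom_up (a := a) (x := x) (y := y) (b := z :: b).
    have u0 : uniq v by rewrite (perm_uniq pv) (sorted_uniq ltn_trans ltnn).
    have u1' : uniq (rcons a x ++ [:: z, y & b]) by rewrite -aw1' uniq_act.
    have u2' : uniq (a ++ [:: x, y, z & b]) by rewrite -a1 uniq_act.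
    apply: tdom_trans (p1 u0 zx) _; rewrite -cat_rcons.
    by apply: tdom_trans (p2 u1' zy) _; rewrite cat_rcons; apply: p3.
  have le := good_low vw _; rewrite reduced_dem // av in le.
  have {}le : low (size u1).+1 t (e * Psi (red v)).
    by apply: low_weaken (le _) => //; rewrite ?i1 -?i1; lia.
  rewrite /braid_sign; case: ifP => _.
    by rewrite mulrN; apply: zspanN; apply: low_rE.
  by case: ifP => _; [apply: low_rE|rewrite mulr0; apply: zspan0].
have -> : e * Psi u1 * P r - e * Psi u2 * P r.+1 =
   (e * Psi u1 * P r - e * Psi (rcons (rcons (red v) r) r.+1) * P r) -
   (e * Psi u2 * P r.+1 - e * Psi (rcons (rcons (red v) r.+1) r) * P r.+1) +
   e * Psi (red v) * braid_sign (rho y) (rho x) (rho z) (E i).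
  rewrite -br !Psi_rcons !mulrA; set A := e * Psi u1 * _; set B := e * Psi u2 * _.
  set C := _ * P r; set C' := _ * P r.+1.
  exact: telescope4.
by apply: zspanD => //; apply: zspanB.
Qed.

(** Matsumoto's theorem with error terms.  The last letters of two reduced words of
    the same tableau are both descents of it; they coincide, are adjacent or
    commute. *)
Lemma matsumoto_le u u' r s : (r <= s)%N -> reduced (rcons u r) ->
  reduced (rcons u' s) -> act mu (rcons u r) = act mu (rcons u' s) ->
  (size u < N)%N ->
  low (size u).+1 (act mu (rcons u r)) (e * Psi (rcons u r) - e * Psi (rcons u' s)).
Proof.
move=> rs /(reduced_rconsP smu) [ru [a [x [y [b [a1 sa xy]]]]]].
move=> /(reduced_rconsP smu) [ru' [a' [x' [y' [b' [a2 sa' xy']]]]]].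
rewrite !act_rcons a1 a2; rewrite -{}sa -{}sa' in rs *.
rewrite !swp_cat !Psi_rcons !mulrA => E' su.
have vu := reduced_valid ru.
have [a'' Ea'] : exists a'', a' = a ++ a''.
  exists (drop (size a) a'); rewrite -{1}(cat_take_drop (size a) a'); congr (_ ++ _).
  have := congr1 (take (size a)) E'; rewrite take_size_cat // takel_cat //.
move: E' a2; rewrite Ea' -catA => /eqP; rewrite eqseq_cat // eqxx /= => /eqP E' a2.
case: a'' Ea' E' a2 => [|z [|z' b0]] Ea' /= E' a2.
- case: E' a2 => <- <- <- a2; rewrite cats0 in a2 *.
  by apply: low_P_diff => //; rewrite a2 a1.
- case: E' a1 a2 xy' => <- <- -> a1 a2 xy'.
  rewrite cats1 size_rcons; apply: adjacent_words => //.
  by rewrite a2 -cats1.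
case: E' a1 a2 => <- <- Eb a1 a2; rewrite Eb.
apply: far_words => //; first by rewrite a1 Eb.
Qed.

Lemma matsumoto u u' r s : reduced (rcons u r) -> reduced (rcons u' s) ->
  act mu (rcons u r) = act mu (rcons u' s) -> (size u < N)%N ->
  low (size u).+1 (act mu (rcons u r)) (e * Psi (rcons u r) - e * Psi (rcons u' s)).
Proof.
move=> r1 r2 E' su; have [rs|sr] := leqP r s; first exact: matsumoto_le.
have ss : size u' = size u.
  by have := reduced_size r1; rewrite E' -(reduced_size r2) !size_rcons => -[].
have := matsumoto_le (ltnW sr) r2 r1 (esym E'); rewrite ss => /(_ su) /zspanN.
by rewrite opprB E'.
Qed.

Lemma std_swp a x y b : std (a ++ [:: x, y & b]) -> y <> (x + l)%N ->
  std (a ++ [:: y, x & b]).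
Proof.
rewrite stdfrom_cat [in X in _ -> X]stdfrom_cat cat0s => /andP [-> h] ne.
apply: (stdfrom_move l_gt0 (x := x) (q := [:: y]) (r := b)) => //.
by rewrite inE eq_sym; apply/eqP.
Qed.

Lemma not_std a b c x : std (a ++ (x + l)%N :: b ++ x :: c) -> False.
Proof.
move=> h; have := std_uniq h; move: h; rewrite stdfrom_cat => /andP [_ /= /andP [/andP [_]]].
rewrite addnK ltnNge leq_addl /= => xa _; rewrite cat_uniq => /and3P [_ /hasPn h _].
by have := h x; rewrite xa inE mem_cat mem_head !orbT => /(_ isT).
Qed.

(** A rearrangement of a row reading whose only descent is [x + l] before [x] is a
    Garnir sequence: the nodes before [x] and those after [x + l] are in place. *)
Lemma garnir_grassmann a x b : perm_eq (a ++ [:: (x + l)%N, x & b]) mu ->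
  sorted ltn (rcons a (x + l)%N) -> sorted ltn (x :: b) ->
  I (E (map rho (a ++ [:: (x + l)%N, x & b]))).
Proof.
set y := (x + l)%N => pt; rewrite !(sorted_pairwise ltn_trans) pairwise_rcons.
case/andP=> /allP ay pa /= /andP [/allP xb pb].
have ut : uniq (a ++ [:: y, x & b]) by rewrite (perm_uniq pt) (sorted_uniq ltn_trans ltnn).
have xa : x \notin a.
  apply/negP=> xa; move: ut; rewrite cat_uniq => /and3P [_ /hasPn h _].
  by have := h x; rewrite xa inE mem_head orbT => /(_ isT).
have yb : y \notin b.
  move: ut; rewrite cat_uniq => /and3P [_ _ /= /andP [h _]].
  by apply: contra h; rewrite inE => ->; rewrite orbT.
have split_le (s : seq nat) z : pairwise ltn s -> z \notin s ->
    s = [seq w <- s | (w < z)%N] ++ [seq w <- s | (z < w)%N].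
  elim: s => //= w s IHs /andP [/allP ws ps]; rewrite inE negb_or => /andP [zw zs].
  case: (ltngtP w z) => h; first by rewrite [in LHS](IHs ps zs).
    have -> : [seq w <- s | (w < z)%N] = [::].
      rewrite -(filter_pred0 s); apply: eq_in_filter => w' /ws /= h'.
      by apply/negbTE; rewrite -leqNgt ltnW // (ltn_trans h h').
    have -> // : [seq w <- s | (z < w)%N] = s.
    by apply/all_filterP/allP=> w' /ws /=; apply: ltn_trans h.
  by rewrite h eqxx in zw.
pose th := [seq w <- a | (w < x)%N]; pose W1 := [seq w <- a | (x < w)%N].
pose W2 := [seq w <- b | (w < y)%N]; pose tl := [seq w <- b | (y < w)%N].
have Ea : a = th ++ W1 := split_le _ _ pa xa.
have Eb : b = W2 ++ tl := split_le _ _ pb yb.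
pose Q := sort leq (W1 ++ W2).
have Qin w : w \in Q -> (x < w < y)%N.
  rewrite mem_sort mem_cat !mem_filter => /orP [/andP [-> /ay ->] //|].
  by case/andP=> -> /xb ->.
have uQ : uniq (W1 ++ W2).
  have := ut; rewrite {1}Ea {1}Eb -catA cat_uniq => /and3P [_ _].
  have p : perm_eq (W1 ++ [:: y, x & W2 ++ tl]) ((W1 ++ W2) ++ [:: y, x & tl]).
    by rewrite -catA perm_cat2l -[_ :: _ :: (_ ++ _)]/([:: y; x] ++ W2 ++ tl) perm_catCA.
  by rewrite (perm_uniq p) cat_uniq => /and3P [].
have thx w : w \in th -> (w < x)%N by rewrite mem_filter => /andP [].
have tly w : w \in tl -> (y < w)%N by rewrite mem_filter => /andP [].
have xy : (x < y)%N by rewrite /y -addn1 leq_add2l.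
have pmu : mu = th ++ x :: Q ++ y :: tl.
  apply: (irr_sorted_eq ltn_trans ltnn smu).
    have pw1 : pairwise ltn th by apply: pairwise_filter.
    have pw2 : pairwise ltn tl by apply: pairwise_filter.
    have pw3 : pairwise ltn Q.
      by rewrite -(sorted_pairwise ltn_trans) ltn_sorted_uniq_leq sort_uniq uQ
        (sort_sorted leq_total).
    rewrite (sorted_pairwise ltn_trans) pairwise_cat /= pairwise_cat /= pw1 pw2 pw3.
    rewrite !andbT !andTb; apply/and4P; split.
    - apply/allrelP=> u v /thx ux; rewrite inE mem_cat inE.
      case/or4P=> [/eqP ->//|/Qin /andP [h _]|/eqP ->|/tly h]; first exact: ltn_trans h.
        exact: ltn_trans xy.
      exact: ltn_trans (ltn_trans ux xy) h.
    - apply/allP=> v; rewrite mem_cat inE => /or3P [/Qin /andP [] //|/eqP ->//|/tly h].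
      exact: ltn_trans h.
    - apply/allrelP=> u v /Qin /andP [_ uy]; rewrite inE => /orP [/eqP ->//|/tly].
      exact: ltn_trans.
    by apply/allP=> v /tly.
  move=> w; rewrite -(perm_mem pt) {1}Ea {1}Eb !(mem_cat, inE) mem_sort mem_cat.
  by do !case: (_ \in _) => //=; rewrite ?orbT //; do !case: (_ == _).
have := garnir (W1 := W1) (W2 := W2) pmu; rewrite perm_sym perm_sort perm_refl => /(_ isT).
by rewrite -/y catA -Ea -Eb.
Qed.

Lemma reduced_words u u' : reduced u -> reduced u' -> act mu u = act mu u' ->
  size u = N -> low N (act mu u) (e * Psi u - e * Psi u').
Proof.
case: (lastP u) => [|v r]; case: (lastP u') => [|v' s] r1 r2 E'.
- by move=> _; rewrite subrr; apply: zspan0.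
- by have := reduced_size r2; rewrite -E' -(reduced_size r1) size_rcons.
- by have := reduced_size r2; rewrite -E' -(reduced_size r1) size_rcons.
rewrite size_rcons => sN; rewrite -sN; apply: matsumoto => //.
by rewrite -sN.
Qed.

(** If some descent can be removed with the tableau remaining nonstandard, the
    induction on length applies.  Otherwise every descent is of the form
    [x + l], [x], and it is the only one, since removing another would leave this
    pair in the wrong order: the tableau is a Garnir sequence. *)
Lemma nonstd_word u : reduced u -> size u = N -> ~~ std (act mu u) ->
  low N (act mu u) (e * Psi u).
Proof.
move=> ru sN nst; set t := act mu u in nst *.
have pt : perm_eq t mu := perm_act mu u.
have ut : uniq t := uniq_act smu u.
(* a descent whose removal leaves the sequence nonstandard is removed *)
have [[a [x [y [b [Et xy ns]]]]]|only] := pselect (exists a x y b,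
    [/\ t = a ++ [:: y, x & b], (x < y)%N & ~~ std (a ++ [:: x, y & b])]).
  have pv : perm_eq (a ++ [:: x, y & b]) mu.
    by apply: perm_trans pt; rewrite Et perm_sym perm_pair.
  have rw := redR pv; have [vw aw sw] := redP pv.
  have [rw1 aw1] := reduced_rcons rw aw xy.
  have E' : t = act mu (rcons (red (a ++ [:: x, y & b])) (size a)) by rewrite aw1.
  have sw1 : (size (red (a ++ [:: x, y & b]))).+1 = N.
    by rewrite -(size_rcons _ (size a)) (reduced_size rw1) -E' -(reduced_size ru).
  rewrite -[e * Psi u](subrK (e * Psi (rcons (red (a ++ [:: x, y & b])) (size a)))).
  apply: zspanD; first exact: reduced_words.
  have sN' : (size (red (a ++ [:: x, y & b])) < N)%N by rewrite -sw1.
  have [g1 _] := IH vw sN'; have := g1 rw; rewrite aw /lead (negPf ns) subr0 => h.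
  rewrite -sw1 Et -(dmz_up a b xy) Psi_rcons mulrA; apply: low_P => //.
  - by have := reduced_valid rw1; rewrite valid_rcons => /andP [].
  - by rewrite (perm_uniq pv) (sorted_uniq ltn_trans ltnn).
  exact: perm_size.
have one a x y b : t = a ++ [:: y, x & b] -> (x < y)%N -> y = (x + l)%N.
  move=> Et xy; have [//|/eqP ne] := eqVneq y (x + l)%N.
  have [st|ns] := boolP (std (a ++ [:: x, y & b])); last by case: only; exists a, x, y, b.
  by move: nst; rewrite Et (std_swp st ne).
have nsorted : ~~ sorted ltn t.
  apply: contra nst => st.
  by rewrite (irr_sorted_eq ltn_trans ltnn st smu (perm_mem pt)) (shape_std hmu).
have [a [y [x [b [Et xy]]]]] := descent ut nsorted.
have yx := one _ _ _ _ Et xy; rewrite {}yx in Et xy.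
apply: low_I; rewrite EPsi ?reduced_valid // -map_act -/t.
apply: (gMl GI); first exact/mono_Psi/reduced_valid.
have uaN (s : seq nat) : uniq s -> sorted ltn s \/ exists a y x b,
    s = a ++ [:: y, x & b] /\ (x < y)%N.
  by move=> us; have [h|/(descent us) h] := boolP (sorted ltn s); [left|right].
have utx : uniq (rcons a (x + l)%N ++ x :: b) by rewrite cat_rcons -Et.
have [ua _ ub] := and3P (etrans (esym (cat_uniq _ _)) utx).
rewrite Et; apply: garnir_grassmann; first by rewrite -Et.
  have [//|[a1 [z [w [a2 [Ea wz]]]]]] := uaN _ ua.
  case: only; exists a1, w, z, (a2 ++ x :: b); split=> //.
    by rewrite Et -cat_rcons Ea -catA.
  have : (x + l)%N \in a1 ++ [:: w, z & a2].
    by rewrite (perm_mem (perm_pair a1 z w a2)) -Ea mem_rcons mem_head.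
  rewrite -!cat_cons catA => /splitPr [h1 h2].
  by apply/negP; rewrite -catA => /not_std.
have [//|[a1 [z [w [a2 [Ea wz]]]]]] := uaN _ ub.
case: only; exists (rcons a (x + l)%N ++ a1), w, z, a2; split=> //.
  by rewrite Et -cat_rcons Ea catA.
have : x \in a1 ++ [:: w, z & a2].
  by rewrite (perm_mem (perm_pair a1 z w a2)) -Ea mem_head.
rewrite -catA => /splitPr [h1 h2].
by apply/negP; rewrite cat_rcons => /not_std.
Qed.

(** A word that stops being reduced at its last letter can be rewritten to end in a
    double crossing, which is zero, a shorter word, or a difference of dots. *)
Lemma good_step u : valid u -> size u = N -> good u.
Proof.
case: (lastP u) => [_ sN|v r].
  have i0 : ninv mu = 0%N := ninv_sorted smu.
  split; last by rewrite /reduced /= i0.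
  move=> _; rewrite /= /lead (shape_std hmu).
  have [_ _ s0] := redP (perm_refl mu); rewrite i0 in s0.
  by rewrite (size0nil s0) subrr; apply: zspan0.
rewrite valid_rcons => /andP [vv rn]; rewrite size_rcons => sN.
have lN : (size v < N)%N by rewrite -sN.
have vr : valid (rcons v r) by rewrite valid_rcons vv.
have svr : size (rcons v r) = N by rewrite size_rcons.
split=> [rv|nrv].
  rewrite svr /lead; case: ifP => st; last first.
    by rewrite subr0; apply: nonstd_word; rewrite ?st.
  have pt := perm_act mu (rcons v r).
  have [_ ar _] := redP pt.
  by apply: reduced_words => //; apply: redR.
rewrite size_rcons dem_rcons Psi_rcons mulrA.
have [g1 g2] := IH vv lN.
have [rv|/g2 h] := boolP (reduced v); last first.
  by apply: low_P => //; [apply: uniq_dem|apply: size_dem].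
rewrite reduced_dem //.
have [a [x [y [b [Ea sa xy]]]]] := split_act smu v rn.
have {xy} yx : (y < x)%N.
  case: xy => // xy; case/negP: nrv.
  by rewrite -sa; case: (reduced_rcons rv Ea xy).
rewrite Ea -sa dmz_down //.
have pv : perm_eq (a ++ [:: y, x & b]) mu.
  by apply: perm_trans (perm_act mu v); rewrite Ea perm_pair.
have rw := redR pv; have [vw aw sw] := redP pv.
have [rw1 aw1] := reduced_rcons rw aw yx.
have E' : act mu v = act mu (rcons (red (a ++ [:: y, x & b])) (size a)) by rewrite aw1.
set w := red _ in rw vw aw sw rw1 aw1 E'.
have sw1 : size v = (size w).+1.
  by rewrite (reduced_size rv) E' -(reduced_size rw1) size_rcons.
have lw : (size w < N)%N by rewrite -sN sw1; lia.
have -> : e * Psi v * P (size a) = (e * Psi v - e * Psi (rcons w (size a))) * P (size a)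
    + e * Psi w * (P (size a) * P (size a)).
  by rewrite mulrBl Psi_rcons !mulrA subrK.
apply: zspanD.
  have h := good_diff vv lN rv rw1 E'; rewrite Ea in h.
  rewrite -(dmz_down a b yx); apply: low_P => //; rewrite ?sa //.
    by rewrite -Ea uniq_act.
  by rewrite -Ea size_act.
have tt : tdom (a ++ [:: y, x & b]) (a ++ [:: x, y & b]).
  by apply: tdom_up => //; rewrite -aw uniq_act.
have lw0 : low (size v).+1 (a ++ [:: x, y & b]) (e * Psi w).
  have := good_low vw lw; rewrite reduced_dem // aw; apply: low_weaken => //.
  by rewrite sw1.
have lwY k : (k < n)%N -> low (size v).+1 (a ++ [:: x, y & b]) (e * Psi w * Y k).
  move=> kn; have := low_Y vw (ltnW lw) kn; rewrite reduced_dem // aw.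
  by apply: low_weaken => //; rewrite sw1; lia.
have -> : e * Psi w * (P (size a) * P (size a)) = e * Psi w *
    (P (size a) * P (size a) * E (map rho a ++ [:: rho y, rho x & map rho b])).
  have vww : valid (rcons (rcons w (size a)) (size a)).
    by rewrite !valid_rcons vw sa rn.
  have := ePsiE vww; rewrite !act_rcons aw swpK map_cat /= !Psi_rcons.
  by rewrite !mulrA.
have [an bn] : (size a < n)%N /\ ((size a).+1 < n)%N by rewrite sa; split=> //; apply: ltnW.
have hE k : (k < n)%N -> low (size v).+1 (a ++ [:: x, y & b])
    (e * Psi w * (Y k * E (map rho a ++ [:: rho y, rho x & map rho b]))).
  by move=> kn; rewrite mulrA; apply: low_rE; apply: lwY.
rewrite -[size a](size_map rho) in hE an bn *.
have [uxy|] := boolP (unlinked (rho y) (rho x)).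
  by rewrite (d_P2far D) //; apply: low_rE.
rewrite /unlinked !negb_and !negbK => /or3P [/eqP ->|/eqP yE|/eqP yE].
- by rewrite (d_P2eq D) mulr0; apply: zspan0.
- have -> : rho x = rho y - 1 by rewrite yE addrK.
  rewrite (d_P2down D) mulrBl mulrBr; apply: zspanB.
    by have := hE _ an; rewrite yE addrK.
  by have := hE _ bn; rewrite yE addrK.
have -> : rho x = rho y + 1 by rewrite yE subrK.
rewrite (d_P2up D) mulrBl mulrBr; apply: zspanB.
  by have := hE _ bn; rewrite yE subrK.
by have := hE _ an; rewrite yE subrK.
Qed.
End Induction.

Lemma all_good u : valid u -> good u.
Proof.
move: {2}(size u).+1 (ltnSn (size u)) => N; elim: N u => // N IHN u.
rewrite ltnS leq_eqVlt => /orP [/eqP sN vu|/IHN //].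
by apply: (good_step (N := N)) => // w vw sw; apply: IHN.
Qed.

(** The words to which a dot is reduced have lost at least one letter, whence the
    strict bound on the inversions. *)
Lemma tableau_dot t k : perm_eq t mu -> (k < n)%N ->
  low (ninv t) t (e * Psi (red t) * Y k).
Proof.
move=> pt kn; have [vt ht st] := redP pt.
have := @low_Y (size (red t)) (fun u vu _ => all_good vu) (red t) k vt (leqnn _) kn.
by rewrite reduced_dem ?redR // ht st.
Qed.

Definition span_gen (z : R) : Prop :=
  (exists v, [/\ std v, perm_eq v mu & z = e * Psi (red v)]) \/ I z.

Lemma low_span M t z : low M t z -> zspan span_gen z.
Proof.
apply: zspan_sub => x h; apply: zspan_in.
by case: h => [[v [h1 h2 _ _ ->]]|h]; [left; exists v|right].
Qed.

Lemma mono_span m : mono m -> zspan span_gen (e * m).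
Proof.
elim=> [|u r rn _|u k kn _].
- have [_ _ s0] := redP (perm_refl mu); rewrite ninv_sorted // in s0.
  apply: zspan_in; left; exists mu; split; rewrite ?shape_std //.
  by rewrite (size0nil s0) Psi_nil.
- rewrite mulrA; apply: (zspan_bind (f := fun z => z * P r)) => [|x y|x];
    [exact: mul0r|exact: mulrBl|].
  case=> [[v [sv pv ->]]|h]; last first.
    by apply: zspan_in; right; apply: (gMr GI) => //; apply: mono_P.
  have [vv _ _] := redP pv; have vr : valid (rcons (red v) r) by rewrite valid_rcons vv.
  rewrite -mulrA -Psi_rcons.
  have h := @good_low (size (rcons (red v) r)).+1 (fun u vu _ => all_good vu) _ vr (leqnn _).
  exact: low_span h.
- rewrite mulrA; apply: (zspan_bind (f := fun z => z * Y k)) => [|x y|x];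
    [exact: mul0r|exact: mulrBl|].
  case=> [[v [sv pv ->]]|h]; last first.
    by apply: zspan_in; right; apply: (gMr GI) => //; apply: mono_Y.
  exact: low_span (tableau_dot pv kn).
Qed.
End Straighten.

Section LevelAll.
Variables (R : pzRingType) (Z : nzRingType) (l : nat) (rho : nat -> Z).
Variables (P Y : nat -> R).
Hypothesis l_gt0 : (0 < l)%N.
Hypothesis rhoS : forall p, rho (p + l)%N = rho p - 1.
Hypothesis rho_apart : forall p p', (p < p' < p + l)%N -> unlinked (rho p) (rho p').
Hypothesis two_neq0 : (1 + 1 : Z) != 0.
Notation datum := (datum l rho P Y).
Notation level := (level l rho P Y).
Notation idl := (idl l rho P Y).
Notation tabs := (tabs l rho).
Notation is_shape := (is_shape l).

Lemma red_choice mu : is_shape mu -> exists red : seq nat -> seq nat,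
  forall v, perm_eq v mu ->
  [/\ valid (size mu) (red v), act mu (red v) = v & size (red v) = ninv v].
Proof.
move=> sh.
have ex v : exists u, perm_eq v mu ->
    [/\ valid (size mu) u, act mu u = v & size u = ninv v].
  have [pv|_] := boolP (perm_eq v mu); last by exists [::].
  by have [u hu] := red_exists (shape_sorted sh) pv; exists u.
by have [red h] := choice ex; exists red.
Qed.

(** In [a E(i^nu) a' E(i)] the right factor is straightened: a word of a tableau
    [v] survives only if [v] has residues [i], and the rest lies in the ideal of the
    more dominant shapes. *)
Lemma trunc_step n E : datum n E ->
  (forall U, upper l U -> forall j, (forall c, tabs j c -> U (sort leq c)) ->
    idl n E U (E j)) ->
  (forall mu k, is_shape mu -> size mu = n -> (k < n)%N ->
    idl n E (above mu) (Y k * E (map rho mu))) ->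
  forall U, upper l U -> forall z i, idl n E U z ->
  idl n E (fun nu => U nu /\ exists2 c, tabs i c & sort leq c = nu) (z * E i).
Proof.
move=> D L1 L2 U up z i; set U' := fun nu => _ /\ _.
have G : gideal P Y n (idl n E U') := idl_gideal l rho P Y n E U'.
suff gen nu a a' : is_shape nu -> size nu = n -> U nu -> mono P Y n a ->
    mono P Y n a' -> idl n E U' (a * E (map rho nu) * a' * E i).
  apply: (zspan_bind (f := fun z => z * E i)) => [|x y|x]; [exact: mul0r|exact: mulrBl|].
  by case=> nu [a [a' [[h1 h2 h3] [h4 h5 ->]]]]; apply: gen.
move: {2}(sumn nu).+1 (ltnSn (sumn nu)) => N; elim: N nu a a' => // N IHN nu a a'.
rewrite ltnS => lN sh sz Unu ha ha'; move: sz lN ha ha' D L1 L2 G IHN => <- lN ha ha' D L1 L2 G IHN.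
have [red redP] := red_choice sh.
have gar th X Q tl W1 W2 : nu = th ++ X :: Q ++ (X + l)%N :: tl ->
    perm_eq (W1 ++ W2) Q -> idl (size nu) E (above nu)
      (E (map rho (th ++ W1 ++ [:: (X + l)%N, X & W2 ++ tl]))).
  move=> Enu pW; rewrite Enu in L1 sh *.
  exact: (garnir_idl l_gt0 rhoS rho_apart two_neq0 L1).
have dots k : (k < size nu)%N -> idl (size nu) E (above nu) (Y k * E (map rho nu)).
  exact: L2.
have -> : a * E (map rho nu) * a' * E i = a * (E (map rho nu) * a' * E i).
  by rewrite !mulrA.
have := mono_span l_gt0 D sh gar dots redP ha'.
apply: (zspan_bind (f := fun z => a * (z * E i))) => [|x y|x].
- by rewrite mul0r mulr0.
- by rewrite mulrBl mulrBr.
case=> [[v [sv pv ->]]|].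
  have [vv av _] := redP v pv.
  have h := ePsiE D vv; rewrite av in h.
  rewrite h -[_ * E _ * E _]mulrA; have [ri|ne] := pselect (map rho v = i).
    rewrite -ri (d_EE D) -h mulrA; apply: zspan_in.
    exists nu, a, (Psi P (red v)); split; last by split=> //; apply: mono_Psi.
    split=> //; split=> //; exists v; first by split.
    exact: (shape_perm sh pv).
  by rewrite (d_EE0 D) // !mulr0; apply: zspan0.
move=> h; apply: (gMl G) => //; move: h.
apply: (zspan_bind (f := fun z => z * E i)) => [|x' y'|x']; [exact: mul0r|exact: mulrBl|].
case=> nu' [b [b' [[h1 h2 h3] [h4 h5 ->]]]]; apply: IHN => //.
  apply: leq_trans lN; case: h3 => _ d ne; apply: dom_sumn_lt => //.
  - exact: shape_sorted h1.
  - exact: shape_sorted sh.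
by apply: (up nu) => //; case: h3.
Qed.

Theorem datum_level n E : datum n E -> level n E.
Proof.
elim: n E => [|n IH] E D.
  have h1 U : upper l U -> forall j, (forall c, tabs j c -> U (sort leq c)) ->
      idl 0 E U (E j).
    move=> up [|x j] h; last by rewrite (d_size D) //; apply: zspan0.
    by apply: (idl_E _ _ _ _ (nu := [::])) => //; apply: (h [::]).
  by split=> //; apply: trunc_step.
have h b : level n (fun i => E (rcons i b)) by apply/IH/datum_rcons.
split.
- by move=> U up j hj; apply: (idm_step l_gt0 rhoS rho_apart two_neq0 D h).
- by move=> mu k sh sz kn; apply: (dot_step l_gt0 rhoS rho_apart two_neq0 D h).
apply: trunc_step => //.
  by move=> U up j hj; apply: (idm_step l_gt0 rhoS rho_apart two_neq0 D h).
by move=> mu k sh sz kn; apply: (dot_step l_gt0 rhoS rho_apart two_neq0 D h).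
Qed.
End LevelAll.

(** * The local relations of the blob algebra *)

Section BlobDatum.
Variables (F : fieldType) (e l n : nat) (kappa : 'I_l -> 'Z_e).
Hypotheses (l_gt0 : (0 < l)%N) (n_gt1 : (1 < n)%N).

Definition column (p : nat) : 'I_l := Ordinal (ltn_pmod p l_gt0).
Definition key_res (p : nat) : 'Z_e := kappa (column p) - (p %/ l)%:R.

Notation B := (blobAlg F n kappa).
Notation rel := (@blob_rel F e l n kappa).

Definition seq_ffun (i : seq 'Z_e) : {ffun 'I_n -> 'Z_e} := [ffun k : 'I_n => nth 0 i k].
Definition bE (i : seq 'Z_e) : B :=
  if size i == n then blob_idm F kappa (seq_ffun i) else 0.
Definition bP (r : nat) : B :=
  if insub r is Some r' then pgen rel (KPsi e r') else 0.
Definition bY (k : nat) : B :=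
  if insub k is Some k' then pgen rel (KY e k') else 0.

Lemma bPE (r : 'I_n.-1) : bP r = pgen rel (KPsi e r).
Proof. by rewrite /bP valK. Qed.

Lemma bYE (k : 'I_n) : bY k = pgen rel (KY e k).
Proof. by rewrite /bY valK. Qed.

Lemma bE_size i : size i = n -> bE i = pgen rel (KIdem (seq_ffun i)).
Proof. by move=> s; rewrite /bE s eqxx. Qed.

Lemma bE0 i : size i <> n -> bE i = 0.
Proof. by move=> /eqP h; rewrite /bE (negPf h). Qed.

Let K c d : klr_rel kappa c d -> cls rel c = cls rel d.
Proof. by move=> h; apply/presP/blob_klr. Qed.

Lemma key_res_small m (ml : (m < l)%N) : key_res m = kappa (Ordinal ml).
Proof.
rewrite /key_res divn_small // subr0; congr kappa; apply: val_inj.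
by rewrite /= modn_small.
Qed.

Lemma pair_ord a (x y : 'Z_e) b : size (a ++ [:: x, y & b]) = n ->
  exists r : 'I_n.-1, [/\ r = size a :> nat, seq_ffun (a ++ [:: x, y & b]) (lo r) = x,
    seq_ffun (a ++ [:: x, y & b]) (hi r) = y &
    sact r (seq_ffun (a ++ [:: x, y & b])) = seq_ffun (a ++ [:: y, x & b])].
Proof.
move=> s; have h : (size a < n.-1)%N by rewrite -s size_cat /= !addnS /= ltnS leq_addr.
have n0 (u v : 'Z_e) : nth 0 (a ++ [:: u, v & b]) (size a) = u.
  by rewrite nth_cat ltnn subnn.
have n1 (u v : 'Z_e) : nth 0 (a ++ [:: u, v & b]) (size a).+1 = v.
  by rewrite nth_cat ltnNge leqW //= subSnn.
exists (Ordinal h); split=> //; rewrite ?ffunE /= ?n0 ?n1 //.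
apply/ffunP=> k; rewrite !ffunE /stransp.
case: tpermP => [->|->|/eqP k1 /eqP k2] /=; rewrite ?n0 ?n1 //.
have {}k1 : (k != size a :> nat) by apply: contra k1 => /eqP E; apply/eqP/val_inj.
have {}k2 : (k != (size a).+1 :> nat) by apply: contra k2 => /eqP E; apply/eqP/val_inj.
move: k1 k2; move: (nat_of_ord k) => j k1 k2.
rewrite !nth_cat; case: ltnP => // ka.
by have -> : (j - size a = (j - size a - 2).+2)%N by lia.
Qed.

Lemma blob_datum : datum l (key_res) bP bY n bE.
Proof.
split.
- exact: bE0.
- move=> i; have [s|/eqP s] := eqVneq (size i) n; last by rewrite bE0 // mulr0.
  by rewrite bE_size //; have := K (klr_idem F kappa (seq_ffun i) (seq_ffun i)); rewrite eqxx !clsE.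
- move=> i j ij.
  have [s|/eqP s] := eqVneq (size i) n; last by rewrite bE0 // mul0r.
  have [s'|/eqP s'] := eqVneq (size j) n; last by rewrite (bE0 s') mulr0.
  rewrite !bE_size //; have := K (klr_idem F kappa (seq_ffun i) (seq_ffun j)).
  case: eqP => [E _|_]; last by rewrite !clsE.
  case: ij; apply: (@eq_from_nth _ 0); first by rewrite s.
  by move=> k; rewrite s => kn; have /ffunP /(_ (Ordinal kn)) := E; rewrite !ffunE.
- move=> x i h; have [s|/eqP s] := eqVneq (size (x :: i)) n; last by rewrite bE0.
  rewrite bE_size //.
  have n0 : (0 < n)%N by apply: ltnW.
  apply: (K (klr_init F (k := Ordinal n0) _ _)) => // m.
  rewrite ffunE /=; apply/eqP=> E; apply: (h m) => //.
  rewrite E key_res_small; congr kappa; exact: val_inj.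
- move=> m i ml; have [s|/eqP s] := eqVneq (size [:: key_res m, key_res m + 1 & i]) n; last by rewrite bE0.
  rewrite bE_size //; have n0 : (0 < n)%N by apply: ltnW.
  apply/(presP (Rel := rel)).
  apply: (@blob_init F e l n kappa _ (Ordinal n0) (Ordinal n_gt1) (Ordinal ml)) => //.
    by rewrite ffunE /= -key_res_small.
  by rewrite !ffunE.
- move=> i; have [s|/eqP s] := eqVneq (size i) n; last by rewrite bE0 // mulr0.
  have n0 : (0 < n)%N by apply: ltnW.
  rewrite bE_size // (bYE (Ordinal n0)).
  have [[m hm]|hm] := pselect (exists m, seq_ffun i (Ordinal n0) = kappa m).
    have := K (klr_y1 F (erefl : Ordinal n0 = 0%N :> nat) hm); by rewrite !clsE.
  have -> : pgen rel (KIdem (seq_ffun i)) = 0; last by rewrite mulr0.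
  apply: (K (klr_init F (k := Ordinal n0) _ _)) => // m.
  by apply/eqP=> E; apply: hm; exists m.
- move=> k i kn; have [s|/eqP s] := eqVneq (size i) n; last by rewrite bE0 // mulr0 mul0r.
  rewrite bE_size // (bYE (Ordinal kn)).
  by have := K (klr_y_idem F kappa (Ordinal kn) (seq_ffun i)); rewrite !clsE.
- move=> a x y b; have [s|/eqP s] := eqVneq (size (a ++ [:: x, y & b])) n; last first.
    rewrite !bE0 ?mulr0 ?mul0r //; by move: s; rewrite !size_cat.
  have [r [<- rx ry rs]] := pair_ord s.
  rewrite !bE_size ?bPE -?rs //; last by move: s; rewrite !size_cat.
  by have := K (klr_psi_idem F kappa r (seq_ffun (a ++ [:: x, y & b]))); rewrite !clsE.
- move=> r k rn kn h1 h2.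
  have rn' : (r < n.-1)%N by rewrite -ltnS prednK // ltnW.
  rewrite (bPE (Ordinal rn')) (bYE (Ordinal kn)).
  have := K (klr_psi_y F kappa (r := Ordinal rn') (k := Ordinal kn) _ _); rewrite !clsE; apply.
    by rewrite -val_eqE /=; apply/eqP.
  by rewrite -val_eqE /=; apply/eqP.
- move=> r s sn rs.
  have sn' : (s < n.-1)%N by rewrite -ltnS prednK // ltnW.
  have rn' : (r < n.-1)%N by apply: ltn_trans sn'; apply: ltn_trans rs.
  rewrite (bPE (Ordinal rn')) (bPE (Ordinal sn')).
  by have := K (klr_psi_psi F kappa (r := Ordinal rn') (s := Ordinal sn') _); rewrite !clsE /= rs; apply.
- move=> a x y b; have [s|/eqP s] := eqVneq (size (a ++ [:: x, y & b])) n; last first.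
    by rewrite /delta bE0 // if_same !mulr0 subr0.
  have [r [<- rx ry rs]] := pair_ord s.
  rewrite bE_size // bPE -[r.+1]/(hi r : nat) -[nat_of_ord r]/(lo r : nat) !bYE.
  have := K (klr_psi_yhi F kappa r (seq_ffun (a ++ [:: x, y & b]))).
  rewrite !clsE rx ry => ->; rewrite mulrBl -presZAl mul1r /delta.
  by case: eqP => _; rewrite ?scale1r ?scale0r.
- move=> a x y b; have [s|/eqP s] := eqVneq (size (a ++ [:: x, y & b])) n; last first.
    by rewrite /delta bE0 // if_same !mulr0 subr0.
  have [r [<- rx ry rs]] := pair_ord s.
  rewrite bE_size // bPE -[r.+1]/(hi r : nat) -[nat_of_ord r]/(lo r : nat) !bYE.
  have := K (klr_yhi_psi F kappa r (seq_ffun (a ++ [:: x, y & b]))).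
  rewrite !clsE rx ry => ->; rewrite mulrBl -presZAl mul1r /delta.
  by case: eqP => _; rewrite ?scale1r ?scale0r.
- move=> a x b; have [s|/eqP s] := eqVneq (size (a ++ [:: x, x & b])) n; last first.
    by rewrite bE0 // mulr0.
  have [r [<- rx ry rs]] := pair_ord s; rewrite bE_size // bPE.
  by have := K (klr_psi2_eq F kappa (etrans rx (esym ry))); rewrite !clsE.
- move=> a x y b h; have [s|/eqP s] := eqVneq (size (a ++ [:: x, y & b])) n; last first.
    by rewrite bE0 // mulr0.
  have [r [<- rx ry rs]] := pair_ord s; rewrite bE_size // bPE.
  have := K (klr_psi2_far F kappa (r := r) (i := seq_ffun (a ++ [:: x, y & b])) _).
  by rewrite !clsE rx ry; apply.
- move=> a x b; have [s|/eqP s] := eqVneq (size (a ++ [:: x, x + 1 & b])) n; last first.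
    by rewrite bE0 // !mulr0.
  have [r [<- rx ry rs]] := pair_ord s.
  rewrite bE_size // bPE -[r.+1]/(hi r : nat) -[nat_of_ord r]/(lo r : nat) !bYE.
  have := K (klr_psi2_up F kappa (r := r) (i := seq_ffun (a ++ [:: x, x + 1 & b])) _).
  by rewrite !clsE rx ry; apply.
- move=> a x b; have [s|/eqP s] := eqVneq (size (a ++ [:: x, x - 1 & b])) n; last first.
    by rewrite bE0 // !mulr0.
  have [r [<- rx ry rs]] := pair_ord s.
  rewrite bE_size // bPE -[r.+1]/(hi r : nat) -[nat_of_ord r]/(lo r : nat) !bYE.
  have := K (klr_psi2_down F kappa (r := r) (i := seq_ffun (a ++ [:: x, x - 1 & b])) _).
  by rewrite !clsE rx ry; apply.
move=> a x y z b; set i := a ++ _.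
have [s|/eqP s] := eqVneq (size i) n; last first.
  by rewrite /braid_sign bE0 // !mulr0 oppr0 !if_same addr0.
have [r [rE rx ry _]] := pair_ord s.
have [|r1 [r1E _ rz _]] := @pair_ord (rcons a x) y z b; first by rewrite cat_rcons.
rewrite cat_rcons -/i in rz.
have rr : r1 = r.+1 :> nat by rewrite r1E size_rcons rE.
rewrite -rE bE_size // -rr !bPE.
have := K (klr_braid F kappa (seq_ffun i) rr); rewrite !clsE => ->.
rewrite mulrDl -presZAl mul1r; congr (_ + _).
rewrite /braid_coef /braid_sign rz rx ry.
by case: ifP => _; [rewrite scaleN1r|case: ifP; rewrite ?scale1r ?scale0r].
Qed.
End BlobDatum.

(** * Residues under strong adjacency-freeness *)

Section Residues.
Variables (e l n : nat) (khat : 'I_l -> int).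
Hypotheses (e_gt1 : (1 < e)%N) (l_gt1 : (1 < l)%N).
Hypothesis saf : strongly_adjacency_free e n khat.
Let l_gt0 : (0 < l)%N := ltnW l_gt1.
Notation kappa := (charge e khat).
Notation rho := (key_res kappa l_gt0).

Lemma rho_shift p : rho (p + l)%N = rho p - 1.
Proof.
rewrite /key_res divnDr // divnn l_gt0 natrD opprD addrA.
by congr (kappa _ - _ - _); apply: val_inj; rewrite /= modnDr.
Qed.

Lemma Zp_val (x : 'Z_e) : (x < e)%N.
Proof. by rewrite -[X in (_ < X)%N](Zp_cast e_gt1) ltn_ord. Qed.

Lemma Zp_valD (x : 'Z_e) k : (x + k%:R : 'Z_e) = ((x + k) %% e)%N :> nat.
Proof. by rewrite -{1}(natr_Zp x) -natrD val_Zp_nat. Qed.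

(** As the representatives increase, equality would force [kappa j + 2] to wrap
    around [e], and the first charge to exceed the last one by 1 or 2
    modulo [e]. *)
Lemma charge_gap (i j : 'I_l) : (i < j)%N -> kappa i <> kappa j + 2%:R.
Proof.
move=> ij /(congr1 (@nat_of_ord _)); rewrite [RHS]Zp_valD => E.
pose i0 : 'I_l := Ordinal l_gt0.
have l1 : (l.-1 < l)%N by rewrite prednK.
pose j0 : 'I_l := Ordinal l1.
have hij := saf_incr saf ij.
have h0 : (kappa i0 <= kappa i)%N.
  have [->//|] := eqVneq i i0; rewrite -val_eqE -lt0n => h.
  by apply/ltnW/(saf_incr saf).
have h1 : (kappa j <= kappa j0)%N.
  have [->//|] := eqVneq j j0; rewrite -val_eqE => h.
  apply/ltnW/(saf_incr saf); rewrite ltn_neqAle h /=.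
  by rewrite -ltnS prednK.
have ne : i0 != j0 by rewrite -val_eqE /=; case: (l) l_gt1 => [|[]].
have a2 := saf_ends saf (erefl : i0 = 0%N :> nat) (prednK l_gt0 : j0.+1 = l).
have /and3P [_ a1 _] := saf_adj saf ne.
have {}a2 : (kappa i0 <> (kappa j0 + 2) %% e :> nat)%N.
  by rewrite -Zp_valD => /val_inj; apply/eqP.
have {}a1 : (kappa i0 <> (kappa j0 + 1) %% e :> nat)%N.
  rewrite -Zp_valD => /val_inj; apply/eqP; apply: contra a1 => /eqP ->.
  by rewrite addrAC subrr add0r.
have b0 := Zp_val (kappa j0); have b1 := Zp_val (kappa j).
have small x : (e <= x < e + e)%N -> (x %% e = x - e)%N.
  move=> /andP [ex xe]; rewrite -{1}(subnK ex) modnDr modn_small //.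
  by move: ex xe; clear; lia.
move: a1 a2 E b0 b1 hij h0 h1.
move: (nat_of_ord (kappa i0)) (nat_of_ord (kappa j0)) => a b.
move: (nat_of_ord (kappa i)) (nat_of_ord (kappa j)) => u v.
move=> a1 a2 E b0 b1 hij h0 h1.
have [h|h] := ltnP (v + 2) e; first by rewrite modn_small // in E; lia.
rewrite small in E; last by lia.
rewrite small in a2; last by lia.
by have [h'|h'] := ltnP (b + 1) e; [rewrite modn_small // in a1|rewrite small in a1]; lia.
Qed.

Lemma charge_apart (i j : 'I_l) : i != j -> [/\ kappa i <> kappa j,
  kappa i <> kappa j + 1 & kappa i <> kappa j - 1].
Proof.
move=> ij; have /and3P [h1 h2 h3] := saf_adj saf ij.
split=> E; [move: h1|move: h2|move: h3]; rewrite E.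
- by rewrite subrr eqxx.
- by rewrite addrAC subrr add0r eqxx.
- by rewrite addrAC subrr add0r eqxx.
Qed.

(** Two of [l] consecutive nodes lie in the same row, or in consecutive rows with
    the lower one further to the left; the charges decide in both cases. *)
Lemma rho_unlinked p p' : (p < p' < p + l)%N -> unlinked (rho p) (rho p').
Proof.
case/andP=> pp' p'l; rewrite /key_res.
set i := column l_gt0 p; set j := column l_gt0 p'.
have Ep := divn_eq p l; have Ep' := divn_eq p' l.
have rp := ltn_pmod p l_gt0; have rp' := ltn_pmod p' l_gt0.
have [E|ne] := eqVneq (p' %/ l)%N (p %/ l)%N.
  have ij : i != j by rewrite -val_eqE /=; apply/eqP=> E'; rewrite Ep Ep' E E' ltnn in pp'.
  rewrite E; have [h1 h2 h3] := charge_apart ij.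
  apply/and3P; split; apply/eqP; rewrite ?[_ - _ + 1]addrAC ?[_ - _ - 1]addrAC.
  - by move/addIr.
  - by move/addIr.
  - by move/addIr.
have E : (p' %/ l = (p %/ l).+1)%N.
  apply/eqP; rewrite eqn_leq; apply/andP; split.
    rewrite -ltnS ltn_divLR //; move: p'l; rewrite {1}Ep mulSn; lia.
  rewrite ltn_neqAle eq_sym ne /=; apply: leq_div2r; exact: ltnW.
have ji : (j < i)%N.
  rewrite /i /j /=; move: p'l; rewrite {1}Ep {1}Ep' E mulSn; lia.
rewrite E -[(p %/ l).+1]addn1 natrD opprD addrA.
have ij : i != j by rewrite -val_eqE neq_ltn ji orbT.
have [h1 h2 h3] := charge_apart ij; have h4 := charge_gap ji.
apply/and3P; split; apply/eqP; rewrite ?subrK.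
- by rewrite addrAC => /addIr.
- by move/addIr.
move=> E'; apply: h4; have -> : kappa i = kappa j - 1 - 1.
  apply: (addIr (- (p %/ l)%:R)).
  by rewrite E' [RHS]addrAC [kappa j - 1 - _]addrAC.
by rewrite (natrD _ 1 1) addrA !subrK.
Qed.

(** For [e = 2] the representatives of two charges would be 0 and 1, which are
    adjacent. *)
Lemma two_unit : (1 + 1 : 'Z_e) != 0.
Proof.
pose i0 : 'I_l := Ordinal l_gt0; pose i1 : 'I_l := Ordinal l_gt1.
have ne : i0 != i1 by rewrite -val_eqE.
have [h1 h2 _] := charge_apart ne.
apply/negP=> /eqP H; have := congr1 (@nat_of_ord _) H.
have -> : (1 + 1 : 'Z_e) = 2%:R by [].
rewrite val_Zp_nat //= => h; have {h} e2 : e = 2%N.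
  have [h'|] := ltnP 2 e; first by rewrite modn_small in h.
  by move=> h'; apply/eqP; rewrite eqn_leq h' e_gt1.
have v1 : (kappa i1 < 2)%N by rewrite -[X in (_ < X)%N]e2; apply: Zp_val.
have hi := saf_incr saf (isT : (i0 < i1)%N).
have E0 : kappa i0 = 0%N%:R by rewrite -[LHS]natr_Zp; congr (_%:R); move: v1 hi; lia.
have E1 : kappa i1 = 1%N%:R.
  by rewrite -[LHS]natr_Zp; congr (_%:R); move: v1 hi; lia.
by apply: h2; rewrite E0 E1 H.
Qed.
End Residues.

Local Open Scope nat_scope.

(** * Tableaux as sequences of numbers *)

Lemma std_addable l s j : stdfrom l [::] s -> j < size s ->
  addable l (take j s) (nth 0 s j).
Proof.
move=> h js; move: h; rewrite -[X in stdfrom _ _ X](cat_take_drop j s) stdfrom_cat.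
by rewrite (drop_nth 0 js) => /andP [_ /andP []].
Qed.

Lemma std_addableP l s : (forall j, j < size s -> addable l (take j s) (nth 0 s j)) ->
  stdfrom l [::] s.
Proof.
elim/last_ind: s => // s x IH h; rewrite stdfrom_rcons; apply/andP; split.
  apply: IH => j js; have := h j; rewrite size_rcons ltnS => /(_ (ltnW js)).
  by rewrite nth_rcons js -cats1 takel_cat // ltnW.
by have := h (size s); rewrite size_rcons ltnSn nth_rcons ltnn eqxx -cats1 take_size_cat // => ->.
Qed.

Lemma std_below l s j y d : stdfrom l [::] s -> j < size s ->
  nth 0 s j = y + d.+1 * l -> y \in take j s.
Proof.
move=> h; elim: d j => [|d IH] j js E; have /andP [_] := std_addable h js.
  by rewrite E mul1n ltnNge leq_addl /= addnK.
rewrite E mulSnr addnA ltnNge leq_addl /= addnK => /(nthP 0) [k].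
rewrite size_takel ?(ltnW js) // => kj; rewrite nth_take // => /IH hk.
have yk : y \in take k s by apply: hk; apply: ltn_trans js.
by move: yk; rewrite -(take_takel s (ltnW kj)); apply: mem_take.
Qed.

Section Keys.
Variables (l n : nat).
Hypothesis l_gt0 : 0 < l.
Notation column := (column l_gt0).

(** Rows are counted from 1 in diagrams, so row 0 needs no code of its own. *)
Definition key (x : node l) : nat := x.1.-1 * l + x.2.
Definition unkey (p : nat) : node l := ((p %/ l).+1, column p).

Lemma key_div x : key x %/ l = x.1.-1.
Proof. by rewrite /key divnMDl // divn_small ?addn0. Qed.

Lemma key_col x : column (key x) = x.2.
Proof. by apply: val_inj; rewrite /= /key modnMDl modn_small. Qed.

Lemma unkeyK p : key (unkey p) = p.
Proof. by rewrite /key /= -divn_eq. Qed.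

Lemma keyK x : 0 < x.1 -> unkey (key x) = x.
Proof. by case: x => r m /= r0; rewrite /unkey key_div key_col /= prednK. Qed.

Lemma node_lt_key x y : 0 < x.1 -> 0 < y.1 -> node_lt x y = (key y < key x).
Proof.
case: x y => [[|r] m] [[|r'] m'] //= _ _; rewrite /node_lt /key /= ltnS eqSS.
have m1 := ltn_ord m; have m2 := ltn_ord m'.
case: (ltngtP r' r) => [h|h|->] /=; last by rewrite ltn_add2l.
  have : r' * l + l <= r * l by rewrite -mulSnr leq_pmul2r.
  lia.
have : r * l + l <= r' * l by rewrite -mulSnr leq_pmul2r.
lia.
Qed.

Section OneShape.
Variable a : Par1 l n.
Implicit Types (t : Tab a).

Definition keys t : seq nat := [seq key (tab_node t k) | k <- enum 'I_n].

Lemma tab_node_diag t k : tab_node t k \in diagram a.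
Proof. exact: valP. Qed.

Lemma tab_node_gt0 t k : 0 < (tab_node t k).1.
Proof. by have := tab_node_diag t k; rewrite in_diagram => /andP []. Qed.

Lemma size_keys t : size (keys t) = n.
Proof. by rewrite size_map size_enum_ord. Qed.

Lemma nth_keys t (k : 'I_n) : nth 0 (keys t) k = key (tab_node t k).
Proof. by rewrite (nth_map k) ?size_enum_ord // nth_ord_enum. Qed.

Lemma key_tab_inj t : injective (fun k => key (tab_node t k)).
Proof.
move=> i j /(congr1 unkey); rewrite !keyK ?tab_node_gt0 //; exact: tab_node_inj.
Qed.

Lemma uniq_keys t : uniq (keys t).
Proof. by rewrite map_inj_uniq ?enum_uniq //; apply: key_tab_inj. Qed.

Lemma tab_surj t x : x \in diagram a -> exists k, tab_node t k = x.
Proof.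
move=> xd; have /andP [_ /forallP /(_ [` xd]%fset) /codomP [k E]] := valP t.
by exists k; rewrite /tab_node -E.
Qed.

Lemma mem_keys t p : (p \in keys t) = (p %/ l < val a (column p)).
Proof.
have E : (unkey p \in diagram a) = (p %/ l < val a (column p)) by rewrite in_diagram.
rewrite -E; apply/mapP/idP => [[k _ ->]|/(tab_surj t) [k hk]].
  by rewrite keyK ?tab_node_gt0 ?tab_node_diag.
by exists k; rewrite ?mem_enum // hk unkeyK.
Qed.

Lemma perm_keys t t' : perm_eq (keys t) (keys t').
Proof. by apply: uniq_perm; rewrite ?uniq_keys // => p; rewrite !mem_keys. Qed.

Definition row_keys : seq nat := keys (initial_tab a).

Lemma initialP (i j : 'I_n) : i < j ->
  key (tab_node (initial_tab a) i) < key (tab_node (initial_tab a) j).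
Proof.
move=> ij; have := xchooseP (@initial_tab_ex l n a).
move=> /forallP /(_ i) /forallP /(_ j) /implyP /(_ ij).
by rewrite node_lt_key ?tab_node_gt0.
Qed.

Lemma row_keys_sorted : sorted ltn row_keys.
Proof.
apply/(sortedP 0)=> i; rewrite size_keys => h.
rewrite (nth_keys _ (Ordinal (ltnW h))) (nth_keys _ (Ordinal h)).
exact: initialP.
Qed.

Lemma row_keys_shape : is_shape l row_keys.
Proof.
rewrite /is_shape row_keys_sorted /=; apply: closed_std => //.
  exact: row_keys_sorted.
apply/allP=> p; rewrite !mem_keys => h; case: ltnP => //= lp.
have -> : column (p - l) = column p.
  by apply: val_inj; rewrite /= -{2}(subnK lp) modnDr.
by apply: leq_ltn_trans h; rewrite leq_div2r // leq_subr.
Qed.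

Lemma keys_inj : injective keys.
Proof.
move=> t t' E; apply/val_inj/ffunP=> k; apply: val_inj.
have := nth_keys t k; rewrite E nth_keys => /(congr1 unkey).
by rewrite !keyK ?tab_node_gt0.
Qed.

Lemma keys_surj v : perm_eq v row_keys -> exists t, keys t = v.
Proof.
move=> pv; have sv : size v = n by rewrite (perm_size pv) size_keys.
have uv : uniq v by rewrite (perm_uniq pv) uniq_keys.
have vm (k : 'I_n) : nth 0 v k \in row_keys by rewrite -(perm_mem pv) mem_nth ?sv.
have vi (k : 'I_n) : index (nth 0 v k) row_keys < n.
  by have := vm k; rewrite -index_mem size_keys.
pose sg (k : 'I_n) : 'I_n := Ordinal (vi k).
have sg_inj : injective sg.
  move=> i j /(congr1 val) /= h; apply: val_inj.
  have := congr1 (nth 0 row_keys) h; rewrite !nth_index // => /eqP.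
  by rewrite nth_uniq ?sv // => /eqP.
pose f : {ffun 'I_n -> diagram a} := [ffun k => val (initial_tab a) (sg k)].
have f_inj : injective f.
  by move=> i j; rewrite !ffunE => /tab_inj /sg_inj.
have fP : injectiveb f && [forall x, x \in codom f].
  apply/andP; split; first exact/injectiveP.
  by apply/forallP=> x; apply: inj_card_onto => //; rewrite card_diagram card_ord.
exists (exist _ f fP); apply: (@eq_from_nth _ 0); first by rewrite size_keys sv.
move=> k; rewrite size_keys => kn; rewrite (nth_keys _ (Ordinal kn)) /tab_node /= ffunE.
have := nth_keys (initial_tab a) (sg (Ordinal kn)); rewrite /tab_node /= => <-.
by rewrite nth_index //; exact: vm (Ordinal kn).
Qed.

Lemma standard_keys t : standard t = stdfrom l [::] (keys t).
Proof.
apply/idP/idP=> h.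
  apply: std_addableP => j; rewrite size_keys => jn; rewrite (nth_keys t (Ordinal jn)).
  set x := tab_node t _.
  have ux : key x \notin take j (keys t).
    have := uniq_keys t; rewrite -{1}(cat_take_drop j (keys t)) cat_uniq => /and3P [_ /hasPn hu _].
    apply: hu; rewrite -(nth_keys t (Ordinal jn)) /= -[X in nth _ _ X](addn0 j) -nth_drop.
    by apply: mem_nth; rewrite size_drop size_keys subn_gt0.
  rewrite /addable ux /=; case: ltnP => //= lx.
  have x1 : 1 < x.1.
    move: lx; rewrite /key; case: (x.1.-1) (ltn_predK (tab_node_gt0 t (Ordinal jn))) => [|r <- //].
    by rewrite mul0n add0n leqNgt ltn_ord.
  have xd : (x.1.-1, x.2) \in diagram a.
    have := tab_node_diag t (Ordinal jn); rewrite !in_diagram -/x /= => /andP [_ hx].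
    rewrite -ltnS prednK ?x1 ?(ltnW x1) //=; exact: leq_trans (leq_pred _) hx.
  have [i Ei] := tab_surj t xd.
  have ij : i < j.
    move/forallP: h => /(_ i) /forallP /(_ (Ordinal jn)) /implyP; apply.
    by rewrite Ei -/x /= eqxx /= prednK // ltnW.
  have -> : key x - l = key (tab_node t i).
    rewrite Ei /key /=; case: (x.1) x1 => [|[|r]] //= _; by rewrite mulSn -addnA addKn.
  by rewrite -nth_keys -(nth_take 0 ij) mem_nth // size_takel ?size_keys // ltnW.
apply/forallP=> i; apply/forallP=> j; apply/implyP=> /andP [/eqP E2 E1].
have js : j < size (keys t) by rewrite size_keys.
have := std_below (y := key (tab_node t i)) (d := (tab_node t j).1 - (tab_node t i).1.+1) h js.
rewrite nth_keys => hb; have : key (tab_node t i) \in take j (keys t).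
  apply: hb; rewrite /key E2 -subSn // subSS addnAC -mulnDl; congr (_ * _ + _).
  by have := tab_node_gt0 t i; lia.
case/(nthP 0)=> k; rewrite size_takel ?(ltnW js) // => kj; rewrite nth_take //.
have kn : k < n by apply: ltn_trans (ltn_ord j).
rewrite (nth_keys t (Ordinal kn)) => /key_tab_inj <-; exact: kj.
Qed.
End OneShape.
End Keys.

(** * Reduced expressions of tableaux *)

Section Words.
Variable n : nat.
Implicit Types (r : 'I_n.-1) (w : seq 'I_n.-1).

Lemma nth_swp (T : Type) (x0 : T) r (s : seq T) (j : 'I_n) : size s = n ->
  nth x0 (swp r s) j = nth x0 s (stransp r j).
Proof.
move=> sn; have rn : r.+1 < size s by rewrite sn hi_subproof.
have [a [x [y [b [-> ra]]]]] := split_at rn; rewrite -ra swp_cat /stransp.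
have n0 (u v : T) : nth x0 (a ++ [:: u, v & b]) r = u.
  by rewrite nth_cat ra ltnn subnn.
have n1 (u v : T) : nth x0 (a ++ [:: u, v & b]) r.+1 = v.
  by rewrite nth_cat ra ltnNge leqW //= subSnn.
case: tpermP => [->|->|/eqP k1 /eqP k2] /=; rewrite ?n0 ?n1 //.
have {}k1 : (j != r :> nat) by apply: contra k1 => /eqP E; apply/eqP/val_inj.
have {}k2 : (j != r.+1 :> nat) by apply: contra k2 => /eqP E; apply/eqP/val_inj.
move: k1 k2; rewrite -ra; move: (nat_of_ord j) => k k1 k2.
rewrite !nth_cat; case: ltnP => // ka.
by have -> : k - size a = (k - size a - 2).+2 by lia.
Qed.

Lemma act_word (T : Type) (x0 : T) w (s : seq T) : size s = n ->
  act s (map val w) = [seq nth x0 s (word_perm w k) | k <- enum 'I_n].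
Proof.
elim: w s => [|r w IH] s sn /=.
  apply: (@eq_from_nth _ x0); first by rewrite size_map size_enum_ord.
  move=> k; rewrite sn => kn.
  by rewrite (nth_map (Ordinal kn)) ?size_enum_ord // perm1 nth_enum_ord.
rewrite IH ?size_swp //; apply: eq_map => k; by rewrite permM nth_swp.
Qed.

Lemma valid_word w : valid n (map val w).
Proof. by apply/allP=> _ /mapP [r _ ->]; apply: hi_subproof. Qed.

Lemma word_lift u : valid n u -> exists w, map val w = u.
Proof.
elim: u => [|r u IH] /=; first by exists [::].
case/andP=> rn /IH [w <-]; have h : r < n.-1 by rewrite ltn_predRL.
by exists (Ordinal h :: w).
Qed.
End Words.

Section ReducedKeys.
Variables (l n : nat).
Hypothesis l_gt0 : 0 < l.
Variable red : 'S_n -> seq 'I_n.-1.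
Hypothesis redP : forall w : 'S_n, reduced_expr w (red w).
Variable a : Par1 l n.
Implicit Types (t : Tab a).
Notation rk := (row_keys a).

Lemma keys_tab_perm t : keys t = [seq nth 0 rk (tab_perm t k) | k <- enum 'I_n].
Proof. by apply: eq_map => k; rewrite nth_keys tab_permP. Qed.

Lemma act_keys t w : act rk (map val w) = keys t <-> word_perm w = tab_perm t.
Proof.
rewrite (act_word 0) ?size_keys // keys_tab_perm; split=> [E|-> //].
apply/permP=> k; move/eq_in_map: E => /(_ k (mem_enum _ k)) /eqP.
by rewrite nth_uniq ?size_keys ?(uniq_keys l_gt0) // => /eqP /val_inj.
Qed.

Definition kred (v : seq nat) : seq nat :=
  if [pick t : Tab a | keys t == v] is Some t then map val (red (tab_perm t)) else [::].

Lemma kred_keys t : kred (keys t) = map val (red (tab_perm t)).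
Proof.
rewrite /kred; case: pickP => [t' /eqP /(keys_inj l_gt0) -> //|/(_ t)].
by rewrite eqxx.
Qed.

(** A shortest word for the permutation of a tableau has as many letters as the
    tableau has inversions: sorting gives a word of this length, and a letter
    changes the number of inversions by at most 1. *)
Lemma kredP v : perm_eq v rk ->
  [/\ valid (size rk) (kred v), act rk (kred v) = v & size (kred v) = ninv v].
Proof.
move=> pv; have [t tv] := keys_surj l_gt0 pv; rewrite -{}tv {v} in pv *.
rewrite kred_keys; have [wE wmin] := redP (tab_perm t).
have E : act rk (map val (red (tab_perm t))) = keys t by apply/act_keys.
split=> //; first by rewrite size_keys valid_word.
apply/eqP; rewrite eqn_leq; apply/andP; split; last first.
  have := ninv_act_le rk (map val (red (tab_perm t))).
  by rewrite E (ninv_sorted (row_keys_sorted l_gt0 a)).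
have [u [vu au su]] := red_exists (row_keys_sorted l_gt0 a) pv.
rewrite size_keys in vu; have [w wu] := word_lift vu; rewrite -{}wu in au su.
by rewrite -su !size_map; apply: wmin; apply/act_keys.
Qed.
End ReducedKeys.

(** * Shapes, dominance and residues of tableaux *)

Lemma down_closed_mem (s : seq nat) : uniq s ->
  (forall k, k.+1 \in s -> k \in s) -> forall k, (k \in s) = (k < size s).
Proof.
move=> us ds k; have down j i : i + j \in s -> i \in s.
  by elim: j => [|j IH]; rewrite ?addn0 // addnS => /ds.
apply/idP/idP=> [ks|].
  rewrite -(size_iota 0 k.+1); apply: uniq_leq_size; first exact: iota_uniq.
  move=> i; rewrite mem_iota ltnS /= => /subnKC E.
  by apply: (@down (k - i)); rewrite E.
apply: contraTT => ks; rewrite -leqNgt -[leqRHS](size_iota 0 k).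
apply: uniq_leq_size => // i iS; rewrite mem_iota /= add0n ltnNge.
apply: contra ks => /subnKC E; by apply: (@down (i - k)); rewrite E.
Qed.

Section Shapes.
Variables (l n : nat).
Hypothesis l_gt0 : 0 < l.
Notation column := (column l_gt0).

Lemma sum_columns nu : \sum_(m < l) count (fun p : nat => p %% l == m) nu = size nu.
Proof.
elim: nu => [|p nu IH] /=; first by rewrite big1.
rewrite big_split IH /= (bigD1 (column p)) //= eqxx big1 // => m.
by rewrite -val_eqE /= eq_sym => /negPf ->.
Qed.

(** The rows met by a column of a shape form an initial segment. *)
Lemma shape_column nu p : is_shape l nu ->
  (p \in nu) = (p %/ l < count (fun p' : nat => p' %% l == p %% l) nu).
Proof.
move=> sh; have unu := std_uniq (shape_std sh); have cl := std_closed (shape_std sh).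
pose s := [seq q %/ l | q <- nu & q %% l == p %% l].
have mem_s k : (k \in s) = (k * l + p %% l \in nu).
  apply/mapP/idP=> [[q]|h].
    by rewrite mem_filter => /andP [/eqP <- qnu] ->; rewrite -divn_eq.
  exists (k * l + p %% l); last by rewrite divnMDl // divn_small ?addn0 // ltn_pmod.
  by rewrite mem_filter h modnMDl modn_mod eqxx.
have us : uniq s.
  rewrite map_inj_in_uniq ?filter_uniq // => x y; rewrite !mem_filter.
  by move=> /andP [/eqP hx _] /andP [/eqP hy _] h; rewrite (divn_eq x l) (divn_eq y l) h hx hy.
have ds k : k.+1 \in s -> k \in s.
  rewrite !mem_s => /(allP cl); rewrite mulSn -addnA ltnNge leq_addr /=.
  by rewrite addKn.
have := down_closed_mem us ds (p %/ l); rewrite mem_s -divn_eq => ->.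
by rewrite size_map size_filter.
Qed.

Lemma shape_par nu : is_shape l nu -> size nu = n ->
  exists b : Par1 l n, row_keys b = nu.
Proof.
move=> sh sz; pose f : {ffun 'I_l -> nat} := [ffun m : 'I_l => count (fun p : nat => p %% l == m) nu].
have fP : \sum_m f m == n.
  by rewrite (eq_bigr _ (fun m _ => ffunE _ m)) sum_columns sz.
exists (exist _ f fP); apply: (irr_sorted_eq ltn_trans ltnn).
- exact: (row_keys_sorted l_gt0).
- exact: shape_sorted sh.
by move=> p; rewrite (mem_keys l_gt0) shape_column //= ffunE.
Qed.

Lemma filter_enum_ord k : [seq j : 'I_n <- enum 'I_n | j < k] = take k (enum 'I_n).
Proof.
apply: (inj_map val_inj); rewrite map_take val_enum_ord -[X in map _ X]/(filter (preim val (fun j => j < k)) _).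
rewrite -filter_map val_enum_ord; case: (leqP k n) => kn; last first.
  rewrite take_oversize ?size_iota 1?ltnW //; apply/all_filterP/allP=> i.
  by rewrite mem_iota => /andP [_ h]; apply: leq_trans h (ltnW kn).
by have := filter_iota_ltn 0 kn; rewrite add0n take_iota (minn_idPl kn).
Qed.

(** All nodes of a diagram precede a node in row 0, hence the bound 0. *)
Definition node_bound (x : node l) : nat := if x.1 is 0 then 0 else key x.

Lemma card_upto (a : Par1 l n) (t : Tab a) k x0 :
  #|` [fset x in tab_upto t k | node_lt x0 x]|%fset =
  cntlt (node_bound x0) (take k (keys t)).
Proof.
set s := [seq tab_node t j | j : 'I_n <- enum 'I_n & j < k].
have -> : ([fset x in tab_upto t k | node_lt x0 x])%fset =
    [fset x in [seq x <- s | node_lt x0 x]]%fset.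
  by apply/fsetP=> x; rewrite !inE mem_filter /= andbC.
rewrite card_fseq undup_id; last first.
  apply/filter_uniq; rewrite map_inj_uniq; last exact: tab_node_inj.
  exact/filter_uniq/enum_uniq.
rewrite /cntlt /keys -map_take -filter_enum_ord (map_comp (@key l) (tab_node t)) count_map size_filter.
apply: eq_in_count => x /mapP [j _ ->]; have t0 := tab_node_gt0 t j.
rewrite /= /node_bound; case E: (x0.1) => [|r]; last by rewrite node_lt_key ?E.
by rewrite /node_lt E /=; case: (_.1) t0.
Qed.

Lemma diagram_upto (a : Par1 l n) (t : Tab a) : diagram a = tab_upto t n.
Proof.
apply/fsetP=> x; rewrite [in RHS]in_fset /=; apply/idP/mapP=> [/(tab_surj t) [k <-]|[k _ ->]].
  by exists k; rewrite // mem_filter ltn_ord mem_enum.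
exact: tab_node_diag.
Qed.

Lemma above_par_lt (a b : Par1 l n) : above (row_keys a) (row_keys b) -> par_lt a b.
Proof.
case=> _ d ne; split; last by apply/eqP=> E; apply: ne; rewrite E.
move=> x0; rewrite (diagram_upto (initial_tab a)) (diagram_upto (initial_tab b)).
by rewrite !card_upto !take_oversize ?size_keys // d.
Qed.

Lemma tdom_tab_lt (a : Par1 l n) (t v : Tab a) : tdom (keys v) (keys t) ->
  keys v <> keys t -> tab_lt t v.
Proof.
move=> d ne; split; last by apply/eqP=> E; apply: ne; rewrite E.
by move=> k _ x0; rewrite !card_upto d.
Qed.

Section Residues.
Variables (e : nat) (kappa : 'I_l -> 'Z_e).

Lemma key_resE x : 0 < x.1 -> key_res kappa l_gt0 (key x) = res kappa x.
Proof.
move=> x0; rewrite /key_res /res key_col key_div // -[in RHS](prednK x0).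
by rewrite -[(x.1.-1).+1]addn1 natrD opprD [in RHS]addrACA addrN addr0.
Qed.

Lemma res_seq_keys (a : Par1 l n) (t : Tab a) :
  seq_ffun n (map (key_res kappa l_gt0) (keys t)) = res_seq kappa t.
Proof.
apply/ffunP=> k; rewrite !ffunE (nth_map 0) ?size_keys //.
by rewrite nth_keys key_resE // tab_node_gt0.
Qed.
End Residues.
End Shapes.

Local Open Scope ring_scope.

(** * Cells and Jucys-Murphy elements *)

Section LinSpan.
Variables (F : fieldType) (V : lmodType F) (S : V -> Prop).

Lemma lin_span_in x : S x -> lin_span S x.
Proof. by exists 1%N, (fun _ => 1), (fun _ => x); rewrite big_ord1 scale1r. Qed.

Lemma lin_span0 : lin_span S 0.
Proof.
exists 0%N, (fun _ => 0), (fun _ => 0); split; last by rewrite big_ord0.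
by case.
Qed.

Lemma lin_spanZ c x : lin_span S x -> lin_span S (c *: x).
Proof.
case=> N [d [v [h ->]]]; exists N, (fun j => c * d j), v; split=> //.
by rewrite scaler_sumr; apply: eq_bigr => j _; rewrite scalerA.
Qed.

Lemma lin_spanD x y : lin_span S x -> lin_span S y -> lin_span S (x + y).
Proof.
case=> N [c [v [h ->]]] [N' [c' [v' [h' ->]]]].
exists (N + N')%N, (fun j => match split j with inl i => c i | inr i => c' i end),
  (fun j => match split j with inl i => v i | inr i => v' i end); split.
  by move=> j; case: splitP.
rewrite big_split_ord /=; congr (_ + _); apply: eq_bigr => j _.
  by rewrite (unsplitK (inl j)).
by rewrite (unsplitK (inr j)).
Qed.

Lemma lin_spanB x y : lin_span S x -> lin_span S y -> lin_span S (x - y).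
Proof. by move=> hx hy; rewrite -scaleN1r; apply/lin_spanD/lin_spanZ. Qed.
End LinSpan.

Section Blob.
Variables (F : fieldType) (e l n : nat) (kappa : 'I_l -> 'Z_e).
Hypotheses (l_gt0 : (0 < l)%N) (n_gt1 : (1 < n)%N).
Notation rho := (key_res kappa l_gt0).
Hypothesis rhoS : forall p, rho (p + l)%N = rho p - 1.
Hypothesis rho_apart : forall p p', (p < p' < p + l)%N -> unlinked (rho p) (rho p').
Hypothesis two_neq0 : (1 + 1 : 'Z_e) != 0.
Variable red : 'S_n -> seq 'I_n.-1.
Hypothesis redP : forall w : 'S_n, reduced_expr w (red w).

Notation B := (blobAlg F n kappa).
Notation P := (@bP F e l n kappa).
Notation Y := (@bY F e l n kappa).
Notation E := (@bE F e l n kappa).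
Notation idm := (@blob_idm F e l n kappa).
Notation star := (@blob_star F e l n kappa).
Notation mono := (mono P Y).
Notation Psi := (Psi P).
Notation idl := (idl l rho P Y).
Notation cell := (cell F kappa red).
Notation kred := (kred red).

Let D := blob_datum F kappa l_gt0 n_gt1.
Let srel := @blob_rel_star F e l n kappa.

Lemma starM (x y : B) : star (x * y) = star y * star x.
Proof. exact: (pres_starM srel). Qed.
Lemma starD (x y : B) : star (x + y) = star x + star y.
Proof. exact: (pres_starD srel). Qed.
Lemma starZ c (x : B) : star (c *: x) = c *: star x.
Proof. exact: (pres_starZ srel). Qed.
Lemma starK (x : B) : star (star x) = x.
Proof. exact: (pres_starK srel). Qed.
Lemma star0 : star 0 = 0.
Proof. by rewrite -(scale0r (0 : B)) starZ !scale0r. Qed.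
Lemma starB (x y : B) : star (x - y) = star x - star y.
Proof. by rewrite starD -scaleN1r starZ scaleN1r. Qed.
Lemma star1 : star 1 = 1.
Proof. exact: (pres_star_cls srel). Qed.
Lemma star_idm i : star (idm i) = idm i.
Proof. exact: (pres_star_gen srel). Qed.
Lemma star_E i : star (E i) = E i.
Proof. by rewrite /bE; case: ifP => _; rewrite ?star_idm ?star0. Qed.
Lemma star_P r : star (P r) = P r.
Proof. by rewrite /bP; case: insubP => *; [apply: (pres_star_gen srel)|apply: star0]. Qed.
Lemma star_Y k : star (Y k) = Y k.
Proof. by rewrite /bY; case: insubP => *; [apply: (pres_star_gen srel)|apply: star0]. Qed.

Lemma star_mono m : mono n m -> mono n (star m).
Proof.
elim=> [|u r rn _ h|u k kn _ h]; first by rewrite star1; apply: mono1.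
  by rewrite starM star_P; apply: monoM => //; apply: mono_P.
by rewrite starM star_Y; apply: monoM => //; apply: mono_Y.
Qed.

Lemma star_idl U z : idl n E U z -> idl n E U (star z).
Proof.
apply: zspan_bind => [|x y|x]; [exact: star0|exact: starB|].
case=> nu [a [a' [h [ha ha' ->]]]]; apply: zspan_in.
exists nu, (star a'), (star a); split=> //.
by split; rewrite ?starM ?star_E ?mulrA //; apply: star_mono.
Qed.

Section OneShape.
Variable a : Par1 l n.
Notation rk := (row_keys a).
Notation ea := (E (map rho rk)).

Lemma idm_keys (t : Tab a) : idm (res_seq kappa t) = E (map rho (keys t)).
Proof. by rewrite bE_size; [rewrite (res_seq_keys l_gt0)|rewrite size_map size_keys]. Qed.

Lemma blob_psi_keys (t : Tab a) : blob_psi F kappa red (tab_perm t) = Psi (kred a (keys t)).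
Proof.
rewrite (kred_keys l_gt0) /blob_psi /Psi big_map; apply: eq_bigr => r _.
by rewrite bPE.
Qed.

Lemma cellE (s t : Tab a) :
  cell s t = star (Psi (kred a (keys s))) * (ea * Psi (kred a (keys t))).
Proof. by rewrite /cell !blob_psi_keys idm_keys mulrA. Qed.

Let sh := row_keys_shape l_gt0 a.
Let sz : size rk = n := size_keys (initial_tab a).

Lemma blob_level : level l rho P Y n E.
Proof. exact: datum_level. Qed.

Lemma datum_row : datum l rho P Y (size rk) E. Proof. by rewrite sz. Qed.

Lemma garnir_row th X Q tl W1 W2 : rk = th ++ X :: Q ++ (X + l)%N :: tl ->
  perm_eq (W1 ++ W2) Q ->
  idl (size rk) E (above rk)
    (E (map rho (th ++ W1 ++ [:: (X + l)%N, X & W2 ++ tl]))).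
Proof.
rewrite sz => Er pW; have h := sh; rewrite Er in h *.
exact: (garnir_idl l_gt0 rhoS rho_apart two_neq0 (level_idm blob_level)).
Qed.

Lemma dot_row k : (k < size rk)%N ->
  idl (size rk) E (above rk) (Y k * ea).
Proof. by rewrite sz => kn; apply: (level_dot blob_level). Qed.

Let kredP := kredP l_gt0 redP (a := a).

Lemma mono_kred (t : Tab a) : mono n (Psi (kred a (keys t))).
Proof.
have [h _ _] := kredP (perm_keys l_gt0 t (initial_tab a)).
by have := mono_Psi P Y h; rewrite size_keys.
Qed.

Lemma row_span m : mono n m ->
  zspan (fun z => (exists t : Std a, z = ea * Psi (kred a (keys (val t)))) \/
                  idl n E (above rk) z) (ea * m).
Proof.
move=> hm; have {}hm : mono (size rk) m by rewrite sz.
have := mono_span l_gt0 datum_row sh garnir_row dot_row kredP hm.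
apply: zspan_sub => z [[v [sv pv ->]]|h]; apply: zspan_in; [left|right].
  have [t tv] := keys_surj l_gt0 pv; rewrite -tv -standard_keys // in sv *.
  by exists (exist _ t sv).
by rewrite sz in h.
Qed.
End OneShape.

Lemma blob_aboveE (a : Par1 l n) nu : above (row_keys a) nu -> is_shape l nu ->
  size nu = n -> exists2 b : Par1 l n, row_keys b = nu & par_lt a b.
Proof.
move=> anu sh sz; have [b bnu] := shape_par l_gt0 sh sz.
by exists b => //; apply: (above_par_lt l_gt0); rewrite bnu.
Qed.

(** A product through the idempotent of a shape above [a] is cut open there; the
    right half is straightened, and the left half is the image under [star] of a
    product that is straightened in the same way.  Two tableaux meet in a cell,
    everything else lies in the ideal of still more dominant shapes. *)
Lemma idl_blob_above (a : Par1 l n) z : idl n E (above (row_keys a)) z -> blob_above red a z.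
Proof.
suff gen nu m m' : is_shape l nu -> size nu = n -> above (row_keys a) nu ->
    mono n m -> mono n m' -> blob_above red a (m * E (map rho nu) * m').
  elim=> [x [nu [m [m' [[h1 h2 h3] [h4 h5 ->]]]]]||x y _ hx _ hy]; first exact: gen.
    exact: lin_span0.
  exact: lin_spanB.
move: {2}(sumn nu).+1 (ltnSn (sumn nu)) => N; elim: N nu m m' => // N IHN nu m m'.
rewrite ltnS => lN sh sz anu hm hm'.
have G : gideal P Y n (idl n E (above nu)) := idl_gideal l rho P Y n E (above nu).
have low z' : idl n E (above nu) z' -> blob_above red a z'.
  elim=> [x [nu' [u [u' [[h1 h2 h3] [h4 h5 ->]]]]]||x y _ hx _ hy]; last exact: lin_spanB.
    case: h3 => s' d ne; apply: IHN => //; last first.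
      exact: (upper_above (row_keys_shape l_gt0 a) sh h1).
    apply: leq_trans lN; apply: dom_sumn_lt => //.
    - exact: shape_sorted h1.
    - exact: shape_sorted sh.
  exact: lin_span0.
have [b bnu ab] := blob_aboveE anu sh sz; rewrite -{}bnu in sh sz anu G low lN *.
set eb := E _.
have -> : m * eb * m' = m * (eb * m') by rewrite mulrA.
have := row_span b hm'; elim=> [x||x y _ hx _ hy]; last 1 first.
- by rewrite mulrBr; apply: lin_spanB.
- case=> [[t ->]|h]; last by apply: low; apply: (gMl G).
  have vt := mono_kred (val t).
  have -> : m * (eb * Psi (kred b (keys (val t)))) =
      star (eb * star m) * Psi (kred b (keys (val t))).
    by rewrite starM starK star_E mulrA.
  have := row_span b (star_mono hm); elim=> [x'||x' y' _ hx _ hy]; last 1 first.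
  - by rewrite starB mulrBl; apply: lin_spanB.
  - case=> [[s ->]|h].
      rewrite starM star_E; apply: lin_span_in; exists b, s, t; split=> //.
      by rewrite cellE mulrA.
    by apply: low; apply: (gMr G) => //; apply: star_idl.
  - by rewrite star0 mul0r; apply: lin_span0.
by rewrite mulr0; apply: lin_span0.
Qed.

Section JucysMurphy.
Variable q : F.
Notation JM := (blob_JM q kappa).

Lemma sum_idm : \sum_i idm i = 1.
Proof.
rewrite -cls1 -(presP (blob_klr (klr_sum1 F n kappa))).
by rewrite (big_morph (cls _) (@cls_add _ _ _) (@cls0 _ _ _)).
Qed.

Lemma Y_idm (k : 'I_n) i : Y k * idm i = idm i * Y k.
Proof.
by have := presP (blob_klr (klr_y_idem F kappa k i)); rewrite bYE !clsE.
Qed.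

Lemma YC (k k' : 'I_n) : Y k * Y k' = Y k' * Y k.
Proof.
by have := presP (blob_klr (klr_yy F kappa k k')); rewrite !bYE !clsE.
Qed.

Lemma idmM i j : idm i * idm j = if i == j then idm i else 0.
Proof.
have := presP (blob_klr (klr_idem F kappa i j)); rewrite clsE => ->.
by case: ifP.
Qed.

Lemma blob_JME (k : 'I_n) :
  JM k = \sum_(i : {ffun 'I_n -> 'Z_e}) qpow q (i k) *: ((1 - Y k) * idm i).
Proof.
pose phi : klrAlg F n kappa -> B := @klr_to_blob F e l n kappa.
have phiD : {morph phi : x y / x + y}.
  by move=> x y; rewrite -(clsP x) -(clsP y) -cls_add /phi !klr_to_blob_cls cls_add.
have phi0 : phi 0 = 0 by rewrite -cls0 /phi klr_to_blob_cls cls0.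
rewrite /blob_JM -[LHS]/(phi _) /klr_JM (big_morph phi phiD phi0); apply: eq_bigr => i _.
have -> : qpow q (i k) *: ((1 - klr_y F kappa k) * klr_idm F kappa i) =
    cls _ (TScale (qpow q (i k)) (TMul (TAdd TOne (TOpp (TGen (KY e k)))) (TGen (KIdem i)))).
  by rewrite !clsE.
by rewrite /phi klr_to_blob_cls !clsE bYE.
Qed.

Lemma Y1_idm (k : 'I_n) i : (1 - Y k) * idm i = idm i * (1 - Y k).
Proof. by rewrite mulrBl mulrBr mul1r mulr1 Y_idm. Qed.

Lemma idm_JM (k : 'I_n) i : idm i * JM k = qpow q (i k) *: (idm i * (1 - Y k)).
Proof.
rewrite blob_JME mulr_sumr (bigD1 i) //= big1 => [|j ji].
  by rewrite addr0 -presZAr Y1_idm mulrA idmM eqxx.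
by rewrite -presZAr Y1_idm mulrA idmM eq_sym (negPf ji) mul0r scaler0.
Qed.

Lemma JM_comm (k k' : 'I_n) : JM k * JM k' = JM k' * JM k.
Proof.
have h (u v : 'I_n) i : idm i * (JM u * JM v) =
    (qpow q (i u) * qpow q (i v)) *: (idm i * ((1 - Y u) * (1 - Y v))).
  rewrite mulrA idm_JM -presZAl -Y1_idm -mulrA idm_JM -presZAr scalerA; congr (_ *: _).
  by rewrite mulrA Y1_idm mulrA.
rewrite -[LHS]mul1r -[RHS]mul1r -sum_idm !mulr_suml; apply: eq_bigr => i _.
rewrite !h [in LHS]mulrC; congr (_ *: _); congr (_ * _).
apply: commrB; first exact: commr1.
by apply/commr_sym/commrB; [apply: commr1|apply: YC].
Qed.

Lemma star_JM (k : 'I_n) : star (JM k) = JM k.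
Proof.
rewrite blob_JME (big_morph star starD star0); apply: eq_bigr => i _.
by rewrite starZ starM starB star1 star_Y star_idm Y1_idm.
Qed.

(** The idempotent of the residue sequence of [t] is absorbed by the cell. *)
Lemma cell_JM (a : Par1 l n) (s t : Tab a) (k : 'I_n) :
  cell s t * JM k = qpow q (res kappa (tab_node t k)) *: (cell s t - cell s t * Y k).
Proof.
have ct : cell s t = cell s t * idm (res_seq kappa t).
  rewrite cellE -mulrA; congr (_ * _); rewrite idm_keys.
  have [vt at' _] := kredP l_gt0 redP (perm_keys l_gt0 t (initial_tab a)).
  by rewrite [LHS](ePsiE (datum_row a)) // at'.
rewrite ct -mulrA idm_JM ffunE -presZAr; congr (_ *: _).
by rewrite mulrBr mulr1 mulrBr mulrA.
Qed.

(** By [tableau_dot] the new tableaux are at least as dominant as [t] and have fewer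
    inversions, so they are strictly more dominant. *)
Lemma cell_dot (a : Par1 l n) (s t : Std a) (k : 'I_n) : exists r : Std a -> F,
  blob_above red a (cell (val s) (val t) * Y k -
    \sum_(v : Std a | `[< tab_lt (val t) (val v) >]) r v *: cell (val s) (val v)).
Proof.
have kn : (k < size (row_keys a))%N by rewrite size_keys.
have := tableau_dot l_gt0 (datum_row a) (row_keys_shape l_gt0 a) (garnir_row (a := a))
  (dot_row (a := a)) (kredP l_gt0 redP (a := a)) (perm_keys l_gt0 (val t) (initial_tab a)) kn.
move=> hz; rewrite cellE -[star _ * _ * _]mulrA; set S := star _; move: hz.
move: (_ * Y k) => z hz.
have above_l z' : idl n E (above (row_keys a)) z' -> blob_above red a (S * z').
  move=> h; apply: idl_blob_above; apply: (gMl (idl_gideal l rho P Y n E _)) => //.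
  exact/star_mono/mono_kred.
elim: {z} hz => [z|| z z' _ [r hr] _ [r' hr']].
- case=> [[v [sv pv d lv ->]]|h]; last first.
    exists (fun _ => 0); rewrite big1 ?subr0; last by move=> v _; rewrite scale0r.
    by apply: above_l; rewrite size_keys in h.
  have [t' tv] := keys_surj l_gt0 pv; rewrite -tv -(standard_keys l_gt0) in sv d lv *.
  pose v' : Std a := exist _ t' sv; exists (fun u => (u == v')%:R).
  have ltv : tab_lt (val t) t'.
    apply: tdom_tab_lt => // E'; by rewrite E' ltnn in lv.
  rewrite (bigD1 v') /=; last exact/asboolP.
  rewrite eqxx scale1r cellE big1 ?addr0 ?subrr; first exact: lin_span0.
  by move=> u /andP [_ /negPf ->]; rewrite scale0r.
- exists (fun _ => 0); rewrite big1 ?subr0; last by move=> v _; rewrite scale0r.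
  by rewrite mulr0; apply: lin_span0.
exists (fun v => r v - r' v).
have -> : \sum_(v : Std a | `[< tab_lt (val t) (val v) >]) (r v - r' v) *: cell (val s) (val v) =
    \sum_(v : Std a | `[< tab_lt (val t) (val v) >]) r v *: cell (val s) (val v) -
    \sum_(v : Std a | `[< tab_lt (val t) (val v) >]) r' v *: cell (val s) (val v).
  by rewrite -sumrB; apply: eq_bigr => v _; rewrite scalerBl.
set A := \sum_(v | _) _; set A' := \sum_(v | _) _.
have -> : S * (z - z') - (A - A') = S * z - A - (S * z' - A').
  by rewrite mulrBr !opprB addrACA [RHS]addrACA [- A + _]addrC.
exact: lin_spanB.
Qed.
End JucysMurphy.
End Blob.

Theorem theorem40 (F : fieldType) (e l n : nat) (q : F) (khat : 'I_l -> int)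
    (red : 'S_n -> seq 'I_n.-1)
    (e_gt1 : (1 < e)%N) (l_gt1 : (1 < l)%N) (n_gt1 : (1 < n)%N)
    (q_prim : e.-primitive_root q) (q_neq1 : q != 1)
    (khat_saf : strongly_adjacency_free e n khat)
    (redP : forall w : 'S_n, reduced_expr w (red w)) :
  let kappa : 'I_l -> 'Z_e := charge e khat in
  let L (i : 'I_n) : blobAlg F n kappa := blob_JM q kappa i in
  let m (a : Par1 l n) (s t : Std a) : blobAlg F n kappa :=
    cell F kappa red (val s) (val t) in
  [/\ forall i j : 'I_n, L i * L j = L j * L i,
      forall i : 'I_n, blob_star (L i) = L i
    & forall (a : Par1 l n) (s t : Std a) (i : 'I_n),
        exists r : Std a -> F,
          blob_above red a
            (m a s t * L i
             - (qpow q (res kappa (tab_node (val t) i)) *: m a s t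
                + \sum_(v : Std a | `[< tab_lt (val t) (val v) >])
                    r v *: m a s v))].
Proof.
move=> kappa L m; split=> [i j|i|a s t k]; [exact: JM_comm|exact: star_JM|].
have [r hr] := cell_dot F n_gt1 (rho_shift e khat l_gt1) (rho_unlinked e_gt1 l_gt1 khat_saf)
  (two_unit e_gt1 l_gt1 khat_saf) redP s t k.
exists (fun v => - (qpow q (res kappa (tab_node (val t) k)) * r v)).
set c := qpow _ _; rewrite /L /m (cell_JM _ (ltnW l_gt1) n_gt1 redP) -/c.
set X := cell _ _ _ _ _ * _ in hr *.
have -> : \sum_(v : Std a | `[< tab_lt (val t) (val v) >])
      - (c * r v) *: cell F kappa red (val s) (val v) =
    - (c *: \sum_(v : Std a | `[< tab_lt (val t) (val v) >])
      r v *: cell F kappa red (val s) (val v)).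
  rewrite scaler_sumr -sumrN; apply: eq_bigr => v _.
  by rewrite scaleNr scalerA.
have h := lin_spanZ (- c) hr.
move: h; rewrite scalerBr !scaleNr opprK scalerBr opprD opprK addrA.
by rewrite [c *: _ - _ - _]addrAC subrr sub0r.
Qed.
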